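(* Let $\Sigma(A,B,C,\mathbf{G})$ be an $L^\infty$-BIBO stable system node on $(U,X,Y)$ and let $P\in\mathcal{L}(X)$. If both system nodes $\Sigma\big(A+P,B,\mathbb{I},(\cdot\,\mathbb{I}-(A+P))^{-1}B\big)$ and $\Sigma\big(A,\mathbb{I},C,C(\cdot\,\mathbb{I}-A)^{-1}\big)$ are $L^\infty$-BIBO stable, then any additively perturbed system node $\Sigma(A+P,B,C,\widetilde{\mathbf{G}})$ is $L^\infty$-BIBO stable.
   Context: All Banach spaces are complex. $\mathbb{C}_\alpha=\{z\in\mathbb{C}:\operatorname{Re}z>\alpha\}$. For the generator $A$ of a strongly continuous semigroup $\mathbb{T}=(\mathbb{T}(t))_{t\ge0}$ on a Banach space $X$, $\omega(\mathbb{T})=\inf\{\omega\in\mathbb{R}:\sup_{t>0}e^{-t\omega}\|\mathbb{T}(t)\|<\infty\}$ is its growth bound. $X_1$ is $D(A)$ with norm $\|(\beta I-A)x\|_X$ and $X_{-1}$ is the completion of $X$ with respect to $\|(\beta I-A)^{-1}x\|_X$, for a fixed $\beta\in\rho(A)$. The semigroup extends uniquely to a strongly continuous semigroup on $X_{-1}$ whose generator $X\to X_{-1}$ extends $A$; the extensions are again denoted $\mathbb{T}$ and $A$. For $P\in\mathcal{L}(X)$, $A+P$ with domain $D(A)$ generates a strongly continuous semigroup, and its spaces $X_1,X_{-1}$ coincide with those of $A$ up to equivalent norms. $\mathbb{I}$ is the identity. System node: for Banach spaces $U,X,Y$, a system node on $(U,X,Y)$ is a collection $\Sigma(A,B,C,\mathbf{G})$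 where $A:D(A)\subset X\to X$ generates a strongly continuous semigroup $\mathbb{T}$ on $X$, $B\in\mathcal{L}(U,X_{-1})$, $C\in\mathcal{L}(X_1,Y)$, and $\mathbf{G}:\mathbb{C}_{\omega(\mathbb{T})}\to\mathcal{L}(U,Y)$ (the transfer function) is analytic with $\mathbf{G}(\alpha)-\mathbf{G}(\beta)=C[(\alpha I-A)^{-1}-(\beta I-A)^{-1}]B$ for all $\alpha,\beta\in\mathbb{C}_{\omega(\mathbb{T})}$. Transfer functions for a given triple are unique only up to an additive constant; $\widetilde{\mathbf{G}}$ denotes any transfer function for the triple $(A+P,B,C)$. In $\Sigma(\cdot,B,\mathbb{I},\cdot)$ the output space is $X$; in $\Sigma(\cdot,\mathbb{I},C,\cdot)$ the input space is $X$. Combined observation/feedthrough operator: $C\&D\begin{bmatrix}x\\ u\end{bmatrix}=C[x-(\beta I-A)^{-1}Bu]+\mathbf{G}(\beta)u$ with $\beta\in\mathbb{C}_{\omega(\mathbb{T})}$ (independent of the choice of $\beta$) and domain $D(C\&D)=\{\begin{bmatrix}x\\ u\end{bmatrix}\in X\times U: Ax+Bu\in X\}$. Generalised solution in the distributional sense: a triple $(u,x,y)$ with $u\in L^1_{\mathrm{loc}}([0,\infty),U)$, $x\in C([0,\infty),X_{-1})$, $x(t)=\mathbb{T}(t)x_0+\int_0^t\mathbb{T}(t-s)Bu(s)\,\mathrm{d}s$ for some $x_0\in X$ and all $t\ge0$, and $y$ the $Y$-valued distribution (linear functional on $C_c^\infty([0,\infty),Y')$) acting by $y(\varphi)=\int_0^\infty\left\langle\varphi''(t),(C\&D)\int_0^t(t-s)\begin{bmatrix}x(s)\\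 u(s)\end{bmatrix}\mathrm{d}s\right\rangle_{Y',Y}\mathrm{d}t$. A function $y\in L^1_{\mathrm{loc}}([0,\infty),Y)$ is identified with the distribution $\varphi\mapsto\int_0^\infty\langle\varphi(t),y(t)\rangle_{Y',Y}\,\mathrm{d}t$. $L^\infty$-BIBO stability: there exists $c>0$ such that for any generalised solution in the distributional sense $(u,x,y)$ with $u\in L^\infty_{\mathrm{loc}}([0,\infty),U)$ and $x(0)=0$ one has $y\in L^\infty_{\mathrm{loc}}([0,\infty),Y)$ and $\|y\|_{L^\infty([0,t],Y)}\le c\|u\|_{L^\infty([0,t],U)}$ for all $t>0$. *)

(* Defs.v *)
(* Every Banach space is a [completeNormedModType] over the complex numbers
   [R[i]], where [R : realType].  Functions of a time variable are total on [R],
   but only their values on [0,oo) matter. *)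
From HB Require Import structures.
From mathcomp Require Import all_boot all_order all_algebra.
From mathcomp Require Import complex.
From mathcomp Require Import all_classical all_reals all_analysis ess_sup_inf.

Set Implicit Arguments.
Unset Strict Implicit.
Unset Printing Implicit Defensive.

Import Order.TTheory GRing.Theory Num.Theory.
Import numFieldNormedType.Exports.

Local Open Scope complex_scope.
Local Open Scope classical_set_scope.
Local Open Scope ring_scope.

Section Bochner.
Context {R : realType} {E : normedModType R[i]}.
Implicit Types (D : set R) (f : R -> E) (t : R).

Local Notation mu := (@lebesgue_measure R).

(* `|v| lives in R[i]; this is the same number, as a real. *)
Definition rnorm (v : E) : R := complex.Re `|v|.

Definition simple_on D (s : R -> E) : Prop :=
  [/\ finite_set (range s),
      (forall v : E, measurable (s @^-1` [set v])) &
      (forall v : E, v != 0 -> (mu (D `&` s @^-1` [set v]) < +oo)%E)].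

Definition simple_integral D (s : R -> E) : E :=
  \sum_(v \in [set: E]) (fine (mu (D `&` s @^-1` [set v])))%:C *: v.

(* Elements of the Lebesgue-Bochner spaces are represented by functions that
   are everywhere limits of Borel simple functions; every class of Bochner
   measurable functions modulo null sets contains such a representative. *)
Definition strongly_measurable D f : Prop :=
  exists s_ : nat -> R -> E, (forall n, simple_on D (s_ n)) /\
    (forall t, D t -> s_ n t @[n --> \oo] --> f t).

Definition is_bochner_integral D f (I : E) : Prop :=
  strongly_measurable D f /\
  exists s_ : nat -> R -> E,
    [/\ (forall n, simple_on D (s_ n)),
        (\int[mu]_(t in D) (rnorm (f t - s_ n t)%R)%:E)%E @[n --> \oo] --> 0%E &
        simple_integral D (s_ n) @[n --> \oo] --> I].

Definition bochner D f : E := xget 0 (is_bochner_integral D f).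

Definition L1loc f : Prop :=
  strongly_measurable `[0, +oo[ f /\
  forall t, 0 <= t -> (\int[mu]_(s in `[0%R, t]) (rnorm (f s))%:E < +oo)%E.

Definition Linfty_norm t f : \bar R :=
  ess_sup mu ((fun s => (rnorm (f s))%:E) \_ `[0, t]).

Definition Linftyloc f : Prop :=
  strongly_measurable `[0, +oo[ f /\
  forall t, 0 < t -> (Linfty_norm t f < +oo)%E.

Definition second_primitive f t : E :=
  bochner `[0, t] (fun s => (t - s)%:C *: f s).

End Bochner.

Definition complex_integral {R : realType} (D : set R) (f : R -> R[i]) : R[i] :=
  Complex (\int[@lebesgue_measure R]_(t in D) complex.Re (f t))
          (\int[@lebesgue_measure R]_(t in D) complex.Im (f t)).

Definition bounded_op {K : numFieldType} {E F : normedModType K}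
    (T : E -> F) : Prop :=
  linear T /\ exists M : K, forall x, `|T x| <= M * `|x|.

(* Only the values of [opv] on [dom] are meaningful. *)
Record operator (E F : Type) := Op { dom : set E; opv :> E -> F }.

Section Operators.
Context {R : realType} {E : normedModType R[i]}.
Implicit Types (A : operator E E) (T : R -> E -> E).

(* (beta I - A)^{-1} x, with the junk value 0 when there is no solution. *)
Definition resolvent A (beta : R[i]) (x : E) : E :=
  xget 0 [set z | dom A z /\ beta *: z - A z = x].

Definition resolvent_set A : set R[i] :=
  [set beta | (forall x, exists! z, dom A z /\ beta *: z - A z = x) /\
              bounded_op (resolvent A beta)].

Definition c0_semigroup T : Prop :=
  [/\ forall t, 0 <= t -> bounded_op (T t),
      forall x, T 0 x = x,
      forall s t x, 0 <= s -> 0 <= t -> T (s + t) x = T s (T t x) &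
      forall x, T t x @[t --> 0^'+] --> x].

Definition generator T : operator E E :=
  Op [set x | cvg ((h^-1)%:C *: (T h x - x) @[h --> 0^'+])]
     (fun x => lim ((h^-1)%:C *: (T h x - x) @[h --> 0^'+])).

Definition generates A T : Prop :=
  c0_semigroup T /\ dom A = dom (generator T) /\
  (forall x, dom A x -> A x = generator T x).

(* The choice is immaterial: a semigroup generated by A is unique for t >= 0. *)
Definition semigroup A : R -> E -> E :=
  xget (fun (_ : R) (x : E) => x) [set T | generates A T].

Definition growth_bound T : \bar R :=
  ereal_inf [set w%:E | w in [set w : R | exists M : R, forall t x, 0 < t ->
    expR (- (t * w)) * rnorm (T t x) <= M * rnorm x]].

Definition half_plane (a : \bar R) : set R[i] :=
  [set z | (a < (complex.Re z)%:E)%E].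

Definition perturb A (P : E -> E) : operator E E :=
  Op (dom A) (fun x => A x + P x).

End Operators.

Section Extrapolation.
Context {R : realType} {X Xm1 : completeNormedModType R[i]}.
Implicit Types (j : X -> Xm1) (A : operator X X).

(* Xm1, with the embedding j, is the completion of X for the norm
   |(beta I - A)^{-1} x|, up to an equivalent norm.  Allowing an equivalent norm
   makes the notion independent of beta and lets the same space serve for A
   and for A + P. *)
Definition extrapolation_space j A : Prop :=
  [/\ linear j, dense (range j) &
      exists beta (m M : R[i]), [/\ resolvent_set A beta, 0 < m, 0 < M &
        forall x, m * `|resolvent A beta x| <= `|j x| /\
                  `|j x| <= M * `|resolvent A beta x|]].

(* Again unique for t >= 0, since the range of j is dense. *)
Definition ext_semigroup j A : R -> Xm1 -> Xm1 :=
  xget (fun (_ : R) (z : Xm1) => z) [set S | c0_semigroup S /\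
    forall t x, 0 <= t -> S t (j x) = j (semigroup A t x)].

(* The generator of the extended semigroup has domain j(X), whence a map
   X -> X_{-1} that extends A. *)
Definition ext_op j A (x : X) : Xm1 := generator (ext_semigroup j A) (j x).

Definition ext_resolvent j A (beta : R[i]) (z : Xm1) : X :=
  xget 0 [set x | beta *: j x - ext_op j A x = z].

(* C : X_1 -> Y is given by a function on X of which only the values on the
   domain of A matter. *)
Definition bounded_X1 {Y : completeNormedModType R[i]} A (C : X -> Y) : Prop :=
  (forall (a : R[i]) x y, dom A x -> dom A y ->
     C (a *: x + y) = a *: C x + C y) /\
  exists beta (M : R[i]), resolvent_set A beta /\
    forall x, dom A x -> `|C x| <= M * `|beta *: x - A x|.

End Extrapolation.

(* Complex differentiability in operator norm on an open set O. *)
Definition analytic_on {R : realType} {U Y : normedModType R[i]}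
    (O : set R[i]) (G : R[i] -> U -> Y) : Prop :=
  forall z, O z -> exists2 L : U -> Y, bounded_op L &
    forall eps : R[i], 0 < eps -> exists2 delta : R[i], 0 < delta &
      forall h, `|h| < delta -> O (z + h) ->
      forall u, `|G (z + h) u - G z u - h *: L u| <= eps * `|h| * `|u|.

Record node_data (R : realType) (U X Xm1 Y : completeNormedModType R[i]) :=
  Sigma { opA : operator X X;
          opB : U -> Xm1;
          opC : X -> Y;
          tfG : R[i] -> U -> Y }.

Section SystemNode.
Context {R : realType} {U X Xm1 Y : completeNormedModType R[i]}.
Variable j : X -> Xm1.
Implicit Type N : node_data U X Xm1 Y.

Definition C_omega (A : operator X X) : set R[i] :=
  half_plane (growth_bound (semigroup A)).

Definition system_node N : Prop :=
  let: Sigma A B C G := N in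
  [/\ exists T, generates A T,
      extrapolation_space j A,
      bounded_op B,
      bounded_X1 A C &
      [/\ forall z, C_omega A z -> bounded_op (G z),
          analytic_on (C_omega A) G &
          forall a b, C_omega A a -> C_omega A b -> forall u,
            G a u - G b u =
            C (ext_resolvent j A a (B u) - ext_resolvent j A b (B u))]].

(* The operator C&D; its value does not depend on the point chosen in the
   half-plane. *)
Definition CD N : operator (X * U) Y :=
  let: Sigma A B C G := N in
  let beta := xget 0 (C_omega A) in
  Op [set xu | exists w : X, ext_op j A xu.1 + B xu.2 = j w]
     (fun xu => C (xu.1 - ext_resolvent j A beta (B xu.2)) + G beta xu.2).

End SystemNode.

(* An element of C_c^oo([0,oo), Y'), given with all its derivatives: [jet k t]
   is the k-th derivative at t, as a functional on Y.  Derivatives are taken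
   within [0,oo) for the norm of Y', and nothing is required for t < 0. *)
Record test_function (R : realType) (Y : completeNormedModType R[i]) := Test {
  jet : nat -> R -> Y -> R[i];
  jet_dual : forall k t, 0 <= t -> bounded_op (jet k t : Y -> R[i]^o);
  jet_derive : forall k t, 0 <= t ->
    forall eps : R, 0 < eps -> exists2 delta : R, 0 < delta &
      forall s, 0 <= s -> `|s - t| < delta -> forall v : Y,
        `|jet k s v - jet k t v - (s - t)%:C * jet k.+1 t v|
          <= (eps * `|s - t|)%:C * `|v|;
  jet_support : exists b : R, forall t v, b < t -> jet 0 t v = 0 }.

Definition distribution (R : realType) (Y : completeNormedModType R[i]) :=
  test_function Y -> R[i].

Definition distribution_of_fun {R : realType} {Y : completeNormedModType R[i]}
    (f : R -> Y) : distribution Y :=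
  fun phi => complex_integral `[0, +oo[ (fun t => jet phi 0 t (f t)).

Section BIBO.
Context {R : realType} {U X Xm1 Y : completeNormedModType R[i]}.
Variables (j : X -> Xm1) (N : node_data U X Xm1 Y).

(* int_0^t (t - s) x(s) ds is formed in X_{-1}; it belongs to X. *)
Definition state_primitive (x : R -> Xm1) (t : R) : X :=
  xget 0 [set z | j z = second_primitive x t].

Definition output (u : R -> U) (x : R -> Xm1) : distribution Y :=
  fun phi => complex_integral `[0, +oo[
    (fun t => jet phi 2 t (CD j N (state_primitive x t, second_primitive u t))).

Definition generalised_solution
    (u : R -> U) (x : R -> Xm1) (y : distribution Y) : Prop :=
  [/\ L1loc u,
      {within `[0, +oo[, continuous x},
      exists x0 : X, forall t, 0 <= t ->
        x t = ext_semigroup j (opA N) t (j x0) +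
          bochner `[0, t] (fun s => ext_semigroup j (opA N) (t - s) (opB N (u s))) &
      y = output u x].

Definition BIBO_stable : Prop :=
  exists2 c : R, 0 < c &
    forall u x y, generalised_solution u x y -> Linftyloc u -> x 0 = 0 ->
    exists f : R -> Y, [/\ Linftyloc f, y = distribution_of_fun f &
      forall t, 0 < t -> (Linfty_norm t f <= c%:E * Linfty_norm t u)%E].

End BIBO.

(* Main.v *)
Require Import Defs.
From HB Require Import structures.
From mathcomp Require Import all_boot all_order all_algebra.
From mathcomp Require Import complex ring lra.
From mathcomp Require Import all_classical all_reals all_analysis ess_sup_inf
  measurable_realfun.

Set Implicit Arguments.
Unset Strict Implicit.
Unset Printing Implicit Defensive.

Import Order.TTheory GRing.Theory Num.Theory.
Import numFieldNormedType.Exports.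

Local Open Scope complex_scope.
Local Open Scope classical_set_scope.
Local Open Scope ring_scope.

(** Let [u] be a locally bounded input and [x] the solution, with zero initial
    state, of [x' = (A + P) x + B u] in the extrapolation space [Xm1].  The output
    of the node that observes the state itself is the second distributional
    derivative of the twice integrated state, and stability says that it is a
    locally bounded function [z], controlled by [u].  Hence the state is [z] in
    the sense that its primitive is the primitive of [z] (state_output), although
    [x] has no reason to take values in [X].  The perturbation then acts as the
    locally bounded input [P z]: in integrated form, [x] solves the unperturbed
    equation [x' = A x + B u + j (P z)], so that by uniqueness [x = x1 + x2], where
    [x1] is driven by [u] in the given node and [x2] by [P z] in the node with
    input operator [j] (mild_perturb).  Accordingly the output of [x] is the sum
    of the outputs of [x1] and [x2], which the two remaining stability hypotheses
    control, and of [E u], where [E] is a bounded operator that accounts for the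
    additive constant in transfer functions and for the base points chosen in the
    definition of outputs (observation_split, output_split).

    Solutions are handled through the equation integrated once: [w] is the
    primitive of [x], it lies in [X], and [A w = x - (primitive of the forcing)].
    Convolutions with the semigroup satisfy it (prim_conv_resolvent) and it has
    no other continuous solution (homogeneous_eq0).  The extrapolation space
    enters through one resolvent of [A], extended to an isomorphism from [Xm1] to
    [X] (extrapolation_exists); the resolvents at all points of the half-plane
    follow by a Neumann series for a rescaled semigroup (resolvent_shift).

    Identities between Bochner integrals are reduced to Lebesgue integrals of
    real functions by bounded real functionals, which separate points by
    Hahn-Banach (norming_rfun, bochner_rfun); Fubini on triangles (fubini_kernel)
    then gives all convolution identities.  On the side of distributions, a double
    integration by parts (jet_second_primitive) identifies functions with second
    derivatives of their second primitives, and explicit test functions built on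
    [exp (- l / r)] show that a continuous function is determined by its second
    distributional derivative on the closed half-line (jet_separation,
    second_derivative_unique). *)

(** * Real norms, limits and bounded operators *)

Section RNorm.
Context {R : realType} {E : normedModType R[i]}.
Implicit Types (v w : E) (r : R).

Lemma normC_rnorm v : `|v| = (rnorm v)%:C.
Proof. by rewrite /rnorm RRe_real// ger0_real. Qed.

Lemma rnorm_ge0 v : 0 <= rnorm v.
Proof. by rewrite -ler0c -normC_rnorm. Qed.

Lemma rnorm0 : rnorm (0 : E) = 0.
Proof. by rewrite /rnorm normr0. Qed.

Lemma rnorm0_eq0 v : rnorm v = 0 -> v = 0.
Proof. by move=> v0; apply/eqP; rewrite -normr_eq0 normC_rnorm v0. Qed.

Lemma rnormN v : rnorm (- v) = rnorm v.
Proof. by rewrite /rnorm normrN. Qed.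

Lemma rdistC v w : rnorm (v - w) = rnorm (w - v).
Proof. by rewrite -rnormN opprB. Qed.

Lemma ler_rnormD v w : rnorm (v + w) <= rnorm v + rnorm w.
Proof. by rewrite -lecR rmorphD /= -!normC_rnorm ler_normD. Qed.

Lemma ler_rnormB v w : rnorm (v - w) <= rnorm v + rnorm w.
Proof. by rewrite -(rnormN w); exact: ler_rnormD. Qed.

Lemma rnormZ (c : R[i]) v : rnorm (c *: v) = complex.Re `|c| * rnorm v.
Proof.
apply: complexI; rewrite -normC_rnorm normrZ normC_rnorm rmorphM/=.
by rewrite RRe_real// ger0_real.
Qed.

Lemma normc_real r : `|r%:C| = `|r|%:C :> R[i].
Proof. by rewrite normc_def /= expr0n /= addr0 sqrtr_sqr. Qed.

Lemma rnormZr r v : rnorm (r%:C *: v) = `|r| * rnorm v.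
Proof. by rewrite rnormZ normc_real. Qed.

Lemma rdist_triangle u v w : rnorm (u - w) <= rnorm (u - v) + rnorm (v - w).
Proof. by apply: le_trans (ler_rnormD _ _); rewrite addrA subrK. Qed.

Lemma ler_rdist v w : `|rnorm v - rnorm w| <= rnorm (v - w).
Proof.
rewrite ler_norml lerBlDr lerNl opprB lerBlDr; apply/andP; split.
  rewrite rdistC; apply: le_trans (ler_rnormD _ _).
  by rewrite subrK.
by apply: le_trans (ler_rnormD _ _); rewrite subrK.
Qed.

Lemma re_gt0 (e : R[i]) : 0 < e -> 0 < complex.Re e /\ e = (complex.Re e)%:C.
Proof.
move=> e0; split; last by rewrite RRe_real// gtr0_real.
by move: e0; rewrite ltcE/= => /andP[].
Qed.

Lemma rcvgP {T : Type} (F : set_system T) {FF : Filter F} (f : T -> E) (l : E) :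
  f x @[x --> F] --> l <-> rnorm (f x - l) @[x --> F] --> (0 : R).
Proof.
split=> [/cvgrPdist_lt fl|/cvgrPdist_lt fl]; apply/cvgrPdist_lt => e e0.
  have e0' : 0 < e%:C by rewrite ltcR.
  have := fl _ e0'; apply: filterS => x.
  by rewrite normC_rnorm ltcR sub0r normrN ger0_norm ?rnorm_ge0 // rdistC.
have [re eE] := re_gt0 e0.
have := fl _ re; apply: filterS => x.
rewrite sub0r normrN ger0_norm ?rnorm_ge0 // => h.
by rewrite eE normC_rnorm ltcR rdistC.
Qed.

Lemma rcvg_norm {T : Type} (F : set_system T) {FF : Filter F} (f : T -> E) (l : E) :
  f x @[x --> F] --> l -> rnorm (f x) @[x --> F] --> rnorm l.
Proof.
move=> /rcvgP/cvgrPdist_lt fl; apply/cvgrPdist_lt => e /fl.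
apply: filterS => x; rewrite sub0r normrN ger0_norm ?rnorm_ge0// => h.
by rewrite distrC; exact: le_lt_trans (ler_rdist _ _) h.
Qed.

Lemma rcvg_dominated {T : Type} (F : set_system T) {FF : Filter F}
    (f : T -> E) (g : T -> R) (l : E) :
  (\forall x \near F, rnorm (f x - l) <= g x) -> g x @[x --> F] --> (0 : R) ->
  f x @[x --> F] --> l.
Proof.
move=> fg g0; apply/rcvgP; apply: (squeeze_cvgr (f := cst 0) (h := g)).
- by apply: filterS fg => x fx; rewrite rnorm_ge0.
- exact: cvg_cst.
- exact: g0.
Qed.

End RNorm.

Section Completeness.
Context {R : realType} {E : completeNormedModType R[i]}.

Lemma rcauchy_cvg (u : nat -> E) :
  (forall e : R, 0 < e -> exists N, forall m n, (N <= m)%N -> (N <= n)%N ->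
     rnorm (u m - u n) < e) ->
  exists l : E, u n @[n --> \oo] --> l.
Proof.
move=> cu; suff /cvg_ex : cvg (u @ \oo) by [].
apply: cauchy_cvg; apply: cauchy_exP => e e0.
have [re eE] := re_gt0 e0.
have [N uN] := cu _ re.
exists (u N); exists N => // n /= Nn.
rewrite -ball_normE /ball_ /= eE normC_rnorm ltcR; exact: uN.
Qed.

Lemma geometric_cvg (u : nat -> E) (c q : R) : 0 <= c -> 0 <= q -> q < 1 ->
  (forall n, rnorm (u n.+1 - u n) <= c * q ^+ n) ->
  exists2 l : E, u n @[n --> \oo] --> l &
    forall n, rnorm (l - u n) <= c * q ^+ n / (1 - q).
Proof.
move=> c0 q0 q1 uq.
have q10 : 0 < 1 - q by rewrite subr_gt0.
have tail n k : rnorm (u (n + k)%N - u n) <= c * q ^+ n * (1 - q ^+ k) / (1 - q).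
  elim: k => [|k IH].
    by rewrite addn0 subrr rnorm0 expr0 subrr mulr0 mul0r.
  rewrite addnS; apply: (le_trans (rdist_triangle _ (u (n + k)%N) _)).
  apply: (le_trans (lerD (uq _) IH)).
  rewrite -(ler_pM2r q10) mulrDl !divfK ?gt_eqF// exprD exprS.
  by rewrite le_eqVlt; apply/orP; left; apply/eqP; ring.
have tail' n m : (n <= m)%N -> rnorm (u m - u n) <= c * q ^+ n / (1 - q).
  move=> nm; rewrite -(subnKC nm); apply: le_trans (tail _ _) _.
  rewrite ler_pM2r ?invr_gt0// ler_piMr ?mulr_ge0 ?exprn_ge0//.
  by rewrite gerBl exprn_ge0.
have geo0 : c * q ^+ n / (1 - q) @[n --> \oo] --> (0 : R).
  have -> : (fun n => c * q ^+ n / (1 - q)) = geometric (c / (1 - q)) q.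
    by apply/funext => n; rewrite /geometric /=; ring.
  by apply: cvg_geometric; rewrite ger0_norm.
have [l ul] : exists l : E, u n @[n --> \oo] --> l.
  apply: rcauchy_cvg => e e0.
  have /cvgrPdist_lt/(_ _ e0)[N _ HN] := geo0.
  have HN' n : (N <= n)%N -> c * q ^+ n / (1 - q) < e.
    move=> Nn; have := HN n Nn; rewrite /= sub0r normrN ger0_norm//.
    by rewrite divr_ge0 ?mulr_ge0 ?exprn_ge0// ltW.
  exists N => m n Nm Nn.
  have [mn|/ltnW nm] := leqP m n.
    by rewrite rdistC; apply: le_lt_trans (tail' _ _ mn) (HN' _ Nm).
  by apply: le_lt_trans (tail' _ _ nm) (HN' _ Nn).
exists l => // n.
have ulk : rnorm (u m - u n) @[m --> \oo] --> rnorm (l - u n).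
  apply: rcvg_norm; exact: cvgB ul (cvg_cst _).
rewrite -(cvg_lim (@Rhausdorff R) ulk).
apply: limr_le; first by apply/cvg_ex; exists (rnorm (l - u n)).
by exists n => // m /= nm; exact: tail'.
Qed.

End Completeness.

Section BoundedOperators.
Context {R : realType}.

Lemma linD {E F : lmodType R[i]} (T : E -> F) x y :
  linear T -> T (x + y) = T x + T y.
Proof. by move=> lT; rewrite -{1}(scale1r x) lT scale1r. Qed.

Lemma lin0 {E F : lmodType R[i]} (T : E -> F) : linear T -> T 0 = 0.
Proof.
by move=> lT; apply: (addrI (T 0)); rewrite -linD// !addr0.
Qed.

Lemma linZ {E F : lmodType R[i]} (T : E -> F) (c : R[i]) x :
  linear T -> T (c *: x) = c *: T x.
Proof. by move=> lT; rewrite -{1}(addr0 (c *: x)) lT lin0// addr0. Qed.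

Lemma linN {E F : lmodType R[i]} (T : E -> F) x : linear T -> T (- x) = - T x.
Proof. by move=> lT; rewrite -scaleN1r linZ// scaleN1r. Qed.

Lemma linB {E F : lmodType R[i]} (T : E -> F) x y :
  linear T -> T (x - y) = T x - T y.
Proof. by move=> lT; rewrite linD// linN. Qed.

Lemma bounded_opP {E F : normedModType R[i]} (T : E -> F) :
  bounded_op T <->
  linear T /\ exists2 K : R, 0 <= K & forall x, rnorm (T x) <= K * rnorm x.
Proof.
split=> [[lT [M TM]]|[lT [K K0 TK]]]; split=> //; last first.
  by exists K%:C => x; rewrite !normC_rnorm -rmorphM/= lecR.
exists (complex.Re `|M|) => [|x].
  by rewrite -ler0c RRe_real ?ger0_real.
have [x0|x0] := eqVneq x 0.
  by rewrite x0 (lin0 lT) !rnorm0 mulr0.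
have xp : 0 < `|x| by rewrite normr_gt0.
have M0 : 0 <= M.
  have : 0 <= M * `|x| by apply: le_trans (TM x).
  by rewrite pmulr_lge0.
have ME : (complex.Re `|M|)%:C = M by rewrite RRe_real ?ger0_real// ger0_norm.
move: ME (TM x); set m := complex.Re _ => <-.
by rewrite [`|T x|]normC_rnorm [`|x|]normC_rnorm -rmorphM lecR.
Qed.

Lemma bounded_cvg {E F : normedModType R[i]} (T : E -> F) :
  bounded_op T -> forall {I : Type} (Fi : set_system I) {FF : Filter Fi} (f : I -> E) l,
  f x @[x --> Fi] --> l -> T (f x) @[x --> Fi] --> T l.
Proof.
move=> /bounded_opP[lT [K K0 TK]] I Fi FF f l /rcvgP fl.
apply: (@rcvg_dominated _ _ _ _ _ _ (fun x => K * rnorm (f x - l))).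
  by apply: nearW => x; rewrite -linB.
by rewrite -[X in _ --> X](mulr0 K); apply: cvgMr.
Qed.

Lemma bounded_comp {E F G : normedModType R[i]} (S : F -> G) (T : E -> F) :
  bounded_op S -> bounded_op T -> bounded_op (fun x => S (T x)).
Proof.
move=> /bounded_opP[lS [K K0 SK]] /bounded_opP[lT [L L0 TL]]; apply/bounded_opP.
split; first by move=> a x y; rewrite lT lS.
exists (K * L); first exact: mulr_ge0.
move=> x; apply: le_trans (SK _) _; rewrite -mulrA; exact: ler_wpM2l.
Qed.

Lemma bounded_add {E F : normedModType R[i]} (S T : E -> F) :
  bounded_op S -> bounded_op T -> bounded_op (fun x => S x + T x).
Proof.
move=> /bounded_opP[lS [K K0 SK]] /bounded_opP[lT [L L0 TL]]; apply/bounded_opP.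
split; first by move=> a x y; rewrite lT lS scalerDr addrACA.
exists (K + L); first exact: addr_ge0.
by move=> x; apply: le_trans (ler_rnormD _ _) _; rewrite mulrDl lerD.
Qed.

Lemma bounded_scale {E F : normedModType R[i]} (c : R[i]) (T : E -> F) :
  bounded_op T -> bounded_op (fun x => c *: T x).
Proof.
move=> /bounded_opP[lT [L L0 TL]]; apply/bounded_opP.
split; first by move=> a x y; rewrite lT scalerDr !scalerA (mulrC c).
exists (complex.Re `|c| * L).
  by rewrite mulr_ge0// -ler0c RRe_real ?ger0_real.
move=> x; rewrite rnormZ -mulrA ler_wpM2l//.
by rewrite -ler0c RRe_real ?ger0_real.
Qed.

Lemma bounded_id {E : normedModType R[i]} : bounded_op (fun x : E => x).
Proof.
by apply/bounded_opP; split=> //; exists 1 => // x; rewrite mul1r.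
Qed.

Lemma bounded_opp {E : normedModType R[i]} : bounded_op (fun x : E => - x).
Proof.
have := bounded_scale (-1) (@bounded_id E); congr bounded_op.
by apply/funext => x; rewrite scaleN1r.
Qed.

Lemma bounded_sub {E F : normedModType R[i]} (S T : E -> F) :
  bounded_op S -> bounded_op T -> bounded_op (fun x => S x - T x).
Proof. by move=> bS bT; exact: bounded_add bS (bounded_comp bounded_opp bT). Qed.

End BoundedOperators.

(** * Bounded real functionals *)

Section HahnBanach.
Context {R : realType} {E : normedModType R[i]}.

(** Bounded real-linear functionals.  Real values keep all scalar integrals
    within the Lebesgue integral of real functions. *)
Definition is_rfun (psi : E -> R) : Prop :=
  [/\ forall v w, psi (v + w) = psi v + psi w,
      forall (r : R) v, psi (r%:C *: v) = r * psi v &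
      exists2 K : R, 0 <= K & forall v, `|psi v| <= K * rnorm v].

(** Partially defined functionals are encoded by their graphs, which are closed
    under union of chains. *)
Let graph (G : set (E * R)) : Prop :=
  [/\ forall v a w b, G (v, a) -> G (w, b) -> G (v + w, a + b),
      forall (r : R) v a, G (v, a) -> G (r%:C *: v, r * a) &
      forall v a, G (v, a) -> a <= rnorm v].

Let graph_fun G v a b : graph G -> G (v, a) -> G (v, b) -> a = b.
Proof.
case=> Ga Gs Gb Ha Hb.
have H1 := Gb _ _ (Ga _ _ _ _ Ha (Gs (-1) _ _ Hb)).
have H2 := Gb _ _ (Ga _ _ _ _ Hb (Gs (-1) _ _ Ha)).
have e : (v + (-1)%:C *: v) = 0 :> E by rewrite rmorphN rmorph1 scaleN1r subrr.
rewrite e rnorm0 in H1 H2; apply/eqP; rewrite eq_le; apply/andP; split.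
  by move: H1; rewrite mulN1r subr_le0.
by move: H2; rewrite mulN1r subr_le0.
Qed.

(** One more dimension: a value at [w] is found between the lower and the upper
    bounds that the points of the graph impose. *)
Let graph_extend G w : graph G -> (exists a, G (0, a)) ->
  exists G', [/\ graph G', G `<=` G' & exists b, G' (w, b)].
Proof.
move=> gG [a0 G0]; case: (gG) => Ga Gs Gb.
have [[b Gwb]|nw] := pselect (exists b, G (w, b)).
  by exists G; split=> //; exists b.
pose lo := [set x : R | exists v a, G (v, a) /\ x = a - rnorm (v - w)].
have lohi v a v' a' : G (v, a) -> G (v', a') -> 
    a - rnorm (v - w) <= rnorm (v' + w) - a'.
  move=> h h'; rewrite lerBlDr addrAC lerBrDr.
  apply: (le_trans (Gb _ _ (Ga _ _ _ _ h h'))).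
  rewrite addrC; apply: le_trans (ler_rnormD _ _).
  by rewrite addrACA addNr addr0.
have lo0 : lo !=set0 by exists (a0 - rnorm (0 - w)), 0, a0.
have loub : has_ubound lo.
  by exists (rnorm (0 + w) - a0) => x [v [a [h ->]]]; exact: lohi.
pose c := sup lo.
have cl v a : G (v, a) -> a - rnorm (v - w) <= c.
  by move=> h; apply: ub_le_sup => //; exists v, a.
have ch v a : G (v, a) -> c <= rnorm (v + w) - a.
  by move=> h; apply: ge_sup => // x [v' [a' [h' ->]]]; exact: lohi.
exists [set p | exists v a (r : R), G (v, a) /\ p = (v + r%:C *: w, a + r * c)].
split; last 1 first.
- by exists (a0 + 1 * c), 0, a0, 1; split=> //; rewrite scale1r add0r.
- split.
  + move=> _ _ _ _ [v [a [r [h [-> ->]]]]] [v' [a' [r' [h' [-> ->]]]]].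
    exists (v + v'), (a + a'), (r + r'); split; first exact: Ga.
    by rewrite addrACA rmorphD scalerDl mulrDl addrACA [in LHS](addrACA a).
  + move=> s _ _ [v [a [r [h [-> ->]]]]].
    exists (s%:C *: v), (s * a), (s * r); split; first exact: Gs.
    by rewrite scalerDr scalerA rmorphM mulrDr mulrA.
  + move=> _ _ [v [a [r [h [-> ->]]]]].
    have [r0|r0|->] := ltgtP r 0; last first.
    * by rewrite scale0r addr0 mul0r addr0; exact: Gb.
    * have := ch _ _ (Gs r^-1 _ _ h); rewrite lerBrDr.
      rewrite -(ler_pM2l r0) mulrDr mulrA divff ?gt_eqF// mul1r addrC.
      rewrite -[r in r * rnorm _]gtr0_norm// -rnormZr scalerDr scalerA -rmorphM.
      by rewrite divff ?gt_eqF// scale1r.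
    * have nr0 : 0 < - r by rewrite oppr_gt0.
      have := cl _ _ (Gs (- r)^-1 _ _ h); rewrite lerBlDr.
      rewrite -(ler_pM2l nr0) mulrDr mulrA divff ?gt_eqF// mul1r mulNr addrC.
      have -> : rnorm (v + r%:C *: w) = - r * rnorm (((- r)^-1)%:C *: v - w).
        rewrite -[X in _ = X * _](gtr0_norm nr0) -rnormZr scalerBr scalerA -rmorphM.
        by rewrite divff ?gt_eqF// scale1r rmorphN scaleNr opprK.
      by move=> hh; lra.
- move=> [v a] h; exists v, a, 0; split=> //.
  by rewrite scale0r mul0r !addr0.
Qed.

(** Hahn-Banach, in the form of norming functionals: a maximal graph of a
    real-linear form below the norm through [(v0, rnorm v0)] is total. *)
Lemma norming_rfun (v0 : E) :
  exists psi, [/\ is_rfun psi, forall v, `|psi v| <= rnorm v & psi v0 = rnorm v0].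
Proof.
pose G0 := [set p : E * R | exists r : R, p = (r%:C *: v0, r * rnorm v0)].
have gG0 : graph G0.
  split.
  - move=> _ _ _ _ [r [-> ->]] [s [-> ->]]; exists (r + s).
    by rewrite rmorphD scalerDl mulrDl.
  - move=> s _ _ [r [-> ->]]; exists (s * r).
    by rewrite scalerA rmorphM mulrA.
  - move=> _ _ [r [-> ->]]; rewrite rnormZr ler_wpM2r ?rnorm_ge0//.
    exact: ler_norm.
pose T := {G : set (E * R) | graph G /\ G0 `<=` G}.
pose rT (A B : T) := `[< sval A `<=` sval B >].
have t0 : T by exists G0; split.
have [||||M Mmax] := @Zorn T rT.
- by move=> A; apply/asboolP.
- by move=> A B C /asboolP AB /asboolP BC; apply/asboolP => p /AB /BC.
- move=> [A hA] [B hB] /asboolP /= AB /asboolP /= BA.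
  have e : A = B by apply/seteqP; split.
  by subst; congr exist; exact: Prop_irrelevance.
- move=> Ch totCh.
  have [[A0 ChA0]|nCh] := pselect (exists A, Ch A); last first.
    by exists t0 => A ChA; exfalso; apply: nCh; exists A.
  pose U := [set p | exists2 A : T, Ch A & sval A p].
  have gU : graph U.
    split.
    + move=> v a w b [A ChA Ap] [B ChB Bp].
      case: (totCh _ _ ChA ChB) => /asboolP AB.
      * by exists B => //; case: (svalP B) => -[Ba _ _] _; apply: Ba => //; exact: AB.
      * by exists A => //; case: (svalP A) => -[Aa _ _] _; apply: Aa => //; exact: AB.
    + move=> r v a [A ChA Ap]; exists A => //.
      by case: (svalP A) => -[_ As _] _; exact: As.
    + by move=> v a [A ChA Ap]; case: (svalP A) => -[_ _ Ab] _; exact: Ab.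
  have G0U : G0 `<=` U.
    by move=> p /(proj2 (svalP A0)) h; exists A0.
  exists (exist _ U (conj gU G0U)) => A ChA; apply/asboolP => p Ap /=.
  by exists A.
have [gM G0M] := svalP M.
have M00 : exists a, sval M (0, a).
  by exists 0; apply: G0M; exists 0; rewrite scale0r mul0r.
have tot w : exists b, sval M (w, b).
  have [G' [gG' MG' [b G'b]]] := graph_extend w gM M00.
  have G0G' : G0 `<=` G' by apply: subset_trans MG'.
  have := Mmax (exist _ G' (conj gG' G0G')).
  move=> e; exists b; rewrite -e //; exact/asboolP.
pose psi w := projT1 (cid (tot w)).
have psiM w : sval M (w, psi w) by rewrite /psi; case: cid.
case: (gM) => Ma Ms Mb.
have psiE w b : sval M (w, b) -> psi w = b.
  by move=> h; apply: graph_fun gM (psiM w) h.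
have psiS (r : R) v : psi (r%:C *: v) = r * psi v by apply: psiE; exact: Ms.
have psib v : `|psi v| <= rnorm v.
  rewrite ler_norml (Mb _ _ (psiM v)) andbT.
  rewrite lerNl -mulN1r -psiS; apply: le_trans (Mb _ _ (psiM _)) _.
  by rewrite rnormZr normrN1 mul1r.
exists psi; split=> //; last first.
  by apply: psiE; apply: G0M; exists 1; rewrite scale1r mul1r.
split=> //; first by move=> v w; apply: psiE; exact: Ma.
by exists 1 => // v; rewrite mul1r.
Qed.

Lemma rnorm_le_rfun (v : E) (a : R) :
  (forall psi, is_rfun psi -> (forall w, `|psi w| <= rnorm w) -> psi v <= a) ->
  rnorm v <= a.
Proof. by move=> h; have [psi [p1 p2 <-]] := norming_rfun v; exact: h. Qed.

Lemma rfunB psi (v w : E) : is_rfun psi -> psi (v - w) = psi v - psi w.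
Proof.
case=> pD pZ _; rewrite pD; congr (_ + _).
by rewrite -mulN1r -pZ rmorphN rmorph1 scaleN1r.
Qed.

Lemma rfunD psi (v w : E) : is_rfun psi -> psi (v + w) = psi v + psi w.
Proof. by case. Qed.

Lemma rfunN psi (v : E) : is_rfun psi -> psi (- v) = - psi v.
Proof.
case=> _ pZ _; rewrite -scaleN1r (_ : -1 = (-1)%:C) ?pZ ?mulN1r//.
by rewrite rmorphN rmorph1.
Qed.

Lemma rfun0 psi : is_rfun psi -> psi (0 : E) = 0.
Proof. by move=> p; rewrite -(subrr 0) rfunB// subrr. Qed.

Lemma rfun_ext (v w : E) : (forall psi, is_rfun psi -> psi v = psi w) -> v = w.
Proof.
move=> h; apply/eqP; rewrite -subr_eq0; apply/eqP/rnorm0_eq0/eqP.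
rewrite eq_le rnorm_ge0 andbT; apply: rnorm_le_rfun => psi p _.
by rewrite rfunB// h// subrr.
Qed.

Lemma rfun_cvg psi : is_rfun psi ->
  forall {I : Type} (Fi : set_system I) {FF : Filter Fi} (f : I -> E) l,
  f x @[x --> Fi] --> l -> psi (f x) @[x --> Fi] --> psi l.
Proof.
move=> p I Fi FF f l /rcvgP fl; case: (p) => _ _ [K K0 pK].
have Kf : K * rnorm (f x - l) @[x --> Fi] --> (0 : R).
  by rewrite -[X in _ --> X](mulr0 K); apply: cvgMr.
apply/cvgrPdist_le => e e0; have /cvgrPdist_le/(_ _ e0) := Kf.
apply: filterS => x; rewrite sub0r normrN distrC -rfunB// => h.
by apply: le_trans h; apply: le_trans (pK _) _; exact: ler_norm.
Qed.

End HahnBanach.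

(** Vectors are equal as soon as all real functionals agree on them, and [ring]
    decides the identities between values. *)
Ltac vec :=
  let psi := fresh "psi" in let p := fresh "p" in
  apply: rfun_ext => psi p;
  rewrite ?(scalerDr, scalerBr, scalerN);
  rewrite ?((fun v w => @rfunD _ _ psi v w p), (fun v => @rfunN _ _ psi v p), @rfun0 _ _ psi p);
  ring.

Section RealFunctionals.
Context {R : realType}.

Lemma rfun_comp {E F : normedModType R[i]} (psi : F -> R) (T : E -> F) :
  is_rfun psi -> bounded_op T -> is_rfun (fun v => psi (T v)).
Proof.
move=> [pD pZ [K K0 pK]] /bounded_opP[lT [L L0 TL]]; split.
- by move=> v w; rewrite linD.
- by move=> r v; rewrite linZ.
- exists (K * L); first exact: mulr_ge0.
  by move=> v; apply: le_trans (pK _) _; rewrite -mulrA ler_wpM2l.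
Qed.

Lemma rfun_scale {E : normedModType R[i]} (psi : E -> R) (c : R[i]) :
  is_rfun psi -> is_rfun (fun v => psi (c *: v)).
Proof. by move=> p; apply: rfun_comp p (bounded_scale _ bounded_id). Qed.

End RealFunctionals.


(** * Simple functions and measurability *)

Section RealIntegrals.
Context {R : realType}.
Local Notation mu := (@lebesgue_measure R).
Variables (D : set R) (mD : measurable D).
Implicit Types f g : R -> R.

Local Notation rintegrable f := (mu.-integrable D (EFin \o f)).

Lemma rint_dominated f g : measurable_fun D f -> (forall t, D t -> `|f t| <= g t) ->
  rintegrable g -> rintegrable f.
Proof.
move=> mf fg ig; apply: (@le_integrable _ _ _ mu D mD _ (EFin \o g)) => //.
  exact/measurable_EFinP.
move=> t Dt /=; rewrite lee_fin; apply: le_trans (fg t Dt) _; exact: ler_norm.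
Qed.

Lemma rint_scale r f : rintegrable f -> rintegrable (fun t => r * f t).
Proof.
by move=> fi; have := @integrableZl _ _ _ mu D mD r _ fi.
Qed.

Lemma rint_add f g : rintegrable f -> rintegrable g -> rintegrable (fun t => f t + g t).
Proof. by move=> fi gi; have := @integrableD _ _ _ mu D mD _ _ fi gi. Qed.

Lemma rint_sub f g : rintegrable f -> rintegrable g -> rintegrable (fun t => f t - g t).
Proof. by move=> fi gi; have := @integrableB _ _ _ mu D mD _ _ fi gi. Qed.

Lemma rint_measurable f : rintegrable f -> measurable_fun D f.
Proof. by move=> /integrableP[/measurable_EFinP]. Qed.

Lemma rint_norm f : rintegrable f -> rintegrable (fun t => `|f t|).
Proof. by move=> fi; exact: (integrable_abse fi). Qed.

End RealIntegrals.

Section Finitary.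
Context {R : realType}.

(** Unlike simple functions, these need not vanish off a set of finite measure;
    they are stable under pairing and under arbitrary maps between values. *)
Definition finitary {T : choiceType} (a : R -> T) : Prop :=
  finite_set (range a) /\ forall v, measurable (a @^-1` [set v]).

Lemma finitary_preimage {T : choiceType} (a : R -> T) (A : set T) :
  finitary a -> measurable (a @^-1` A).
Proof.
move=> [fa ma].
have -> : a @^-1` A = \bigcup_(v in range a `&` A) a @^-1` [set v].
  apply/seteqP; split=> [t At|t [v [_ Av] /= ->]//].
  by exists (a t) => //; split=> //; exists t.
by apply: fin_bigcup_measurable => //; exact: finite_setIl.
Qed.

Lemma finitary_comp {T T' : choiceType} (h : T -> T') (a : R -> T) :
  finitary a -> finitary (fun t => h (a t)).
Proof.
move=> fa; split.
  have -> : range (fun t => h (a t)) = h @` range a.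
    by apply/seteqP; split=> [_ [t _ <-]|_ [_ [t _ <-] <-]];
      [exists (a t) => //; exists t|exists t].
  by apply: finite_image; case: fa.
by move=> v; exact: (finitary_preimage (h @^-1` [set v]) fa).
Qed.

Lemma finitary_pair {T T' : choiceType} (a : R -> T) (b : R -> T') :
  finitary a -> finitary b -> finitary (fun t => (a t, b t)).
Proof.
move=> [fa ma] [fb mb]; split.
  apply: (@sub_finite_set _ _ (range a `*` range b)); last exact: finite_setX.
  by move=> _ [t _ <-]; split; exists t.
move=> [v w]; have -> : (fun t => (a t, b t)) @^-1` [set (v, w)] =
    a @^-1` [set v] `&` b @^-1` [set w].
  by apply/seteqP; split=> t /=; [case=> <- <-|case=> <- <-].
exact: measurableI.
Qed.

Lemma finitary_mem (D : set R) : measurable D -> finitary (fun t => t \in D).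
Proof.
move=> mD; split.
  exact: (@sub_finite_set _ _ [set: bool]).
move=> [] .
  have -> // : (fun t => t \in D) @^-1` [set true] = D.
  by apply/seteqP; split=> t /= h; [rewrite -inE|rewrite mem_set].
have -> : (fun t => t \in D) @^-1` [set false] = ~` D.
  by apply/seteqP; split=> t /=; [move/negbT; rewrite notin_setE|
     move=> h; apply/negbTE; rewrite notin_setE].
exact: measurableC.
Qed.

Lemma finitary_if {T : choiceType} (D : set R) (a : R -> T) (c : T) :
  measurable D -> finitary a -> finitary (fun t => if t \in D then a t else c).
Proof.
move=> mD fa; have := finitary_pair (finitary_mem mD) fa.
exact: (finitary_comp (fun p => if p.1 then p.2 else c)).
Qed.

Lemma measurable_finitary d (Om : measurableType d) {T : choiceType}
    (a : Om -> T -> R) (p : Om -> R) (s : R -> T) :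
  measurable_fun setT p -> (forall v, measurable_fun setT (a^~ v)) ->
  finitary s -> measurable_fun setT (fun w => a w (s (p w))).
Proof.
move=> mp ma fs _ B mB; rewrite setTI.
have -> : (fun w => a w (s (p w))) @^-1` B =
    \bigcup_(v in range s) (p @^-1` (s @^-1` [set v]) `&` (a^~ v) @^-1` B).
  apply/seteqP; split=> [w Bw|w [v _ [/= -> //]]].
  by exists (s (p w)) => //; exists (p w).
apply: fin_bigcup_measurable; first by case: fs.
move=> v _; apply: measurableI.
  by have := mp measurableT _ (finitary_preimage [set v] fs); rewrite setTI.
by have := ma v measurableT _ mB; rewrite setTI.
Qed.

End Finitary.

Section BochnerWeak.
Context {R : realType} {E : completeNormedModType R[i]}.
Implicit Types (D : set R) (f s : R -> E).

Local Notation mu := (@lebesgue_measure R).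

Lemma simple_finitary D s : simple_on D s -> finitary s.
Proof. by case. Qed.

(** Measurability of scalar quantities built on a strongly measurable function;
    the parameter space [Om] is a plane when Fubini is at stake. *)
Lemma measurable_strongly d (Om : measurableType d) (a : Om -> E -> R)
    (p : Om -> R) D f :
  measurable D -> measurable_fun setT p -> (forall v, measurable_fun setT (a^~ v)) ->
  (forall w (u : nat -> E) v, u n @[n --> \oo] --> v ->
     a w (u n) @[n --> \oo] --> a w v) ->
  strongly_measurable D f ->
  measurable_fun (p @^-1` D) (fun w => a w (f (p w))).
Proof.
move=> mD mp ma ca [s_ [ss sf]].
have mpD : measurable (p @^-1` D) by rewrite -[X in measurable X]setTI; exact: mp.
apply: (measurable_fun_cvg (h := fun n w => a w (s_ n (p w)))).
  move=> n; apply: measurable_funTS.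
  exact: (measurable_finitary mp ma (simple_finitary (ss n))).
by move=> w Dw; apply: ca; exact: sf.
Qed.

Lemma measurable_rfun D f (psi : E -> R) : measurable D -> is_rfun psi ->
  strongly_measurable D f -> measurable_fun D (fun t => psi (f t)).
Proof.
move=> mD p sf; apply: (@measurable_strongly _ R (fun _ => psi) id) => //.
by move=> _ u v uv; exact: rfun_cvg.
Qed.

Lemma measurable_rnorm D f : measurable D ->
  strongly_measurable D f -> measurable_fun D (fun t => rnorm (f t)).
Proof.
move=> mD sf; apply: (@measurable_strongly _ R (fun _ => rnorm) id) => //.
by move=> _ u v uv; exact: rcvg_norm.
Qed.

Lemma measurable_rdist D f s : measurable D -> finitary s ->
  strongly_measurable D f -> measurable_fun D (fun t => rnorm (f t - s t)).
Proof.
move=> mD fs sf.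
apply: (@measurable_strongly _ R (fun t v => rnorm (v - s t)) id) => //.
  by move=> v; apply: (@measurable_finitary _ _ R _ (fun _ u => rnorm (v - u)) id).
by move=> w u v uv; apply: rcvg_norm; exact: cvgB uv (cvg_cst _).
Qed.

Let indic_int D A : measurable D -> measurable A -> (mu (D `&` A) < +oo)%E ->
  mu.-integrable D (EFin \o (\1_A : R -> R)) /\
  \int[mu]_(t in D) (\1_A t : R) = fine (mu (D `&` A)).
Proof.
move=> mD mA fA; split.
  apply/integrableP; split.
    by apply/measurable_EFinP; apply: measurable_funTS; exact: measurable_indic.
  under eq_integral do rewrite /= ger0_norm//.
  by rewrite integral_indic// setIC.
by rewrite /Rintegral integral_indic// setIC.
Qed.

Let rfun_sum (psi : E -> R) (l : seq E) (c : E -> R) : is_rfun psi ->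
  psi (\sum_(v <- l) (c v)%:C *: v) = \sum_(v <- l) c v * psi v.
Proof.
move=> p; elim: l => [|v l IH]; first by rewrite !big_nil rfun0.
by rewrite !big_cons; case: (p) => pD pZ _; rewrite pD pZ IH.
Qed.

Let simple_sum D s (psi : E -> R) (l : seq E) :
  measurable D -> simple_on D s -> is_rfun psi ->
  let g := fun t => \sum_(v <- l) psi v * (\1_(s @^-1` [set v]) t : R) in
  mu.-integrable D (EFin \o g) /\
  \int[mu]_(t in D) g t =
  \sum_(v <- l) fine (mu (D `&` s @^-1` [set v])) * psi v.
Proof.
move=> mD [_ ms fs] p; elim: l => [|v l [IH1 IH2]] /=.
  have -> : (fun t : R => \sum_(v <- [::]) psi v * (\1_(s @^-1` [set v]) t : R)) = cst 0.
    by apply/funext => t; rewrite big_nil.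
  by rewrite big_nil; split; [exact: integrable0|rewrite /Rintegral integral0].
have -> : (fun t : R => \sum_(v <- v :: l) psi v * (\1_(s @^-1` [set v]) t : R)) =
    (fun t => psi v * (\1_(s @^-1` [set v]) t : R) +
              \sum_(v <- l) psi v * (\1_(s @^-1` [set v]) t : R)).
  by apply/funext => t; rewrite big_cons.
rewrite big_cons; have [->|v0] := eqVneq v 0.
  rewrite (rfun0 p) mulr0 add0r.
  by under eq_fun do rewrite mul0r add0r.
have [i1 i2] := indic_int mD (ms v) (fs _ v0).
have i3 : mu.-integrable D (EFin \o (fun t => psi v * (\1_(s @^-1` [set v]) t : R))).
  exact: rint_scale.
split.
  exact: (@integrableD _ _ _ mu D mD (EFin \o _) (EFin \o _) i3 IH1).
by rewrite RintegralD// RintegralZl// i2 IH2 mulrC.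
Qed.

(** The integral of a simple function is a finite sum over its values, and so is
    the integral of its composition with a functional. *)
Lemma simple_integral_rfun D s (psi : E -> R) :
  measurable D -> simple_on D s -> is_rfun psi ->
  mu.-integrable D (EFin \o (psi \o s)) /\
  psi (simple_integral D s) = \int[mu]_(t in D) psi (s t).
Proof.
move=> mD ss p; case: (ss) => fr ms fs.
pose l : seq E := finmap.enum_fset (fset_set (range s)).
have ul : uniq l by exact: finmap.fset_uniq.
have [i1 i2] := simple_sum l mD ss p.
have e t : psi (s t) = \sum_(v <- l) psi v * (\1_(s @^-1` [set v]) t : R).
  have sl : s t \in l by rewrite in_fset_set// inE; exists t.
  rewrite (bigD1_seq (s t))//= big1 => [|v vt].
    by rewrite addr0 indicE mem_set//= mulr1.
  rewrite indicE memNset ?mulr0//= => /esym h.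
  by move: vt; rewrite h eqxx.
have -> : EFin \o (psi \o s) =
    EFin \o (fun t => \sum_(v <- l) psi v * (\1_(s @^-1` [set v]) t : R)).
  by apply/funext => t /=; rewrite e.
split=> //; under eq_Rintegral do rewrite e.
rewrite i2 /simple_integral.
rewrite (fsbigTE (fset_set (range s))); first by rewrite rfun_sum.
  move=> v; rewrite in_fset_set// => nv.
suff -> : s @^-1` [set v] = set0 by rewrite setI0 measure0 /= scale0r.
rewrite -subset0 => t /= st; move: nv; rewrite notin_setE; apply.
by exists t.
Qed.

Definition bochner_integrable D f : Prop :=
  strongly_measurable D f /\ (\int[mu]_(t in D) (rnorm (f t))%:E < +oo)%E.

Lemma rnorm_integrable D f : measurable D -> bochner_integrable D f ->
  mu.-integrable D (EFin \o (fun t => rnorm (f t))).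
Proof.
move=> mD [sf fi]; apply/integrableP; split.
  by apply/measurable_EFinP; exact: measurable_rnorm.
by under eq_integral do rewrite /= ger0_norm ?rnorm_ge0//.
Qed.

Lemma rfun_integrable D f (psi : E -> R) : measurable D -> is_rfun psi ->
  bochner_integrable D f -> mu.-integrable D (EFin \o (fun t => psi (f t))).
Proof.
move=> mD p bf; case: (p) => _ _ [K K0 pK].
apply: (rint_dominated mD (g := fun t => K * rnorm (f t))).
- by apply: measurable_rfun => //; case: bf.
- by move=> t _; exact: pK.
- by apply: rint_scale => //; exact: rnorm_integrable.
Qed.

End BochnerWeak.

(** * The Bochner integral through functionals *)

Section BochnerExistence.
Context {R : realType} {E : completeNormedModType R[i]}.
Implicit Types (D : set R) (f s : R -> E).

Local Notation mu := (@lebesgue_measure R).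

Let simple_dist D f s (psi : E -> R) K :
  measurable D -> bochner_integrable D f -> simple_on D s -> is_rfun psi -> 0 <= K ->
  (forall v, `|psi v| <= K * rnorm v) ->
  (\int[mu]_(t in D) (rnorm (f t - s t))%:E < +oo)%E ->
  `| \int[mu]_(t in D) psi (f t) - psi (simple_integral D s)|
    <= K * fine (\int[mu]_(t in D) (rnorm (f t - s t))%:E).
Proof.
move=> mD bf ss p K0 pK fin.
have [is1 ->] := simple_integral_rfun mD ss p.
have if1 := rfun_integrable mD p bf.
have id : mu.-integrable D (EFin \o (fun t => rnorm (f t - s t))).
  apply/integrableP; split.
    apply/measurable_EFinP; apply: measurable_rdist => //; last by case: bf.
    exact: simple_finitary ss.
  by under eq_integral do rewrite /= ger0_norm ?rnorm_ge0//.
rewrite -RintegralB//.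
have i2 := rint_sub mD if1 is1.
apply: le_trans (le_normr_Rintegral _ _) _ => //.
rewrite -[fine _]/(\int[mu]_(t in D) rnorm (f t - s t)) -RintegralZl//.
apply: le_Rintegral => //; first exact: rint_norm.
  exact: rint_scale.
by move=> t _ /=; rewrite -rfunB.
Qed.

(** The approximating simple functions are cut off where they exceed twice the
    norm of [f], after which their distance to [f] is dominated. *)
Let approx_seq D f : measurable D -> bochner_integrable D f ->
  exists s_ : nat -> R -> E, (forall n, simple_on D (s_ n)) /\
    (\int[mu]_(t in D) (rnorm (f t - s_ n t))%:E)%E @[n --> \oo] --> 0%E.
Proof.
move=> mD bf; case: (bf) => -[s_ [ss sf]] fi.
pose A n := D `&` (fun t => rnorm (s_ n t) - 2 * rnorm (f t)) @^-1` `]-oo, 0].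
have mA n : measurable (A n).
  have m : measurable_fun D (fun t => rnorm (s_ n t) - 2 * rnorm (f t)).
    apply: measurable_funB.
      apply: measurable_funTS.
      apply: (@measurable_finitary _ _ R _ (fun _ u => rnorm u) id) => //.
      exact: simple_finitary (ss n).
    apply: measurable_funM => //.
    by apply: measurable_rnorm => //; case: bf.
  by apply: m => //; exact: measurable_itv.
have AP n t : A n t <-> D t /\ rnorm (s_ n t) <= 2 * rnorm (f t).
  by rewrite /A /= in_itv /= subr_le0.
pose s' n t := if t \in A n then s_ n t else 0.
have ss' n : simple_on D (s' n).
  have fs : finitary (s' n) by apply: finitary_if => //; exact: simple_finitary (ss n).
  case: (fs) => f1 f2; split=> // v v0; case: (ss n) => _ m3 /(_ v v0).
  apply: le_lt_trans; apply: le_measure; rewrite ?inE.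
  - exact: (measurableI _ _ mD (f2 v)).
  - exact: (measurableI _ _ mD (m3 v)).
  - move=> t [Dt /=]; rewrite /s'; case: ifPn => // _ v0'.
    by move: v0; rewrite -v0' eqxx.
have bs' n t : D t -> rnorm (s' n t) <= 2 * rnorm (f t).
  move=> Dt; rewrite /s'; case: ifPn => [|_]; first by rewrite inE AP => -[].
  by rewrite rnorm0 mulr_ge0 ?rnorm_ge0.
have bd n t : D t -> rnorm (f t - s' n t) <= 3 * rnorm (f t).
  move=> Dt; apply: le_trans (ler_rnormB _ _) _.
  by have := bs' n _ Dt; lra.
have cs' t : D t -> rnorm (f t - s' n t) @[n --> \oo] --> (0 : R).
  move=> Dt; have [f0|f0] := eqVneq (rnorm (f t)) 0.
    rewrite (_ : (fun n => _) = cst 0); first exact: cvg_cst.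
    apply/funext => n /=; apply/eqP; rewrite eq_le rnorm_ge0 andbT.
    by have := bd n _ Dt; rewrite f0 mulr0.
  have fp : 0 < rnorm (f t) by rewrite lt_def f0 rnorm_ge0.
  have /rcvgP h := sf t Dt.
  have h' : rnorm (f t - s_ n t) @[n --> \oo] --> (0 : R).
    by under eq_fun do rewrite rdistC.
  apply: cvg_trans h'; apply: near_eq_cvg.
  have /cvgrPdist_lt/(_ _ fp) := h; apply: filterS => n.
  rewrite sub0r normrN ger0_norm ?rnorm_ge0// => hn.
  rewrite /s' mem_set //; apply/AP; split=> //.
  have := ler_rnormD (s_ n t - f t) (f t); rewrite subrK => h2.
  by apply: le_trans h2 _; lra.
exists s'; split=> //.
have i3 : mu.-integrable D (EFin \o (fun t => 3 * rnorm (f t))).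
  by apply: rint_scale => //; exact: rnorm_integrable.
have := @dominated_cvg _ _ R mu D mD (fun n t => (rnorm (f t - s' n t))%:E) (cst 0%E)
  (EFin \o (fun t => 3 * rnorm (f t))).
rewrite integral0; apply=> //.
- move=> n; apply/measurable_EFinP; apply: measurable_rdist => //; last by case: bf.
  exact: simple_finitary (ss' n).
- by move=> t Dt; apply: cvg_EFin; [exact: nearW|exact: cs'].
- by move=> n t Dt /=; rewrite lee_fin ger0_norm ?rnorm_ge0// bd.
Qed.

Let near_fin (u : nat -> \bar R) : u n @[n --> \oo] --> 0%E ->
  forall e : R, 0 < e -> exists N, forall n, (N <= n)%N ->
    (u n < +oo)%E /\ fine (u n) < e.
Proof.
move=> /fine_cvgP[[N1 _ h1] /cvgrPdist_lt h2] e e0.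
have [N2 _ h3] := h2 e e0.
exists (maxn N1 N2) => n; rewrite geq_max => /andP[n1 n2].
have f1 := h1 n n1; split; first by move: f1; rewrite fin_numE ltey => /andP[].
have := h3 n n2; rewrite /= sub0r normrN; apply: le_lt_trans.
exact: ler_norm.
Qed.

(** Functionals compute the Bochner integral: this turns every identity between
    Bochner integrals into one between Lebesgue integrals of real functions. *)
Lemma is_bochner_rfun D f I (psi : E -> R) :
  measurable D -> bochner_integrable D f -> is_bochner_integral D f I ->
  is_rfun psi -> psi I = \int[mu]_(t in D) psi (f t).
Proof.
move=> mD bf [_ [s_ [ss s0 sI]]] p; case: (p) => _ _ [K K0 pK].
have c1 : psi (simple_integral D (s_ n)) @[n --> \oo] --> psi I by exact: rfun_cvg.
apply: (@cvg_unique _ (@Rhausdorff R) _ _ _ _ c1).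
apply/cvgrPdist_lt => e e0.
have K1 : 0 < K + 1 by rewrite ltr_wpDl.
have [N HN] := near_fin s0 (divr_gt0 e0 K1).
exists N => // n /= Nn; have [f1 f2] := HN n Nn.
apply: le_lt_trans (simple_dist mD bf (ss n) p K0 pK f1) _.
apply: (@le_lt_trans _ _ ((K + 1) * fine (\int[mu]_(t in D) (rnorm (f t - s_ n t))%:E))).
  rewrite ler_wpM2r ?lerDl//; apply: fine_ge0; apply: integral_ge0 => t _.
  by rewrite lee_fin rnorm_ge0.
by rewrite mulrC -ltr_pdivlMr.
Qed.

(** The integrals of the approximations form a Cauchy sequence, because a norm is
    a supremum of values of functionals. *)
Lemma bochner_exists D f : measurable D -> bochner_integrable D f ->
  exists I, is_bochner_integral D f I.
Proof.
move=> mD bf; have [s_ [ss s0]] := approx_seq mD bf.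
suff [I hI] : exists I : E, simple_integral D (s_ n) @[n --> \oo] --> I.
  by exists I; split; [case: bf|exists s_].
apply: rcauchy_cvg => e e0.
have [N HN] := near_fin s0 (divr_gt0 e0 (ltr0n _ 3)).
exists N => m n Nm Nn; have [f1 f2] := HN m Nm; have [f3 f4] := HN n Nn.
have e3 : e / 3 + e / 3 < e by lra.
apply: le_lt_trans e3; apply: rnorm_le_rfun => psi p pb; rewrite rfunB//.
have pb' v : `|psi v| <= 1 * rnorm v by rewrite mul1r.
have := simple_dist mD bf (ss m) p ler01 pb' f1.
have := simple_dist mD bf (ss n) p ler01 pb' f3.
rewrite !mul1r => h1 h2.
move: (ler_norml (\int[mu]_(t in D) psi (f t) - psi (simple_integral D (s_ m))) (fine (\int[mu]_(t in D) (rnorm (f t - s_ m t))%:E))).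
move: (ler_norml (\int[mu]_(t in D) psi (f t) - psi (simple_integral D (s_ n))) (fine (\int[mu]_(t in D) (rnorm (f t - s_ n t))%:E))).
rewrite h1 h2 => /esym/andP[a1 a2] /esym/andP[b1 b2].
lra.
Qed.

Lemma bochner_rfun D f (psi : E -> R) : measurable D -> bochner_integrable D f ->
  is_rfun psi -> psi (bochner D f) = \int[mu]_(t in D) psi (f t).
Proof.
move=> mD bf p; have [I hI] := bochner_exists mD bf.
by apply: is_bochner_rfun => //; rewrite /bochner; apply: xgetPex; exists I.
Qed.

Lemma bochner_unique D f (I : E) : measurable D -> bochner_integrable D f ->
  (forall psi, is_rfun psi -> psi I = \int[mu]_(t in D) psi (f t)) ->
  bochner D f = I.
Proof. by move=> mD bf h; apply: rfun_ext => psi p; rewrite bochner_rfun// h. Qed.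

Lemma strongly_measurable_ext D f g : {in D, f =1 g} ->
  strongly_measurable D f -> strongly_measurable D g.
Proof.
move=> fg [s_ [ss sf]]; exists s_; split=> // t Dt.
by rewrite -fg ?inE//; exact: sf.
Qed.

Let is_bochner_ext D f g I : {in D, f =1 g} ->
  is_bochner_integral D f I -> is_bochner_integral D g I.
Proof.
move=> fg [sf [s_ [h1 h2 h3]]]; split; first exact: strongly_measurable_ext sf.
exists s_; split=> //.
rewrite (_ : (fun n => _) = (fun n => \int[mu]_(t in D) (rnorm (f t - s_ n t))%:E)%E)//.
by apply/funext => n; apply: eq_integral => t Dt; rewrite fg.
Qed.

Lemma eq_bochner D f g : {in D, f =1 g} -> bochner D f = bochner D g.
Proof.
move=> fg; congr xget; apply/seteqP; split=> I; first exact: is_bochner_ext.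
by apply: is_bochner_ext => t Dt; rewrite fg.
Qed.

End BochnerExistence.

(** * Strong measurability *)

Section StrongMeasurability.
Context {R : realType}.
Local Notation mu := (@lebesgue_measure R).

Let W (n : nat) := `[(0 : R), n%:R]%classic.

Let mW n : measurable (W n).
Proof. exact: measurable_itv. Qed.

Let WE n t : (t \in W n) = (0 <= t <= n%:R).
Proof.
by apply/idP/idP => [/set_mem|h]; [|apply/mem_set]; rewrite /W /= in_itv.
Qed.

(** Time rounded down to the grid of mesh [1 / n.+1], on a window. *)
Let grid (n : nat) (t : R) : nat :=
  if t \in W n then Num.truncn (t * n.+1%:R) else 0%N.

Let grid_finitary n : finitary (grid n).
Proof.
split.
  apply: (@sub_finite_set _ _ `I_((n * n.+1).+1)); last exact: finite_II.
  move=> _ [t _ <-] /=; rewrite /grid; case: ifPn => //.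
  rewrite WE => /andP[t0 tn]; rewrite ltnS truncn_le_nat.
  apply: (@le_lt_trans _ _ (n * n.+1)%:R); last by rewrite ltr_nat.
  by rewrite natrM ler_wpM2r.
move=> m.
have e (t : R) : t \in W n ->
    (grid n t == m) = (m%:R / n.+1%:R <= t < m.+1%:R / n.+1%:R).
  move=> tI; rewrite /grid tI; move: tI; rewrite WE => /andP[t0 _].
  by rewrite truncn_eq ?mulr_ge0// ler_pdivrMr// ltr_pdivlMr.
pose J := `[(m%:R / n.+1%:R : R), m.+1%:R / n.+1%:R[%classic.
have mJ : measurable J by exact: measurable_itv.
have -> : grid n @^-1` [set m] =
    (W n `&` J) `|` (~` W n `&` [set t | 0%N = m]).
  apply/seteqP; split=> t /=.
    move=> /eqP gm; have [tI|tI] := boolP (t \in W n).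
      left; split; first exact: set_mem.
      by rewrite /J /= in_itv/= -e.
    right; split; first by move: tI; rewrite notin_setE.
    by move/eqP: gm; rewrite /grid (negbTE tI).
  move=> [[tI]|[tI <-]].
    by rewrite /J /= in_itv/= -e ?mem_set// => /eqP.
  by rewrite /grid memNset.
apply: measurableU; apply: measurableI => //; first exact: measurableC.
by have [->|m0] := eqVneq 0%N m; [rewrite (_ : [set _ | _] = setT)//; apply/seteqP|
  rewrite (_ : [set _ | _] = set0)//; apply/seteqP; split=> // t /= /eqP;
  rewrite (negbTE m0)].
Qed.

Let grid_cvg (t : R) : 0 <= t -> (grid n t)%:R / n.+1%:R @[n --> \oo] --> t.
Proof.
move=> t0; apply/cvgrPdist_lt => e e0.
near=> n.
have n0 : 0 < n.+1%:R :> R by [].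
have tn : t \in W n.
  rewrite WE t0/=.
  by near: n; exact: nbhs_infty_ger.
rewrite /grid tn.
have t1 : 0 <= t * n.+1%:R by rewrite mulr_ge0.
have /andP[h1 h2] := truncn_itv t1.
have e1 : n.+1%:R^-1 < e by near: n; exact: near_infty_natSinv_lt (PosNum e0).
rewrite ger0_norm; last by rewrite subr_ge0 ler_pdivrMr.
apply: lt_trans e1; rewrite ltrBlDr -[X in X + _]mul1r -mulrDl ltr_pdivlMr//.
by rewrite addrC natr1.
Unshelve. all: by end_near. Qed.

(** Rounding time down makes simple functions out of simple functions, so an
    operation [F] that is jointly continuous from the left in time preserves
    strong measurability.  This covers sums, operators, continuous functions,
    cut-offs and convolution integrands. *)
Lemma strongly_measurable_comp {E1 E2 E3 : normedModType R[i]}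
    (F : R -> E1 -> E2 -> E3) (f1 : R -> E1) (f2 : R -> E2) :
  strongly_measurable `[0, +oo[ f1 -> strongly_measurable `[0, +oo[ f2 ->
  (forall (t : R) (r : nat -> R) (u : nat -> E1) (v : nat -> E2), 0 <= t -> (forall n, 0 <= r n <= t) ->
    r n @[n --> \oo] --> t -> u n @[n --> \oo] --> f1 t ->
    v n @[n --> \oo] --> f2 t ->
    F (r n) (u n) (v n) @[n --> \oo] --> F t (f1 t) (f2 t)) ->
  strongly_measurable `[0, +oo[ (fun t => F t (f1 t) (f2 t)).
Proof.
move=> [a_ [sa ca]] [b_ [sb cb]] cF.
pose s_ n t := if t \in W n
  then F ((grid n t)%:R / n.+1%:R) (a_ n t) (b_ n t) else 0.
exists s_; split.
  move=> n; have [f1s f2s] : finitary (s_ n).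
    apply: finitary_if => //.
    have fa : finitary (a_ n) by case: (sa n).
    have fb : finitary (b_ n) by case: (sb n).
    exact: (finitary_comp (fun p => F (p.1.1%:R / n.+1%:R) p.1.2 p.2)
      (finitary_pair (finitary_pair (grid_finitary n) fa) fb)).
  split=> // v v0.
  apply: (@le_lt_trans _ _ (mu (W n))).
    apply: le_measure; rewrite ?inE; [|exact: mW|].
      exact: (measurableI _ _ (measurable_itv _) (f2s v)).
    move=> t [_ /=]; rewrite /s_; case: ifPn => [/set_mem//|_ v0'].
    by move: v0; rewrite -v0' eqxx.
  by rewrite lebesgue_measure_itv/=; case: ifP => _; rewrite ?ltry// -EFinB ltry.
move=> t /=; rewrite in_itv/= andbT => t0.
have h := cF t _ _ _ t0 _ (grid_cvg t0) (ca t _) (cb t _).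
apply: cvg_trans (h _ _ _); last 3 first.
- move=> n; rewrite divr_ge0//=; case: (boolP (t \in W n)) => tn.
    have t1 : 0 <= t * n.+1%:R by rewrite mulr_ge0.
    by have /andP[h1 _] := truncn_itv t1; rewrite /grid tn ler_pdivrMr.
  by rewrite /grid (negbTE tn) mul0r.
- by rewrite /= in_itv/= t0.
- by rewrite /= in_itv/= t0.
apply: near_eq_cvg; near=> n.
rewrite /s_ ifT// WE t0/=.
by near: n; exact: nbhs_infty_ger.
Unshelve. all: by end_near. Qed.

Lemma strongly_measurable_cst {E : normedModType R[i]} (v : E) :
  strongly_measurable `[0, +oo[ (fun=> v).
Proof.
have s0 : strongly_measurable `[0, +oo[ (fun=> 0 : E).
  exists (fun _ _ => 0); split; last by move=> t _; exact: cvg_cst.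
  move=> n; split.
  - by apply: (@sub_finite_set _ _ [set 0 : E]); [move=> _ [t _ <-]|exact: finite_set1].
  - move=> w; have [->|w0] := eqVneq 0 w.
      by rewrite (_ : _ @^-1` _ = setT)//; apply/seteqP.
    rewrite (_ : _ @^-1` _ = set0)//; apply/seteqP; split=> // t /= /eqP.
    by rewrite (negbTE w0).
  - move=> w w0; rewrite (_ : _ `&` _ = set0) ?measure0//.
    by apply/seteqP; split=> // t [_ /= h]; move: w0; rewrite -h eqxx.
apply: (@strongly_measurable_comp _ _ _ (fun _ _ _ => v) _ _ s0 s0).
by move=> *; exact: cvg_cst.
Qed.

Lemma strongly_measurable_continuous {E : normedModType R[i]} (f : R -> E) :
  continuous f -> strongly_measurable `[0, +oo[ f.
Proof.
move=> cf; have s0 := strongly_measurable_cst (0 : E).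
apply: (@strongly_measurable_comp _ _ _ (fun t _ _ => f t) _ _ s0 s0).
by move=> t r u v _ _ rt _ _; apply: continuous_cvg => //; exact: cf.
Qed.

Lemma strongly_measurable_add {E : normedModType R[i]} (f g : R -> E) :
  strongly_measurable `[0, +oo[ f -> strongly_measurable `[0, +oo[ g ->
  strongly_measurable `[0, +oo[ (fun t => f t + g t).
Proof.
move=> sf sg; apply: (@strongly_measurable_comp _ _ _ (fun _ x y => x + y) _ _ sf sg).
by move=> t r u v _ _ _ uf vg; exact: cvgD.
Qed.

Lemma strongly_measurable_op {E F : normedModType R[i]} (T : E -> F) (f : R -> E) :
  bounded_op T -> strongly_measurable `[0, +oo[ f ->
  strongly_measurable `[0, +oo[ (fun t => T (f t)).
Proof.
move=> bT sf; apply: (@strongly_measurable_comp _ _ _ (fun _ x _ => T x) _ _ sf sf).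
by move=> t r u v _ _ _ uf _; exact: bounded_cvg.
Qed.

Lemma strongly_measurable_sub {E : completeNormedModType R[i]} (D D' : set R) (f : R -> E) :
  measurable D -> measurable D' -> D' `<=` D ->
  strongly_measurable D f -> strongly_measurable D' f.
Proof.
move=> mD mD' DD' [s_ [ss sf]]; exists s_; split; last by move=> t /DD'/sf.
move=> n; have [h1 h2 h3] := ss n; split=> // v v0; apply: le_lt_trans (h3 v v0).
apply: le_measure; rewrite ?inE.
- exact: (measurableI _ _ mD' (h2 v)).
- exact: (measurableI _ _ mD (h2 v)).
- exact: setSI.
Qed.

End StrongMeasurability.

(** * Locally integrable functions and their primitives *)

Section LocallyIntegrable.
Context {R : realType}.
Local Notation mu := (@lebesgue_measure R).

Lemma itv_half_line (a b : R) : 0 <= a -> `[a, b] `<=` (`[0, +oo[%classic : set R).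
Proof. by move=> a0 t /=; rewrite !in_itv/= andbT => /andP[at_ _]; exact: le_trans at_. Qed.

Lemma mu_itv_fin (a b : R) : (mu `[a, b]%classic < +oo)%E.
Proof. by rewrite lebesgue_measure_itv/=; case: ifP => _; rewrite ?ltry// -EFinB ltry. Qed.

Lemma rint_cst (a b c : R) : mu.-integrable `[a, b] (EFin \o (fun=> c)).
Proof.
apply/integrableP; split; first by apply/measurable_EFinP; exact: measurable_cst.
rewrite /= integral_cst//=; apply: lte_mul_pinfty => //; exact: mu_itv_fin.
Qed.

Lemma Rint_cst (a b c : R) : a <= b -> \int[mu]_(t in `[a, b]) c = c * (b - a).
Proof.
move=> ab; rewrite Rintegral_cst//; congr (_ * _).
have e : (lebesgue_measure `[a, b]%classic = (b - a)%:E :> \bar R)%E.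
  rewrite lebesgue_measure_itv/= lte_fin; case: ltP => [//|ba].
  by rewrite (@le_anti _ _ a b) ?ab// subrr.
exact: (congr1 fine e).
Qed.

Lemma rint_bounded (a b : R) (f : R -> R) (K : R) :
  measurable_fun `[a, b] f -> (forall t, a <= t <= b -> `|f t| <= K) ->
  mu.-integrable `[a, b] (EFin \o f).
Proof.
move=> mf fK; apply: (rint_dominated _ (g := fun=> K)) => //.
exact: rint_cst.
Qed.

Context {E : completeNormedModType R[i]}.
Implicit Types f g : R -> E.

Lemma L1loc_integrable f (a b : R) : 0 <= a -> L1loc f -> bochner_integrable `[a, b] f.
Proof.
move=> a0 [sf fi]; split.
  by apply: strongly_measurable_sub sf => //; exact: itv_half_line.
have [ab|ba] := leP a b; last first.
  by rewrite set_itv_ge ?integral_set0 ?ltry// bnd_simp -ltNge.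
apply: le_lt_trans (fi b (le_trans a0 ab)).
apply: ge0_subset_integral => //.
- apply/measurable_EFinP; apply: measurable_rnorm => //.
  by apply: strongly_measurable_sub sf => //; exact: itv_half_line.
- by move=> t _; rewrite lee_fin rnorm_ge0.
- by move=> t /=; rewrite !in_itv/= => /andP[at_ ->]; rewrite (le_trans a0).
Qed.

Lemma L1loc_dominated {F : completeNormedModType R[i]} f (g : R -> F) (K : R -> R) :
  strongly_measurable `[0, +oo[ f -> L1loc g ->
  (forall t s, 0 <= s -> s <= t -> rnorm (f s) <= K t * rnorm (g s)) -> L1loc f.
Proof.
move=> sf lg fg; split=> // t t0.
have bg : bochner_integrable `[0, t] g.
  move: lg => [sg gi]; split; last exact: gi.
  by apply: strongly_measurable_sub sg => //; exact: itv_half_line.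
have ig : mu.-integrable `[0, t] (EFin \o (fun s => rnorm (g s))).
  exact: rnorm_integrable.
have i1 : mu.-integrable `[0, t] (EFin \o (fun s => rnorm (f s))).
  apply: (rint_dominated _ (g := fun s => K t * rnorm (g s))) => //.
  - apply: measurable_rnorm => //.
    by apply: strongly_measurable_sub sf => //; exact: itv_half_line.
  - move=> s /=; rewrite in_itv/= => /andP[s0 st].
    by rewrite ger0_norm ?rnorm_ge0// fg.
  - exact: rint_scale.
exact: (integrable_lty _ i1).
Qed.

Lemma L1loc_bounded f (K : R -> R) : strongly_measurable `[0, +oo[ f ->
  (forall t s, 0 <= s -> s <= t -> rnorm (f s) <= K t) -> L1loc f.
Proof.
move=> sf fK; split=> // t t0.
have i1 : mu.-integrable `[0, t] (EFin \o (fun s => rnorm (f s))).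
  apply: (rint_bounded (K := K t)).
    apply: measurable_rnorm => //.
    by apply: strongly_measurable_sub sf => //; exact: itv_half_line.
  by move=> s /andP[s0 st]; rewrite ger0_norm ?rnorm_ge0// fK.
exact: (integrable_lty _ i1).
Qed.

Lemma L1loc_add f g : L1loc f -> L1loc g -> L1loc (fun t => f t + g t).
Proof.
move=> lf lg; have sm : strongly_measurable `[0, +oo[ (fun t => f t + g t).
  by apply: strongly_measurable_add; [case: lf|case: lg].
split=> // t t0.
have i1 : mu.-integrable `[0, t] (EFin \o (fun s => rnorm (f s + g s))).
  apply: (rint_dominated _ (g := fun s => rnorm (f s) + rnorm (g s))) => //.
  - apply: measurable_rnorm => //.
    by apply: strongly_measurable_sub sm => //; exact: itv_half_line.
  - by move=> s _; rewrite ger0_norm ?rnorm_ge0// ler_rnormD.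
  - by apply: rint_add => //; apply: rnorm_integrable => //; exact: L1loc_integrable.
exact: (integrable_lty _ i1).
Qed.

Lemma continuous_bounded {F : normedModType R[i]} (f : R -> F) : continuous f ->
  exists K : R -> R, forall t s, 0 <= s -> s <= t -> rnorm (f s) <= K t.
Proof.
move=> cf.
have H t : exists K, forall s, 0 <= s -> s <= t -> rnorm (f s) <= K.
  have [t0|t0] := leP 0 t; last first.
    by exists 0 => s s0 st; have := le_trans s0 st; rewrite leNgt t0.
  have c : {within `[0, t], continuous (fun s => rnorm (f s))}.
    by apply: continuous_subspaceT => s; apply: rcvg_norm; exact: cf.
  have [m _ hm] := EVT_max t0 c.
  by exists (rnorm (f m)) => s s0 st; apply: hm; rewrite in_itv/= s0.
by exists (fun t => projT1 (cid (H t))) => t; case: cid.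
Qed.

Lemma L1loc_continuous f : continuous f -> L1loc f.
Proof.
move=> cf; have [K fK] := continuous_bounded cf.
by apply: (L1loc_bounded (K := K)) => //; exact: strongly_measurable_continuous.
Qed.

Lemma L1loc_ext f g : (forall t, 0 <= t -> f t = g t) -> L1loc f -> L1loc g.
Proof.
move=> fg [sf fi]; split.
  by apply: strongly_measurable_ext sf => t; rewrite inE/= in_itv/= andbT; exact: fg.
move=> t t0; move: (fi t t0); congr (_ < _)%E; apply: eq_integral => s.
by rewrite inE/= in_itv/= => /andP[s0 _]; rewrite fg.
Qed.

End LocallyIntegrable.

Section LocallyIntegrableOperators.
Context {R : realType}.

Lemma L1loc_op {E F : completeNormedModType R[i]} (T : E -> F) (f : R -> E) :
  bounded_op T -> L1loc f -> L1loc (fun t => T (f t)).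
Proof.
move=> bT lf; case/bounded_opP: (bT) => lT [K K0 TK].
apply: (L1loc_dominated (K := fun=> K) (g := f)) => //.
by apply: strongly_measurable_op => //; case: lf.
Qed.

Lemma L1loc_sub {E : completeNormedModType R[i]} (f g : R -> E) :
  L1loc f -> L1loc g -> L1loc (fun t => f t - g t).
Proof. by move=> lf lg; exact: L1loc_add lf (L1loc_op bounded_opp lg). Qed.

End LocallyIntegrableOperators.

Section Primitive.
Context {R : realType}.
Local Notation mu := (@lebesgue_measure R).

Definition prim {E : normedModType R[i]} (f : R -> E) (t : R) : E := bochner `[0, t] f.

Lemma prim_rfun {E : completeNormedModType R[i]} (f : R -> E) (psi : E -> R) t :
  L1loc f -> is_rfun psi -> psi (prim f t) = \int[mu]_(s in `[0, t]) psi (f s).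
Proof. by move=> lf p; apply: bochner_rfun => //; exact: L1loc_integrable. Qed.

Lemma prim_unique {E : completeNormedModType R[i]} (f : R -> E) t (I : E) : L1loc f ->
  (forall psi, is_rfun psi -> psi I = \int[mu]_(s in `[0, t]) psi (f s)) ->
  prim f t = I.
Proof. by move=> lf h; apply: bochner_unique => //; exact: L1loc_integrable. Qed.

Lemma eq_prim {E : completeNormedModType R[i]} (f g : R -> E) t :
  (forall s, 0 <= s -> s <= t -> f s = g s) -> prim f t = prim g t.
Proof.
move=> fg; apply: eq_bochner => s; rewrite inE/= in_itv/= => /andP[s0 st].
exact: fg.
Qed.

#[global] Opaque prim.

Lemma prim_op {E F : completeNormedModType R[i]} (T : E -> F) (f : R -> E) t :
  bounded_op T -> L1loc f -> T (prim f t) = prim (fun s => T (f s)) t.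
Proof.
move=> bT lf; apply/esym/prim_unique; first exact: L1loc_op.
by move=> psi p; rewrite (prim_rfun t lf (rfun_comp p bT)).
Qed.

Lemma rfun_L1loc {E : completeNormedModType R[i]} (psi : E -> R) (f : R -> E) (a b : R) :
  0 <= a -> is_rfun psi -> L1loc f ->
  mu.-integrable `[a, b] (EFin \o (fun s => psi (f s))).
Proof. by move=> a0 p lf; apply: rfun_integrable => //; exact: L1loc_integrable. Qed.

Lemma prim_add {E : completeNormedModType R[i]} (f g : R -> E) t :
  L1loc f -> L1loc g -> prim (fun s => f s + g s) t = prim f t + prim g t.
Proof.
move=> lf lg; apply: prim_unique; first exact: L1loc_add.
move=> psi p; case: (p) => pD _ _; rewrite pD !prim_rfun//.
rewrite -RintegralD//; [|exact: rfun_L1loc..].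
by apply: eq_Rintegral => s _; rewrite pD.
Qed.

Lemma prim_sub {E : completeNormedModType R[i]} (f g : R -> E) t :
  L1loc f -> L1loc g -> prim (fun s => f s - g s) t = prim f t - prim g t.
Proof.
move=> lf lg; rewrite (prim_add t lf (L1loc_op bounded_opp lg)).
by rewrite -(prim_op t bounded_opp lg).
Qed.

Lemma prim0 {E : completeNormedModType R[i]} (f : R -> E) : L1loc f -> prim f 0 = 0.
Proof.
move=> lf; apply: prim_unique => // psi p.
by rewrite set_itv1 Rintegral_set1 rfun0.
Qed.

(** The mean value inequality from which differentiability of primitives follows. *)
Lemma prim_increment {E : completeNormedModType R[i]} (f : R -> E) (v : E) (a b e : R) :
  L1loc f -> 0 <= a -> a <= b -> (forall s, a <= s -> s <= b -> rnorm (f s - v) <= e) ->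
  rnorm (prim f b - prim f a - (b - a)%:C *: v) <= e * (b - a).
Proof.
move=> lf a0 ab fe; apply: rnorm_le_rfun => psi p pb.
rewrite !rfunB//; case: (p) => _ pZ _; rewrite pZ !prim_rfun//.
have i1 : mu.-integrable `[0, b] (EFin \o (fun s => psi (f s))) by exact: rfun_L1loc.
have i2 : mu.-integrable `[a, b] (EFin \o (fun s => psi (f s))) by exact: rfun_L1loc.
have -> : \int[mu]_(s in `[0, b]) psi (f s) - \int[mu]_(s in `[0, a]) psi (f s) =
    \int[mu]_(s in `[a, b]) psi (f s).
  rewrite (Rintegral_itvB i1) ?bnd_simp//.
  rewrite Rintegral_itv_obnd_cbnd//; apply: integrableS i2 => //.
  by move=> s /=; rewrite !in_itv/= => /andP[/ltW-> ->].
rewrite [_ * psi v]mulrC -(Rint_cst (psi v) ab) -RintegralB//; last exact: rint_cst.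
rewrite -(Rint_cst e ab).
apply: le_Rintegral => //.
- by apply: rint_sub => //; exact: rint_cst.
- exact: rint_cst.
- move=> s /=; rewrite in_itv/= => /andP[as_ sb].
  rewrite -rfunB//; apply: le_trans (ler_norm _) _.
  by apply: le_trans (pb _) _; exact: fe.
Qed.

End Primitive.


(** * Real integrals and Fubini on triangles *)

Section RealCalculus.
Context {R : realType}.
Local Notation mu := (@lebesgue_measure R).

Lemma Rint_FTC2 (p k : R -> R) (a b : R) : a <= b -> continuous k -> continuous p ->
  (forall x, a < x -> x < b -> is_derive x (1 : R) p (k x)) ->
  \int[mu]_(x in `[a, b]) k x = p b - p a.
Proof.
rewrite le_eqVlt => /predU1P[<- _ _ _|ab ck cp dp].
  by rewrite set_itv1 Rintegral_set1 subrr.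
rewrite /Rintegral (@continuous_FTC2 _ k p)//.
- exact: continuous_subspaceT.
- split.
  + by move=> x; rewrite in_itv/= => /andP[ax xb]; case: (dp x ax xb).
  + by apply: cvg_at_right_filter; exact: cp.
  + by apply: cvg_at_left_filter; exact: cp.
- move=> x; rewrite in_itv/= => /andP[ax xb].
  by rewrite derive1E; have /@derive_val -> := dp x ax xb.
Qed.

Let deriv_shift (s : R) : derive1 (fun r : R => r - s) = cst 1.
Proof.
apply/funext => x; rewrite derive1E.
by have /@derive_val -> : is_derive x (1 : R) (fun r : R => r - s) 1
  by apply: is_derive_eq; rewrite subr0.
Qed.

Let deriv_reflect (s : R) : derive1 (fun r : R => s - r) = cst (-1).
Proof.
apply/funext => x; rewrite derive1E.
by have /@derive_val -> : is_derive x (1 : R) (fun r : R => s - r) (-1)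
  by rewrite -[X in is_derive _ _ _ X]sub0r; apply: is_deriveB.
Qed.

Lemma Rint_shift (k : R -> R) (s T : R) : s <= T -> continuous k ->
  \int[mu]_(r in `[s, T]) k (r - s) = \int[mu]_(r in `[0, T - s]) k r.
Proof.
move=> sT ck; rewrite /Rintegral; congr fine.
have cF : continuous (fun r : R => r - s) by move=> x; apply: cvgB => //; exact: cvg_cst.
have := @integration_by_substitution_increasing R (fun r => r - s) k s T sT.
rewrite subrr deriv_shift => ->.
- by apply: eq_integral => r _; rewrite /= mulr1.
- by move=> x y _ _ xy; rewrite ltrD2r.
- by move=> x _; exact: cvg_cst.
- exact: is_cvg_cst.
- exact: is_cvg_cst.
- split.
  + by move=> x _; exact: derivableB.
  + by apply: cvg_at_right_filter; exact: cF.
  + by apply: cvg_at_left_filter; exact: cF.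
- exact: continuous_subspaceT.
Qed.

Lemma Rint_reflect (k : R -> R) (s T : R) : s <= T -> continuous k ->
  \int[mu]_(r in `[s, T]) k (T - r) = \int[mu]_(r in `[0, T - s]) k r.
Proof.
move=> sT ck; rewrite /Rintegral; congr fine.
have cF : continuous (fun r : R => T - r) by move=> x; apply: cvgB => //; exact: cvg_cst.
have := @integration_by_substitution_decreasing R (fun r => T - r) k s T sT.
rewrite subrr deriv_reflect => ->.
- by apply: eq_integral => r _; rewrite /= opprK mulr1.
- by move=> x y _ _ xy; rewrite ltrD2l ltrN2.
- by move=> x _; exact: cvg_cst.
- exact: is_cvg_cst.
- exact: is_cvg_cst.
- split.
  + by move=> x _; exact: derivableB.
  + by apply: cvg_at_right_filter; exact: cF.
  + by apply: cvg_at_left_filter; exact: cF.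
- exact: continuous_subspaceT.
Qed.

End RealCalculus.

Section Kernel.
Context {R : realType} {E : completeNormedModType R[i]}.
Local Notation mu := (@lebesgue_measure R).
Variables (f : R -> E) (a : R -> R -> E -> R) (T K : R).
Hypotheses (T0 : 0 <= T) (K0 : 0 <= K) (lf : L1loc f)
  (ma : forall v, measurable_fun setT (fun p : R * R => a p.1 p.2 v))
  (ca : forall r s (u : nat -> E) v, u n @[n --> \oo] --> v ->
     a r s (u n) @[n --> \oo] --> a r s v)
  (ba : forall r s v, 0 <= s -> s <= r -> r <= T -> `|a r s v| <= K * rnorm v).

Let tri : set (R * R) := [set p | 0 <= p.2 /\ p.2 <= p.1 /\ p.1 <= T].

Let mtri : measurable tri.
Proof.
have -> : tri = (snd @^-1` `[0, +oo[) `&`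
    ((fun p : R * R => p.1 - p.2) @^-1` `[0, +oo[) `&` (fst @^-1` `]-oo, T]).
  apply/seteqP; split=> p; rewrite /tri /= !in_itv/= !andbT subr_ge0.
    by case=> ? [? ?].
  by case=> -[? ?] ?.
apply: measurableI; first apply: measurableI.
- by rewrite -[X in measurable X]setTI; apply: measurable_snd => //; exact: measurable_itv.
- rewrite -[X in measurable X]setTI; apply: measurable_funB => //; exact: measurable_itv.
- by rewrite -[X in measurable X]setTI; apply: measurable_fst => //; exact: measurable_itv.
Qed.

Let H : R * R -> R := (fun p => a p.1 p.2 (f p.2)) \_ tri.

Let mH : measurable_fun setT H.
Proof.
apply/(measurable_restrictT _ mtri).
have m : measurable_fun (snd @^-1` (`[0, +oo[%classic : set R))
    (fun p : R * R => a p.1 p.2 (f p.2)).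
  apply: (measurable_strongly (a := fun p v => a p.1 p.2 v) (p := snd)) => //.
  - by move=> [r s] u v uv; exact: ca.
  - by case: lf.
apply: measurable_funS m.
- by rewrite -[X in measurable X]setTI; apply: measurable_snd => //; exact: measurable_itv.
- by move=> p [p0 _] /=; rewrite in_itv/= andbT.
Qed.

Let g (s : R) : R := K * rnorm (f s).

Let ig : mu.-integrable `[0, T] (EFin \o g).
Proof.
by apply: rint_scale => //; apply: rnorm_integrable => //; exact: L1loc_integrable.
Qed.

Let Hg r s : `|H (r, s)| <= (g \_ `[0, T]) s * \1_(`[0, T]%classic : set R) r.
Proof.
rewrite /H patchE; case: ifPn => [/set_mem /= [s0 [sr rT]]|_].
  rewrite patchE mem_set; last by rewrite /= in_itv/= s0 (le_trans sr).
  by rewrite indicE mem_set ?mulr1 ?ba//= in_itv/= rT (le_trans s0).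
rewrite normr0 mulr_ge0// patchE; case: ifP => // _.
by rewrite mulr_ge0 ?rnorm_ge0.
Qed.

Let ig' : mu.-integrable setT (EFin \o (g \_ `[0, T])).
Proof.
by rewrite -restrict_EFin; apply/integrable_restrict => //; rewrite setTI.
Qed.

Let mHr r : measurable_fun setT (fun s => H (r, s)).
Proof. by apply: (measurableT_comp mH); exact: measurable_pair1. Qed.

Let mHs s : measurable_fun setT (fun r => H (r, s)).
Proof. by apply: (measurableT_comp mH); exact: measurable_pair2. Qed.

Let iHr r : mu.-integrable setT (fun s => (H (r, s))%:E).
Proof.
apply: (rint_dominated measurableT (g := g \_ `[0, T])) => //.
move=> s _; apply: le_trans (Hg r s) _.
apply: ler_piMr; last by rewrite indicE lern1 leq_b1.
by rewrite patchE; case: ifP => // _; rewrite mulr_ge0 ?rnorm_ge0.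
Qed.

Let iHs s : mu.-integrable setT (fun r => (H (r, s))%:E).
Proof.
apply: (rint_dominated measurableT
  (g := fun r => (g \_ `[0, T]) s * \1_(`[0, T]%classic : set R) r)) => //.
apply: rint_scale => //; exact: integrable_indic_itv.
Qed.

Let iH : (mu \x mu)%E.-integrable setT (EFin \o H).
Proof.
apply/integrable12ltyP; first exact/measurable_EFinP.
pose c := fine (\int[mu]_s ((g \_ `[0, T]) s)%:E).
have ifin : (\int[mu]_s ((g \_ `[0, T]) s)%:E \is a fin_num)%E.
  exact: (integrable_fin_num _ ig').
have le r : (\int[mu]_s `|(EFin \o H) (r, s)| <= (c * \1_(`[0, T]%classic : set R) r)%:E)%E.
  rewrite /c EFinM fineK// -integralZr//.
  apply: ge0_le_integral => //.
  - by apply: (measurableT_comp (f := abse)) => //; apply/measurable_EFinP; exact: mHr.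
  - apply/measurable_EFinP; apply: measurable_funM => //.
    exact: (rint_measurable ig').
  - by move=> s _; rewrite /= -EFinM lee_fin Hg.
have ic : mu.-integrable setT (EFin \o (fun r => c * \1_(`[0, T]%classic : set R) r)).
  by apply: rint_scale => //; exact: integrable_indic_itv.
apply: le_lt_trans (integrable_lty measurableT ic).
apply: ge0_le_integral => //.
- by move=> r _; exact: integral_ge0.
- have m : measurable_fun setT (abse \o (EFin \o H)).
    by apply: measurableT_comp => //; exact/measurable_EFinP.
  have p0 p : (0%R <= (abse \o (EFin \o H)) p)%E by exact: abse_ge0.
  have := @measurable_fun_fubini_tonelli_F _ _ _ _ R mu _ m p0.
  exact.
- exact: (measurable_int _ ic).
Qed.

(** Fubini on a triangle, for a kernel acting on a strongly measurable
    function.  Every convolution identity below is an instance. *)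
Lemma fubini_kernel :
  \int[mu]_(r in `[0, T]) (\int[mu]_(s in `[0, r]) a r s (f s)) =
  \int[mu]_(s in `[0, T]) (\int[mu]_(r in `[s, T]) a r s (f s)).
Proof.
have L r : ((fun r => \int[mu]_(s in `[0, r]) a r s (f s)) \_ `[0, T]) r =
    \int[mu]_s H (r, s).
  rewrite patchE; case: ifPn => rI.
    move: (set_mem rI); rewrite /= in_itv/= => /andP[r0 rT].
    rewrite Rintegral_mkcond; apply: eq_Rintegral => s _.
    rewrite /H !patchE; case: ifPn => sI.
      move: (set_mem sI); rewrite /= in_itv/= => /andP[s0 sr].
      by rewrite mem_set.
    rewrite ifF//; apply/negbTE; rewrite notin_setE => -[/= s0 [sr _]].
    by move: sI; rewrite notin_setE/= in_itv/= s0 sr.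
  rewrite (_ : (fun s => H (r, s)) = cst 0) ?/Rintegral ?integral0//.
  apply/funext => s; rewrite /H patchE ifF//; apply/negbTE; rewrite notin_setE.
  move=> [/= s0 [sr rT]]; move: rI.
  by rewrite notin_setE/= in_itv/= rT (le_trans s0).
have M s : ((fun s => \int[mu]_(r in `[s, T]) a r s (f s)) \_ `[0, T]) s =
    \int[mu]_r H (r, s).
  rewrite patchE; case: ifPn => sI.
    move: (set_mem sI); rewrite /= in_itv/= => /andP[s0 sT].
    rewrite Rintegral_mkcond; apply: eq_Rintegral => r _.
    rewrite /H !patchE; case: ifPn => rI.
      move: (set_mem rI); rewrite /= in_itv/= => /andP[sr rT].
      by rewrite mem_set.
    rewrite ifF//; apply/negbTE; rewrite notin_setE => -[/= _ [sr rT]].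
    by move: rI; rewrite notin_setE/= in_itv/= sr rT.
  rewrite (_ : (fun r => H (r, s)) = cst 0) ?/Rintegral ?integral0//.
  apply/funext => r; rewrite /H patchE ifF//; apply/negbTE; rewrite notin_setE.
  move=> [/= s0 [sr rT]]; move: sI.
  by rewrite notin_setE/= in_itv/= s0 (le_trans sr).
rewrite Rintegral_mkcond [RHS]Rintegral_mkcond.
under eq_Rintegral do rewrite L.
under [RHS]eq_Rintegral do rewrite M.
rewrite /Rintegral; congr fine.
under eq_integral do rewrite fineK ?(integrable_fin_num measurableT (iHr _))//.
under [RHS]eq_integral do rewrite fineK ?(integrable_fin_num measurableT (iHs _))//.
exact: (Fubini iH).
Qed.

End Kernel.

(** * Convolution with a strongly continuous family *)

Section Sequences.
Context {R : realType}.

Lemma cvg_rdist {E : normedModType R[i]} {T : Type} (F : set_system T)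
    {FF : Filter F} (f : T -> E) (l : E) :
  f x @[x --> F] --> l -> rnorm (f x - l) @[x --> F] --> (0 : R).
Proof. by move=> /rcvgP. Qed.

Lemma continuous_seq {E : normedModType R[i]} (g : R -> E) (t : R) :
  (forall u : nat -> R, u n @[n --> \oo] --> t -> g (u n) @[n --> \oo] --> g t) ->
  g s @[s --> t] --> g t.
Proof.
move=> h; apply/rcvgP.
have H := (@cvg_nbhsP R R^o (fun s : R => rnorm (g s - g t)) t 0).2.
by apply: H => u ut; exact: (cvg_rdist (h u ut)).
Qed.

Lemma continuous_max0 : continuous (Num.max (0 : R)).
Proof.
move=> x; apply/cvgrPdist_lt => e e0; near=> y.
have : `|x - y| < e by near: y; exact: cvgr_dist_lt.
apply: le_lt_trans; rewrite /Num.max.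
by case: ltP => h1; case: ltP => h2; rewrite ?subrr ?normr0//;
  rewrite ler_norml; apply/andP; split; have := ler_norm (x - y);
  have := ler_norm (- (x - y)); rewrite normrN; lra.
Unshelve. all: by end_near. Qed.

End Sequences.

Section DominatedConvergence.
Context {R : realType}.
Local Notation mu := (@lebesgue_measure R).

(** The exceptional point [c] is where integrands that are cut off jump. *)
Lemma Rint_dominated_cvg (D : set R) (h : nat -> R -> R) (l g : R -> R) (c : R) :
  measurable D -> (forall n, mu.-integrable D (EFin \o h n)) ->
  measurable_fun D l -> mu.-integrable D (EFin \o g) ->
  (forall n s, D s -> `|h n s| <= g s) ->
  (forall s, D s -> s != c -> h n s @[n --> \oo] --> l s) ->
  \int[mu]_(s in D) h n s @[n --> \oo] --> \int[mu]_(s in D) l s.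
Proof.
move=> mD ih ml ig hg hl.
have ae : \forall s \ae mu, D s -> (EFin \o h n) s @[n --> \oo] --> (EFin \o l) s.
  exists [set c]; split; first exact: measurable_set1.
    exact: lebesgue_measure_set1.
  move=> s; apply: contra_notP => /eqP sc Ds.
  by apply: cvg_EFin; [exact: nearW|exact: hl].
have ab : \forall s \ae mu, forall n, D s -> (`|(EFin \o h n) s| <= (EFin \o g) s)%E.
  by apply/aeW => s n Ds; rewrite /= lee_fin hg.
have mh n : measurable_fun D (EFin \o h n) := measurable_int _ (ih n).
have ml' : measurable_fun D (EFin \o l) by exact/measurable_EFinP.
have [il _ lim] := @dominated_convergence _ _ R mu D mD _ _ _ mh ml' ae ig ab.
have fl : ((\int[mu]_(s in D) (EFin \o l) s)%E \is a fin_num) :=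
  @integrable_fin_num _ _ _ mu D mD _ il.
by apply: fine_cvg; rewrite fineK//; exact: lim.
Qed.

End DominatedConvergence.

Section PrimitiveDifference.
Context {R : realType} {E : completeNormedModType R[i]}.
Local Notation mu := (@lebesgue_measure R).

Lemma rnorm_primB (f g : R -> E) t : L1loc f -> L1loc g ->
  rnorm (prim f t - prim g t) <= \int[mu]_(s in `[0, t]) rnorm (f s - g s).
Proof.
move=> lf lg; apply: rnorm_le_rfun => psi p pb.
rewrite (rfunB _ _ p).
have -> : psi (prim f t) - psi (prim g t) =
    \int[mu]_(s in `[0, t]) psi (f s) - \int[mu]_(s in `[0, t]) psi (g s).
  by congr (_ - _); exact: prim_rfun.
have ld := L1loc_sub lf lg.
rewrite -RintegralB//; [|exact: rfun_L1loc..].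
apply: le_Rintegral => //.
- by apply: rint_sub => //; exact: rfun_L1loc.
- by apply: rnorm_integrable => //; exact: L1loc_integrable.
- by move=> s _; rewrite -rfunB//; apply: le_trans (ler_norm _) (pb _).
Qed.

End PrimitiveDifference.

Section StronglyContinuousFamily.
Context {R : realType} {E F : completeNormedModType R[i]}.
Local Notation mu := (@lebesgue_measure R).

(** Operators depending on a real parameter, strongly continuous and uniformly
    bounded to the left of every time; a function of nonnegative times enters
    through [Num.max 0]. *)
Definition sc_family (K : R -> E -> F) : Prop :=
  [/\ forall r, linear (K r),
      exists M : R -> R, (forall t, 0 <= M t) /\
        forall t r v, r <= t -> rnorm (K r v) <= M t * rnorm v &
      forall v, continuous (K^~ v)].

Lemma sc_family_bounded K r : sc_family K -> bounded_op (K r).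
Proof.
case=> lK [M [M0 hM]] _; apply/bounded_opP; split=> //.
by exists (M r) => // v; exact: hM.
Qed.

Lemma sc_family_cvg K (r : nat -> R) (v : nat -> E) r0 v0 : sc_family K ->
  r n @[n --> \oo] --> r0 -> v n @[n --> \oo] --> v0 ->
  K (r n) (v n) @[n --> \oo] --> K r0 v0.
Proof.
move=> [lK [M [M0 hM]] cK] rr vv.
have c1 : K (r n) v0 @[n --> \oo] --> K r0 v0.
  exact: (cvg_comp _ _ rr (cK v0 r0)).
have c2 : K (r n) (v n - v0) @[n --> \oo] --> (0 : F).
  apply: (@rcvg_dominated _ _ _ _ _ _ (fun n => M (r0 + 1) * rnorm (v n - v0))).
    have : \forall n \near \oo, r n < r0 + 1.
      by apply: cvgr_lt rr _ _; rewrite ltrDl.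
    by apply: filterS => n rn; rewrite subr0; apply: hM; exact: ltW.
  by rewrite -[X in _ --> X](mulr0 (M (r0 + 1))); apply: cvgMr; apply/rcvgP.
have -> : (fun n => K (r n) (v n)) = (fun n => K (r n) (v n - v0) + K (r n) v0).
  by apply/funext => n; rewrite -linD// subrK.
by rewrite -[X in _ --> X]add0r; exact: cvgD.
Qed.

Variables (K : R -> E -> F) (scK : sc_family K).

Definition conv (f : R -> E) (t : R) : F := prim (fun s => K (t - s) (f s)) t.

Lemma conv_L1loc f t : L1loc f -> L1loc (fun s => K (t - s) (f s)).
Proof.
move=> lf; case: (scK) => lK [M [M0 hM]] cK.
apply: (L1loc_dominated (K := fun=> M t) (g := f)) => //; last first.
  by move=> _ s s0 _; apply: hM; rewrite gerBl.
have sf : strongly_measurable `[0, +oo[ f by case: lf.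
apply: (@strongly_measurable_comp _ _ _ _ (fun s v _ => K (t - s) v) _ _ sf sf).
move=> s r u v _ _ rs uf _; apply: sc_family_cvg => //.
by apply: cvgB => //; exact: cvg_cst.
Qed.

Lemma conv_rfun f t (psi : F -> R) : L1loc f -> is_rfun psi ->
  psi (conv f t) = \int[mu]_(s in `[0, t]) psi (K (t - s) (f s)).
Proof.
by move=> lf p; exact: (prim_rfun t (conv_L1loc t lf) p).
Qed.

(** Extended by zero beyond [w], the integrands live on a common interval. *)
Let cut (f : R -> E) (w s : R) : F := if s <= w then K (w - s) (f s) else 0.

Let cut_L1loc f w : L1loc f -> L1loc (cut f w).
Proof.
move=> lf; case: (scK) => lK [M [M0 hM]] cK.
have sf : strongly_measurable `[0, +oo[ f by case: lf.
apply: (L1loc_dominated (K := fun=> M w) (g := f)) => //; last first.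
  move=> _ s s0 _; rewrite /cut; case: ifP => _; first by apply: hM; rewrite gerBl.
  by rewrite rnorm0 mulr_ge0 ?rnorm_ge0.
apply: (@strongly_measurable_comp _ _ _ _
  (fun s v _ => if s <= w then K (w - s) v else 0) _ _ sf sf).
move=> s r u v _ rs rc uf _; case: ifPn => [sw|].
  have -> : (fun n => if r n <= w then K (w - r n) (u n) else 0) =
      (fun n => K (w - r n) (u n)).
    by apply/funext => n; rewrite (le_trans _ sw)//; case/andP: (rs n).
  by apply: sc_family_cvg => //; apply: cvgB => //; exact: cvg_cst.
rewrite -ltNge => ws; apply: (@cvg_trans _ ((fun=> (0 : F)) @ \oo)); last exact: cvg_cst.
apply: near_eq_cvg; have : \forall n \near \oo, w < r n by apply: cvgr_gt rc _ _.
by apply: filterS => n wr; rewrite leNgt wr.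
Qed.

Let cutE f w N : L1loc f -> w <= N -> conv f w = prim (cut f w) N.
Proof.
move=> lf wN; apply: rfun_ext => psi p; rewrite conv_rfun// prim_rfun//; last exact: cut_L1loc.
rewrite Rintegral_mkcond [RHS]Rintegral_mkcond; apply: eq_Rintegral => s _.
rewrite !patchE /cut; case: ifPn => sI.
  move: (set_mem sI); rewrite /= in_itv/= => /andP[s0 sw].
  by rewrite mem_set ?sw//= in_itv/= s0 (le_trans sw).
case: ifPn => // sI'; move: (set_mem sI'); rewrite /= in_itv/= => /andP[s0 sN].
by case: ifPn => [sw|_]; [move: sI; rewrite notin_setE/= in_itv/= s0 sw|rewrite rfun0].
Qed.

Let cut_cvg f (w : nat -> R) c s : s != c -> w n @[n --> \oo] --> c ->
  cut f (w n) s @[n --> \oo] --> cut f c s.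
Proof.
move=> sc wc; rewrite /cut; have [lt|gt] := ltP s c.
  rewrite (ltW lt); apply: (@cvg_trans _ ((fun n => K (w n - s) (f s)) @ \oo)).
    apply: near_eq_cvg; have : \forall n \near \oo, s < w n by apply: cvgr_gt wc _ _.
    by apply: filterS => n /ltW ->.
  by apply: sc_family_cvg => //; [apply: cvgB => //; exact: cvg_cst|exact: cvg_cst].
have cs : c < s by rewrite lt_def sc.
rewrite leNgt cs/=; apply: (@cvg_trans _ ((fun=> (0 : F)) @ \oo)); last exact: cvg_cst.
apply: near_eq_cvg; have : \forall n \near \oo, w n < s by apply: cvgr_lt wc _ _.
by apply: filterS => n ws; rewrite leNgt ws.
Qed.

(** Convolutions with locally integrable inputs are continuous, by dominated
    convergence: the integrands converge except at the end point. *)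
Lemma conv_continuous f : L1loc f -> continuous (fun t : R => conv f (Num.max 0 t)).
Proof.
move=> lf t; apply: continuous_seq => u ut.
set c := Num.max 0 t.
have uc : Num.max 0 (u n) @[n --> \oo] --> c.
  by apply: continuous_cvg => //; exact: continuous_max0.
pose w n := if Num.max 0 (u n) < c + 1 then Num.max 0 (u n) else c.
have wu : \forall n \near \oo, Num.max 0 (u n) = w n.
  have : \forall n \near \oo, Num.max 0 (u n) < c + 1.
    by apply: cvgr_lt uc _ _; rewrite ltrDl.
  by apply: filterS => n un; rewrite /w un.
have wc : w n @[n --> \oo] --> c.
  by apply: cvg_trans uc; apply: near_eq_cvg.
apply: (@cvg_trans _ ((fun n => conv f (w n)) @ \oo)).
  by apply: near_eq_cvg; apply: filterS wu => n ->.
case: (scK) => lK [M [M0 hM]] cK.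
have c0 : 0 <= c by rewrite le_max lexx.
have cN : c <= c + 1 by rewrite lerDl.
have wN n : w n <= c + 1 by rewrite /w; case: ifP => // /ltW.
pose h n s := rnorm (cut f (w n) s - cut f c s).
pose g s := 2 * M (c + 1) * rnorm (f s).
have mI : measurable (`[0, c + 1]%classic : set R) by exact: measurable_itv.
have ld n := L1loc_sub (cut_L1loc (w n) lf) (cut_L1loc c lf).
have ih n : mu.-integrable `[0, c + 1] (EFin \o h n).
  by apply: rnorm_integrable => //; exact: L1loc_integrable.
have ig : mu.-integrable `[0, c + 1] (EFin \o g).
  by apply: rint_scale => //; apply: rnorm_integrable => //; exact: L1loc_integrable.
have bcut v s : v <= c + 1 -> 0 <= s -> rnorm (cut f v s) <= M (c + 1) * rnorm (f s).
  move=> vN s0; rewrite /cut; case: ifP => _.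
    by apply: hM; apply: le_trans vN; rewrite gerBl.
  by rewrite rnorm0 mulr_ge0 ?rnorm_ge0.
have hg n s : 0 <= s -> h n s <= g s.
  move=> s0; apply: le_trans (ler_rnormB _ _) _; rewrite /g -mulrA mulr2n mulrDl mul1r.
  by apply: lerD; exact: bcut.
have est n : rnorm (conv f (w n) - conv f c) <= \int[mu]_(s in `[0, c + 1]) h n s.
  rewrite (cutE lf (wN n)) (cutE lf cN).
  exact: (rnorm_primB (c + 1) (cut_L1loc (w n) lf) (cut_L1loc c lf)).
apply: (@rcvg_dominated _ _ _ _ _ _ (fun n => \int[mu]_(s in `[0, c + 1]) h n s)).
  by apply: nearW => n; exact: est.
have e : \int[mu]_(s in `[0, c + 1]) (cst 0 : R -> R) s = 0.
  by rewrite /Rintegral integral0.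
have mc : measurable_fun `[0, c + 1] (cst 0 : R -> R) by exact: measurable_cst.
have L : \int[mu]_(s in `[0, c + 1]) h n s @[n --> \oo] -->
    \int[mu]_(s in `[0, c + 1]) (cst 0 : R -> R) s.
  apply: (Rint_dominated_cvg mI ih mc ig (c := c)).
  - move=> n s /=; rewrite in_itv/= => /andP[s0 _].
    by rewrite ger0_norm ?rnorm_ge0// hg.
  - by move=> s _ sc; apply: cvg_rdist; exact: cut_cvg.
by rewrite e in L.
Qed.

End StronglyContinuousFamily.

(** * Second primitives, and uniform boundedness *)

Section PrimitiveContinuity.
Context {R : realType} {E : completeNormedModType R[i]}.
Local Notation mu := (@lebesgue_measure R).

Lemma max0_id (t : R) : 0 <= t -> Num.max 0 t = t.
Proof. by move=> t0; rewrite max_r. Qed.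

Lemma max0_ge0 (t : R) : 0 <= Num.max 0 t.
Proof. by rewrite le_max lexx. Qed.

Lemma L1loc_max0 (f : R -> E) : continuous (fun t : R => f (Num.max 0 t)) -> L1loc f.
Proof.
move=> cf; apply: (L1loc_ext _ (L1loc_continuous cf)) => t t0.
by rewrite max0_id.
Qed.

Lemma sc_family_id : sc_family (fun (_ : R) (v : E) => v).
Proof.
split; first by [].
  by exists (fun=> 1); split=> // t r v _; rewrite mul1r.
by move=> v r; exact: cvg_cst.
Qed.

Lemma prim_continuous (f : R -> E) : L1loc f ->
  continuous (fun t : R => prim f (Num.max 0 t)).
Proof. by move=> lf; exact: (conv_continuous sc_family_id lf). Qed.

Lemma L1loc_prim (f : R -> E) : L1loc f -> L1loc (prim f).
Proof. by move=> lf; apply: L1loc_max0; exact: prim_continuous. Qed.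

Lemma sc_family_ramp : sc_family (fun (r : R) (v : E) => (Num.max 0 r)%:C *: v).
Proof.
split; first by move=> r a u v; rewrite scalerDr !scalerA mulrC.
  exists (Num.max 0); split; first exact: max0_ge0.
  move=> t r v rt; rewrite rnormZr ger0_norm ?max0_ge0//.
  by rewrite ler_wpM2r ?rnorm_ge0// ge_max max0_ge0/= le_max rt orbT.
move=> v r; apply: (@rcvg_dominated _ _ _ _ _ _
    (fun s => `|Num.max 0 s - Num.max 0 r| * rnorm v)).
  by apply: nearW => s; rewrite -scalerBl -rmorphB rnormZr.
rewrite -[X in _ --> X](mul0r (rnorm v)); apply: cvgMl.
apply/cvgrPdist_lt => e e0.
have /cvgrPdist_lt/(_ _ e0) := @continuous_max0 R r.
by apply: filterS => s; rewrite sub0r normrN normr_id distrC.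
Qed.

Lemma second_primitiveE (f : R -> E) t : 0 <= t ->
  L1loc f -> second_primitive f t = prim (prim f) t.
Proof.
move=> t0 lf.
have -> : second_primitive f t = conv (fun r v => (Num.max 0 r)%:C *: v) f t.
  apply: eq_prim => s s0 st; rewrite max0_id// subr_ge0//.
apply: rfun_ext => psi p; case: (p) => _ pZ [K K0 pK].
apply: (etrans (conv_rfun sc_family_ramp t lf p)).
apply: (etrans _ (esym (prim_rfun t (L1loc_prim lf) p))).
have -> : \int[mu]_(s in `[0, t]) psi (prim f s) =
    \int[mu]_(s in `[0, t]) (\int[mu]_(r in `[0, s]) psi (f r)).
  by apply: eq_Rintegral => s _; exact: prim_rfun.
rewrite (fubini_kernel (a := fun _ _ v => psi v) (K := K) K0 lf)//.
- apply: eq_Rintegral => s; rewrite inE/= in_itv/= => /andP[s0 st].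
  by rewrite pZ Rint_cst// max0_id ?subr_ge0// mulrC.
- by move=> r s u v uv; exact: rfun_cvg.
Qed.

(** A continuous function is the derivative of its primitive. *)
Lemma prim_eq0 (f : R -> E) : continuous f -> (forall t, 0 <= t -> prim f t = 0) ->
  forall t, 0 <= t -> f t = 0.
Proof.
move=> cf f0 t t0; apply/rnorm0_eq0/eqP; rewrite eq_le rnorm_ge0 andbT.
apply/ler_addgt0Pl => e e0; rewrite addr0.
have /cvgrPdist_lt/(_ _ e0) : rnorm (f s - f t) @[s --> t] --> (0 : R).
  by apply: cvg_rdist; exact: cf.
move=> /nbhs_ballP[d /= d0 hd].
have lf := L1loc_continuous cf.
have d2 : 0 < d / 2 by rewrite divr_gt0.
have H : rnorm (prim f (t + d / 2) - prim f t - (t + d / 2 - t)%:C *: f t)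
    <= e * (t + d / 2 - t).
  apply: prim_increment => //; first by rewrite lerDl ltW.
  move=> s ts sd; have := hd s; rewrite sub0r normrN ger0_norm ?rnorm_ge0//.
  move=> h; apply/ltW/h; rewrite /ball /= distrC ger0_norm ?subr_ge0//.
  by lra.
have E' : t + d / 2 - t = d / 2 by rewrite addrAC subrr add0r.
move: H; rewrite E' f0 ?f0//; last by rewrite addr_ge0// ltW.
by rewrite subrr sub0r rnormN rnormZr gtr0_norm// mulrC ler_pM2r.
Qed.

Lemma prim_injective (f g : R -> E) :
  continuous (fun t : R => f (Num.max 0 t)) -> continuous (fun t : R => g (Num.max 0 t)) ->
  (forall t, 0 <= t -> prim f t = prim g t) -> forall t, 0 <= t -> f t = g t.
Proof.
move=> cf cg fg t t0; have lf := L1loc_max0 cf; have lg := L1loc_max0 cg.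
pose d (t : R) := f (Num.max 0 t) - g (Num.max 0 t).
have cd : continuous d by move=> s; apply: cvgB; [exact: cf|exact: cg].
have /(_ t t0) : forall s, 0 <= s -> d s = 0.
  apply: (prim_eq0 cd) => s s0.
  rewrite (_ : prim d s = prim (fun s => f s - g s) s); last first.
    by apply: eq_prim => r r0 _; rewrite /d max0_id.
  by rewrite (prim_sub s lf lg) (fg s s0) subrr.
by rewrite /d max0_id// => /eqP; rewrite subr_eq0 => /eqP.
Qed.

Lemma L1loc_second_primitive (f : R -> E) : L1loc f -> L1loc (second_primitive f).
Proof.
move=> lf; apply: (L1loc_ext _ (L1loc_prim (L1loc_prim lf))).
by move=> t t0; rewrite (second_primitiveE t0 lf).
Qed.

End PrimitiveContinuity.

Lemma second_primitive_op {R : realType} {E F : completeNormedModType R[i]}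
    (T : E -> F) (f : R -> E) t : bounded_op T -> L1loc f -> 0 <= t ->
  T (second_primitive f t) = second_primitive (fun s => T (f s)) t.
Proof.
move=> bT lf t0; rewrite (second_primitiveE t0 lf) (second_primitiveE t0 (L1loc_op bT lf)).
rewrite (prim_op t bT (L1loc_prim lf)).
by apply: eq_prim => s _ _; exact: prim_op.
Qed.

Section UniformBoundedness.
Context {R : realType} {E F : completeNormedModType R[i]}.

(** The operator norm [N] is a supremum, so it is nearly attained. *)
Lemma almost_norming (T : E -> F) : bounded_op T ->
  exists2 N : R, 0 <= N & (forall x, rnorm (T x) <= N * rnorm x) /\
    (0 < N -> exists2 y, rnorm y != 0 & 2 / 3 * N * rnorm y <= rnorm (T y)).
Proof.
move=> /bounded_opP[lT [K K0 TK]].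
pose S := [set r | exists2 x, rnorm x != 0 & r = rnorm (T x) / rnorm x].
have SK : ubound S K.
  move=> _ [x x0 ->]; rewrite ler_pdivrMr// lt_def x0 rnorm_ge0//.
have [[r0 Sr0]|nS] := pselect (S !=set0); last first.
  exists 0 => //; split; last by rewrite ltxx.
  move=> x; rewrite mul0r; have [x0|x0] := eqVneq (rnorm x) 0.
    by have := TK x; rewrite x0 mulr0.
  by exfalso; apply: nS; exists (rnorm (T x) / rnorm x), x.
have hS : has_sup S by split; [exists r0|exists K].
have ub x : rnorm x != 0 -> rnorm (T x) / rnorm x <= sup S.
  by move=> x0; apply: sup_upper_bound => //; exists x.
exists (sup S).
  case: Sr0 => x x0 _; apply: le_trans (ub x x0).
  by rewrite divr_ge0 ?rnorm_ge0.
split.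
  move=> x; have [x0|x0] := eqVneq (rnorm x) 0.
    by have := TK x; rewrite x0 !mulr0.
  by have := ub x x0; rewrite ler_pdivrMr// lt_def x0 rnorm_ge0.
move=> N0; have e0 : 0 < sup S / 3 by rewrite divr_gt0.
have [_ [y y0 ->] h] := sup_adherent e0 hS.
exists y => //.
have yp : 0 < rnorm y by rewrite lt_def y0 rnorm_ge0.
by rewrite -ler_pdivlMr//; apply: le_trans (ltW h); lra.
Qed.

(** Uniform boundedness by a gliding hump: each step moves by [3 ^- k] in a
    direction almost norming for an operator of norm beyond [4 ^ k]; the later
    steps, of total length [3 ^- k / 2], cannot undo the gain. *)
Lemma uniform_boundedness (S : nat -> E -> F) : (forall n, bounded_op (S n)) ->
  (forall x, exists M, forall n, rnorm (S n x) <= M) ->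
  exists M, forall n x, rnorm (S n x) <= M * rnorm x.
Proof.
move=> bS pS; apply: contrapT => nb.
have lS n : linear (S n) by case: (bS n).
have step k : exists ny : nat * E * R,
    [/\ forall x, rnorm (S ny.1.1 x) <= ny.2 * rnorm x, rnorm ny.1.2 = 3^-1 ^+ k,
        2 / 3 * ny.2 * 3^-1 ^+ k <= rnorm (S ny.1.1 ny.1.2) & 4 ^+ k <= ny.2].
  apply: contrapT => nk; apply: nb; exists (4 ^+ k) => n x.
  have [N N0 [h1 h2]] := almost_norming (bS n).
  have [kN|Nk] := leP (4 ^+ k) N; last first.
    apply: le_trans (h1 x) _; apply: ler_wpM2r; [exact: rnorm_ge0|exact: ltW].
  have Np : 0 < N by apply: lt_le_trans kN; rewrite exprn_gt0.
  have [y y0 hy] := h2 Np; exfalso; apply: nk.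
  have yp : 0 < rnorm y by rewrite lt_def y0 rnorm_ge0.
  pose c := 3^-1 ^+ k / rnorm y.
  have c0 : 0 <= c by rewrite divr_ge0 ?exprn_ge0 ?invr_ge0 ?rnorm_ge0.
  exists (n, c%:C *: y, N); split=> //=.
    by rewrite rnormZr ger0_norm// /c divfK.
  rewrite linZ// rnormZr ger0_norm//.
  apply: le_trans (ler_wpM2l c0 hy).
  by rewrite mulrC /c -mulrA [X in _ <= _ * X]mulrC !mulrA divfK// mulrA.
pose ny k := projT1 (cid (step k)).
pose m k := (ny k).1.1; pose y k := (ny k).1.2; pose N k := (ny k).2.
have H k : [/\ forall x, rnorm (S (m k) x) <= N k * rnorm x, rnorm (y k) = 3^-1 ^+ k,
    2 / 3 * N k * 3^-1 ^+ k <= rnorm (S (m k) (y k)) & 4 ^+ k <= N k].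
  by rewrite /m /y /N /ny; case: cid.
pose next k (x : E) :=
  if rnorm (S (m k) (y k)) <= rnorm (S (m k) (x + y k)) then x + y k else x - y k.
pose u := fix u k := if k is k'.+1 then next k' (u k') else 0.
have uS k : rnorm (S (m k) (y k)) <= rnorm (S (m k) (u k.+1)).
  rewrite /= /next; case: ifPn => //; rewrite -ltNge => h.
  have e : S (m k) (y k) + S (m k) (y k) =
      S (m k) (u k + y k) - S (m k) (u k - y k).
    by rewrite linD// linB// opprB [S _ (u k) + _]addrC addrACA subrr addr0.
  have : rnorm (S (m k) (y k) + S (m k) (y k)) <=
      rnorm (S (m k) (u k + y k)) + rnorm (S (m k) (u k - y k)).
    by rewrite e; exact: ler_rnormB.
  rewrite (_ : S (m k) (y k) + S (m k) (y k) = 2%:R%:C *: S (m k) (y k)); last first.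
    by rewrite rmorph_nat scaler_nat mulr2n.
  by rewrite rnormZr ger0_norm//; lra.
have ud k : rnorm (u k.+1 - u k) <= 1 * 3^-1 ^+ k.
  rewrite mul1r /= /next; case: ifP => _; case: (H k) => _ yk _ _.
    by rewrite addrAC subrr add0r yk.
  by rewrite addrAC subrr add0r rnormN yk.
have [x _ xu] : exists2 l, u n @[n --> \oo] --> l &
    forall n, rnorm (l - u n) <= 1 * 3^-1 ^+ n / (1 - 3^-1).
  by apply: geometric_cvg => //; rewrite ?invr_ge0// invf_lt1// ltr1n.
have [M hM] := pS x.
have lb k : N k * 3^-1 ^+ k <= 6 * M.
  case: (H k) => h1 _ h3 _.
  have a1 := h1 (x - u k.+1).
  have a2 := xu k.+1.
  have N0 : 0 <= N k by case: (H k) => _ _ _; apply: le_trans; exact: exprn_ge0.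
  have a3 : N k * rnorm (x - u k.+1) <= N k * (1 * 3^-1 ^+ k.+1 / (1 - 3^-1)).
    exact: ler_wpM2l.
  have a4 := uS k.
  have a5 : rnorm (S (m k) (u k.+1)) <= rnorm (S (m k) x) + rnorm (S (m k) (x - u k.+1)).
    by rewrite linB// -{1}[S _ (u _)](subKr (S (m k) x)); exact: ler_rnormB.
  have a6 := hM (m k).
  have e : 1 * 3^-1 ^+ k.+1 / (1 - 3^-1) = 3^-1 ^+ k / 2 :> R.
    rewrite exprS; by set z := 3^-1 ^+ k; field.
  move: a3; rewrite e => a3.
  move: h3 a3; set z := 3^-1 ^+ k; set w := N k => h3 a3.
  have : 2 / 3 * w * z <= M + w * (z / 2) by lra.
  have -> : w * (z / 2) = (w * z) / 2 by rewrite mulrA.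
  have -> : 2 / 3 * w * z = 2 / 3 * (w * z) by rewrite mulrA.
  lra.
have [k hk] : exists k : nat, 6 * M < (4 / 3) ^+ k.
  pose k := (Num.truncn `|18 * M|).+1; exists k.
  have bern n : 1 + n%:R / 3 <= (4 / 3) ^+ n :> R.
    elim: n => [|n IH]; first by rewrite mul0r addr0 expr0.
    have n0 : 0 <= n%:R :> R by [].
    rewrite exprS; apply: (@le_trans _ _ (4 / 3 * (1 + n%:R / 3))).
      by rewrite -natr1; lra.
    by rewrite ler_wpM2l// divr_ge0.
  apply: lt_le_trans (bern k).
  have h : `|18 * M| < k%:R by have /andP[] := truncn_itv (normr_ge0 (18 * M)).
  by have := le_lt_trans (ler_norm _) h; lra.
have := lb k; rewrite leNgt => /negP; apply.
apply: lt_le_trans hk _; rewrite exprMn_comm; last exact: mulrC.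
apply: ler_wpM2r; first by rewrite exprn_ge0// invr_ge0.
by case: (H k).
Qed.

End UniformBoundedness.

(** * Growth of semigroups *)

Section Semigroups.
Context {R : realType} {E : completeNormedModType R[i]}.
Variables (T : R -> E -> E) (cT : c0_semigroup T).
Local Notation mu := (@lebesgue_measure R).

Let bT t : 0 <= t -> bounded_op (T t).
Proof. by case: cT => h _ _ _; exact: h. Qed.

Let T0 x : T 0 x = x.
Proof. by case: cT. Qed.

Let TD s t x : 0 <= s -> 0 <= t -> T (s + t) x = T s (T t x).
Proof. by case: cT => _ _ h _; exact: h. Qed.

Let lT t : 0 <= t -> linear (T t).
Proof. by move=> /bT[]. Qed.

Let T_near0 x e : 0 < e -> exists2 d : R, 0 < d &
  forall t, 0 <= t -> t < d -> rnorm (T t x - x) < e.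
Proof.
move=> e0; case: cT => _ _ _ /(_ x) /cvg_rdist /cvgrPdist_lt/(_ _ e0).
move=> [d /= d0 h]; exists d => // t t0 td.
have [->|t0'] := eqVneq t 0; first by rewrite T0 subrr rnorm0.
have tp : 0 < t by rewrite lt_def t0'.
have := h t; rewrite /= sub0r normrN (gtr0_norm tp) => /(_ td tp).
by rewrite sub0r normrN ger0_norm ?rnorm_ge0.
Qed.

(** Otherwise some sequence of operators [T t], with [t] tending to 0, would be
    pointwise bounded by continuity of orbits, but not uniformly. *)
Let T_bound0 : exists d M : R, [/\ 0 < d, 1 <= M &
  forall t x, 0 <= t -> t <= d -> rnorm (T t x) <= M * rnorm x].
Proof.
apply: contrapT => nb.
have step n : exists tx : R * E, [/\ 0 <= tx.1, tx.1 <= n.+1%:R^-1 &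
    n.+1%:R * rnorm tx.2 < rnorm (T tx.1 tx.2)].
  apply: contrapT => nn; apply: nb; exists n.+1%:R^-1, n.+1%:R; split.
  - by rewrite invr_gt0.
  - by rewrite ler1n.
  - move=> t x t0 tn; rewrite leNgt; apply/negP => h; apply: nn.
    by exists (t, x).
pose tx n := projT1 (cid (step n)).
have H n : [/\ 0 <= (tx n).1, (tx n).1 <= n.+1%:R^-1 &
    n.+1%:R * rnorm (tx n).2 < rnorm (T (tx n).1 (tx n).2)].
  by rewrite /tx; case: cid.
have [M hM] : exists M, forall n x, rnorm (T (tx n).1 x) <= M * rnorm x.
  apply: uniform_boundedness.
    by move=> n; apply: bT; case: (H n).
  move=> x; have [d d0 hd] := T_near0 x ltr01.
  have [N hN] : exists N, forall n, (N <= n)%N -> rnorm (T (tx n).1 x) <= 1 + rnorm x.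
    exists (Num.truncn d^-1) => n Nn; case: (H n) => h1 h2 _.
    have : rnorm (T (tx n).1 x - x) < 1.
      apply: hd => //; apply: (le_lt_trans h2).
      rewrite invf_plt ?posrE//.
      have /andP[_ h] := truncn_itv (ltW (divr_gt0 ltr01 d0)).
      rewrite -[X in X < _]div1r; apply: lt_le_trans h _.
      by rewrite ler_nat ltnS div1r.
    move=> h; rewrite -{1}(subrK x (T _ x)); apply: le_trans (ler_rnormD _ _) _.
    by rewrite lerD2r ltW.
  exists (1 + rnorm x + \sum_(i < N) rnorm (T (tx i).1 x)) => n.
  have s0 (P : pred 'I_N) : 0 <= \sum_(i < N | P i) rnorm (T (tx i).1 x).
    by apply: sumr_ge0 => i _; exact: rnorm_ge0.
  have [Nn|nN] := leqP N n.
    by apply: le_trans (hN n Nn) _; rewrite lerDl; exact: (s0 predT).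
  rewrite (bigD1 (Ordinal nN))//= addrCA lerDl addr_ge0//.
  by rewrite addr_ge0// rnorm_ge0.
pose n := Num.truncn `|M|.
case: (H n) => _ _; rewrite ltNge => /negP; apply.
apply: le_trans (hM n _) _; rewrite ler_wpM2r ?rnorm_ge0//.
have /andP[_ h] := truncn_itv (normr_ge0 M).
by apply: le_trans (ler_norm M) (ltW h).
Qed.

(** Bounded near the origin by the uniform boundedness principle, a semigroup
    grows at most exponentially. *)
Lemma semigroup_exp_bound : exists w M : R, [/\ 0 <= w, 0 <= M &
  forall t x, 0 <= t -> rnorm (T t x) <= M * expR (t * w) * rnorm x].
Proof.
have [d [M [d0 M1 hM]]] := T_bound0.
have M0 : 0 < M by apply: lt_le_trans M1.
have P n : forall t x, 0 <= t -> t <= n.+1%:R * d -> rnorm (T t x) <= M ^+ n.+1 * rnorm x.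
  elim: n => [|n IH] t x t0 tn; first by rewrite expr1; apply: hM => //; rewrite mul1r in tn.
  have [td|dt] := leP t d.
    apply: le_trans (hM t x t0 td) _; rewrite ler_wpM2r ?rnorm_ge0//.
    by rewrite exprS ler_peMr ?(ltW M0)// exprn_ege1.
  have td0 : 0 <= t - d by rewrite subr_ge0 ltW.
  rewrite -(subrKC d t) TD ?(ltW d0)//.
  apply: le_trans (hM _ _ (ltW d0) (lexx d)) _.
  rewrite exprS -mulrA ler_wpM2l ?(ltW M0)//; apply: IH => //.
  by rewrite lerBlDl; apply: le_trans tn _; rewrite -[n.+2%:R]natr1 mulrDl mul1r addrC.
exists (ln M / d), M; split.
- by rewrite divr_ge0 ?ln_ge0// ltW.
- exact: ltW.
- move=> t x t0; pose n := Num.truncn (t / d).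
  have td : 0 <= t / d by rewrite divr_ge0// ltW.
  have /andP[h1 h2] := truncn_itv td.
  apply: le_trans (P n t x t0 _) _.
    by rewrite -ler_pdivrMr// ltW.
  rewrite ler_wpM2r ?rnorm_ge0// exprS ler_wpM2l ?(ltW M0)//.
  rewrite -{1}(lnK M0) -expRM_natl ler_expR mulrA.
  by rewrite mulrAC ler_wpM2r// ln_ge0.
Qed.

Lemma semigroup_local_bound : exists M : R -> R, (forall t, 0 <= M t) /\
  forall t r v, 0 <= r -> r <= t -> rnorm (T r v) <= M t * rnorm v.
Proof.
have [w [M [w0 M0 hM]]] := semigroup_exp_bound.
exists (fun t => M * expR (Num.max 0 t * w)); split.
  by move=> t; rewrite mulr_ge0// expR_ge0.
move=> t r v r0 rt; apply: le_trans (hM r v r0) _.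
rewrite ler_wpM2r ?rnorm_ge0// ler_wpM2l// ler_expR ler_wpM2r//.
by rewrite le_max rt orbT.
Qed.

(** Frozen at negative times, so that orbits are continuous on the whole line. *)
Definition clamped (r : R) (v : E) : E := T (Num.max 0 r) v.

Lemma clampedE r v : 0 <= r -> clamped r v = T r v.
Proof. by move=> r0; rewrite /clamped max0_id. Qed.

Lemma clamped_family : sc_family clamped.
Proof.
have [M [M0 hM]] := semigroup_local_bound.
split.
- by move=> r; apply: lT; exact: max0_ge0.
- exists (fun t => M (Num.max 0 t)); split=> // t r v rt.
  by apply: hM; rewrite ?max0_ge0// ge_max max0_ge0/= le_max rt orbT.
- move=> v r; pose a := Num.max 0 r.
  pose C := M (a + 1) + 1.
  have C0 : 0 < C by rewrite ltr_wpDl.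
  apply/rcvgP/cvgrPdist_lt => e e0.
  have [d d0 hd] := T_near0 v (divr_gt0 e0 C0).
  have d1 : 0 < Num.min d 1 by rewrite lt_min d0 ltr01.
  have /cvgrPdist_lt/(_ _ d1) := @continuous_max0 R r.
  apply: filterS => s; rewrite lt_min => /andP[sd s1].
  rewrite sub0r normrN ger0_norm ?rnorm_ge0// /clamped -/a.
  set b := Num.max 0 s in sd s1 *.
  have b0 : 0 <= b by exact: max0_ge0.
  have a0 : 0 <= a by exact: max0_ge0.
  have key x y : 0 <= x -> x <= y -> x <= a + 1 -> y - x < d ->
      rnorm (T y v - T x v) < e.
    move=> x0 xy xa yx.
    have yx0 : 0 <= y - x by rewrite subr_ge0.
    rewrite -{1}(subrKC x y) TD// -linB; last exact: lT.
    apply: le_lt_trans (hM (a + 1) _ _ x0 xa) _.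
    apply: (@le_lt_trans _ _ (C * rnorm (T (y - x) v - v))).
      by rewrite ler_wpM2r ?rnorm_ge0// lerDl.
    by rewrite mulrC -ltr_pdivlMr//; exact: hd.
  have [ab|/ltW ba] := leP a b.
    apply: key => //; first by rewrite lerDl.
    by move: sd; rewrite distrC ger0_norm// subr_ge0.
  rewrite rdistC; apply: key => //; first by apply: le_trans ba _; rewrite lerDl.
  by move: sd; rewrite ger0_norm// subr_ge0.
Qed.

Lemma clamped_continuous v : continuous (clamped^~ v).
Proof. by case: clamped_family => _ _; exact. Qed.

End Semigroups.

(** * The integrated Cauchy problem *)

Section GeneratorIntegral.
Context {R : realType} {E : completeNormedModType R[i]}.
Variables (T : R -> E -> E) (cT : c0_semigroup T).
Local Notation mu := (@lebesgue_measure R).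
Local Notation S := (clamped T).

Let SS : sc_family S := clamped_family cT.

Lemma clamped_L1loc v : L1loc (fun s => S s v).
Proof. by apply: L1loc_continuous; exact: clamped_continuous. Qed.

(** Difference quotients from the left, with [h < 0], are images under
    [T (x + h)] of quotients at the origin. *)
Let diff_quotient (x : R) (w g : E) : 0 < x ->
  (h^-1)%:C *: (T h w - w) @[h --> 0^'+] --> g ->
  (h^-1)%:C *: (S (h + x) w - S x w) @[h --> (0 : R)^'] --> S x g.
Proof.
move=> x0 qg; case: cT => bT _ TD _.
have lT t : 0 <= t -> linear (T t) by move=> /bT[].
have [M [M0 hM]] := semigroup_local_bound cT.
apply/rcvgP/cvgrPdist_lt => e e0.
have C0 : 0 < M (x + 1) + 1 by rewrite ltr_wpDl.
have e1 : 0 < e / 2 / (M (x + 1) + 1) by rewrite !divr_gt0.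
have /cvg_rdist/cvgrPdist_lt/(_ _ e1)[d1 /= d10 hd1] := qg.
have e2 : 0 < e / 2 by rewrite divr_gt0.
have cg : S s g @[s --> x] --> S x g by exact: clamped_continuous.
have /cvg_rdist/cvgrPdist_lt/(_ _ e2)[d2 /= d20 hd2] := cg.
near=> h.
have hx : `|h| < x by near: h; apply: dnbhs0_lt.
have h1 : `|h| < 1 by near: h; apply: dnbhs0_lt.
have hd1' : `|h| < d1 by near: h; apply: dnbhs0_lt.
have hd2' : `|h| < d2 by near: h; apply: dnbhs0_lt.
have h0 : h != 0 by near: h; exact: nbhs_dnbhs_neq.
have hp : 0 < `|h| by rewrite normr_gt0.
have xh : 0 < h + x by have := ler_norm (- h); rewrite normrN; lra.
rewrite sub0r normrN ger0_norm ?rnorm_ge0//.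
have q1 : rnorm ((`|h|^-1)%:C *: (T `|h| w - w) - g) < e / 2 / (M (x + 1) + 1).
  have := hd1 `|h|; rewrite /= !sub0r !normrN normr_id => /(_ hd1' hp).
  by rewrite ger0_norm ?rnorm_ge0.
have q2 : rnorm (S (h + x) g - S x g) < e / 2.
  have := hd2 (h + x); rewrite /= sub0r normrN (ger0_norm (rnorm_ge0 _)).
  by apply; rewrite opprD addrCA subrr addr0 normrN.
have key y : 0 <= y -> y <= x + 1 ->
    rnorm (T y ((`|h|^-1)%:C *: (T `|h| w - w)) - T y g) < e / 2.
  move=> y0 yx; rewrite -linB; last exact: lT.
  apply: le_lt_trans (hM (x + 1) y _ y0 yx) _.
  apply: (@le_lt_trans _ _ ((M (x + 1) + 1) *
      rnorm ((`|h|^-1)%:C *: (T `|h| w - w) - g))).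
    by rewrite ler_wpM2r ?rnorm_ge0// lerDl.
  by rewrite mulrC -ltr_pdivlMr.
have [hneg|hpos|h00] := ltgtP h 0; last by rewrite h00 eqxx in h0.
  have nh : `|h| = - h by rewrite ltr0_norm.
  have -> : (h^-1)%:C *: (S (h + x) w - S x w) =
      T (h + x) ((`|h|^-1)%:C *: (T `|h| w - w)).
    rewrite !clampedE ?(ltW xh) ?(ltW x0)//.
    have -> : T x w = T (h + x) (T `|h| w).
      by rewrite -TD ?(ltW xh)// nh addrAC subrr add0r.
    rewrite -linB; last exact: lT (ltW xh).
    rewrite -linZ; last exact: lT (ltW xh).
    congr (T _ _); rewrite nh invrN rmorphN scaleNr -scalerN opprB//.
  apply: le_lt_trans (rdist_triangle _ (T (h + x) g) _) _.
  have -> : e = e / 2 + e / 2 by rewrite -splitr.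
  apply: ltrD; first by apply: key; [exact: ltW|lra].
  by move: q2; rewrite clampedE ?ltW.
have nh : `|h| = h by rewrite gtr0_norm.
have -> : (h^-1)%:C *: (S (h + x) w - S x w) =
    T x ((`|h|^-1)%:C *: (T `|h| w - w)).
  rewrite !clampedE ?(ltW xh) ?(ltW x0)// [h + x]addrC TD ?(ltW x0) ?(ltW hpos)//.
  rewrite -linB; last exact: lT (ltW x0).
  by rewrite -linZ ?nh//; exact: lT (ltW x0).
rewrite [S x g]clampedE ?ltW//.
apply: lt_trans (key x (ltW x0) _) _; first by rewrite lerDl.
by rewrite ltr_pdivrMr// ltr_pMr// ltr1n.
Unshelve. all: by end_near. Qed.

(** Fundamental theorem for the orbit of a point of the domain. *)
Lemma semigroup_increment (x g : E) t : 0 <= t ->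
  (h^-1)%:C *: (T h x - x) @[h --> 0^'+] --> g ->
  T t x - x = prim (fun s => S s g) t.
Proof.
move=> t0 xg; apply: rfun_ext => psi p.
rewrite (prim_rfun t (clamped_L1loc g) p).
have ck v : continuous (fun s => psi (S s v)).
  by move=> s; apply: rfun_cvg => //; exact: clamped_continuous.
have D y : 0 < y -> y < t ->
    is_derive y (1 : R) (fun s => psi (S s x)) (psi (S y g)).
  move=> y0 _.
  have L : h^-1 *: (psi (S (h *: 1 + y) x) - psi (S y x)) @[h --> (0 : R)^'] --> psi (S y g).
    have -> : (fun h : R => h^-1 *: (psi (S (h *: 1 + y) x) - psi (S y x))) =
        (fun h => psi ((h^-1)%:C *: (S (h + y) x - S y x))).
      apply/funext => h; case: (p) => _ pZ _; rewrite pZ -rfunB//.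
      by rewrite [h *: 1]mulr1.
    by apply: rfun_cvg => //; exact: diff_quotient.
  split; first by apply/cvg_ex; exists (psi (S y g)).
  exact: (cvg_lim (@Rhausdorff R) L).
rewrite (Rint_FTC2 t0 (ck g) (ck x) D) !clampedE//.
by case: (cT) => _ -> _ _; exact: rfunB.
Qed.

(** [Q] stands for the resolvent [(b - A)^-1] of the generator [A] of [T]: it
    commutes with [T], and the orbit of [Q v] has derivative [A (Q v)] at the
    origin. *)
Definition resolvent_data (b : R[i]) (Q : E -> E) : Prop :=
  [/\ bounded_op Q, forall t v, 0 <= t -> T t (Q v) = Q (T t v) &
      forall v, (h^-1)%:C *: (T h (Q v) - Q v) @[h --> 0^'+] --> b *: Q v - v].

Variables (b : R[i]) (Q : E -> E) (dQ : resolvent_data b Q).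

Let bQ : bounded_op Q. Proof. by case: dQ. Qed.
Let lQ : linear Q. Proof. by case: bQ. Qed.

Let SQ r v : S r (Q v) = Q (S r v).
Proof. by case: dQ => _ h _; apply: h; exact: max0_ge0. Qed.

Let bS r : bounded_op (S r). Proof. exact: sc_family_bounded SS. Qed.

(** The integral of an orbit belongs to the domain of the generator, which maps
    it to [T t v - v]. *)
Lemma orbit_primitive v t : 0 <= t ->
  prim (fun s => S s v) t = Q (b *: prim (fun s => S s v) t - T t v + v).
Proof.
move=> t0; case: dQ => _ Qc Qg.
have l1 := clamped_L1loc v.
have bO : bounded_op (fun w => b *: Q w - w).
  exact: bounded_sub (bounded_scale b bQ) bounded_id.
have := semigroup_increment t0 (Qg v).
have -> : prim (fun s => S s (b *: Q v - v)) t =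
    b *: Q (prim (fun s => S s v) t) - prim (fun s => S s v) t.
  rewrite (prim_op t bO l1); congr prim; apply/funext => s.
  rewrite linB; last by case: (bS s).
  by rewrite linZ ?SQ//; case: (bS s).
rewrite Qc// => e.
rewrite linD// linB// linZ//.
have -> : Q v = Q (T t v) - (b *: Q (prim (fun s => S s v) t) - prim (fun s => S s v) t).
  by rewrite -e opprB addrCA subrr addr0.
by rewrite addrA subrK opprB addrC subrK.
Qed.

Definition orbit_prim (r : R) (v : E) : E := prim (fun s => S s v) (Num.max 0 r).

Lemma orbit_primE r v : 0 <= r -> orbit_prim r v = prim (fun s => S s v) r.
Proof. by move=> r0; rewrite /orbit_prim max0_id. Qed.

Lemma orbit_prim_family : sc_family orbit_prim.
Proof.
have [lS [M [M0 hM]] cS] := SS.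
split.
- move=> r a u v; rewrite /orbit_prim.
  have e : prim (fun s => S s (a *: u + v)) (Num.max 0 r) =
    prim (fun s => a *: S s u + S s v) (Num.max 0 r).
    by congr prim; apply/funext => s; rewrite lS.
  rewrite e prim_add; [|exact: L1loc_op (bounded_scale a bounded_id) (clamped_L1loc u)|exact: clamped_L1loc].
  by rewrite -(prim_op _ (bounded_scale a bounded_id) (clamped_L1loc u)).
- exists (fun t => M (Num.max 0 t) * Num.max 0 t); split.
    by move=> t; rewrite mulr_ge0// max0_ge0.
  move=> t r v rt; rewrite /orbit_prim.
  have rt' : Num.max 0 r <= Num.max 0 t by rewrite ge_max max0_ge0/= le_max rt orbT.
  have := @prim_increment _ _ (fun s => S s v) 0 0 (Num.max 0 r)
    (M (Num.max 0 t) * rnorm v) (clamped_L1loc v) (lexx 0) (max0_ge0 r).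
  rewrite prim0; last exact: clamped_L1loc.
  rewrite scaler0 !subr0 => H; apply: le_trans (H _) _.
    move=> s s0 sr; rewrite subr0; apply: hM; exact: le_trans rt'.
  rewrite mulrAC -!mulrA ler_wpM2l// mulrC [rnorm v * _]mulrC ler_wpM2r ?rnorm_ge0//.
- by move=> v; exact: prim_continuous (clamped_L1loc v).
Qed.

(** By Fubini, the kernel is integrated instead of the convolution. *)
Lemma prim_conv f t : 0 <= t -> L1loc f -> prim (conv S f) t = conv orbit_prim f t.
Proof.
move=> t0 lf; have [_ [M [M0 hM]] _] := SS.
have lx : L1loc (conv S f) by apply: L1loc_max0; exact: conv_continuous.
apply: rfun_ext => psi p; case: (p) => _ _ [K K0 pK].
have ck v : continuous (fun s => psi (S s v)).
  by move=> s; apply: rfun_cvg => //; exact: clamped_continuous.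
apply: (etrans (prim_rfun t lx p)).
apply: (etrans _ (esym (conv_rfun orbit_prim_family t lf p))).
have -> : \int[mu]_(s in `[0, t]) psi (conv S f s) =
    \int[mu]_(r in `[0, t]) (\int[mu]_(s in `[0, r]) psi (S (r - s) (f s))).
  by apply: eq_Rintegral => s _; exact: conv_rfun.
have KM : 0 <= K * M t by rewrite mulr_ge0.
rewrite (fubini_kernel (a := fun r s v => psi (S (r - s) v)) (K := K * M t) KM lf).
- apply: eq_Rintegral => s; rewrite inE/= in_itv/= => /andP[s0 st].
  rewrite (Rint_shift st (ck (f s))).
  rewrite /orbit_prim max0_id ?subr_ge0//.
  exact: (esym (prim_rfun _ (clamped_L1loc (f s)) p)).
- move=> v; apply: (measurableT_comp (continuous_measurable_fun (ck v))).
  exact: measurable_funB.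
- move=> r s u v uv; apply: rfun_cvg => //; apply: bounded_cvg => //.
- move=> r s v s0 sr rt; apply: le_trans (pK _) _; rewrite -mulrA ler_wpM2l//.
  by apply: hM; apply: le_trans rt; rewrite gerBl.
Qed.

(** A mild solution [x = T * f] of [x' = A x + f] solves the equation integrated
    once, here in resolvent form: each orbit does so, and integration in time
    preserves the identity. *)
Lemma prim_conv_resolvent f t : 0 <= t -> L1loc f ->
  prim (conv S f) t = Q (b *: prim (conv S f) t - conv S f t + prim f t).
Proof.
move=> t0 lf; rewrite prim_conv//.
have fO := orbit_prim_family.
apply: rfun_ext => psi p; case: (p) => pD _ _.
have pQ : is_rfun (fun v => psi (Q v)) by exact: rfun_comp.
have pQb : is_rfun (fun v => psi (Q (b *: v))) by exact: rfun_scale pQ.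
have lS s : linear (S s) by case: (bS s).
rewrite linD// linB// pD (rfunB _ _ p).
transitivity (\int[mu]_(s in `[0, t]) psi (Q (b *: orbit_prim (t - s) (f s)))
  - \int[mu]_(s in `[0, t]) psi (Q (S (t - s) (f s)))
  + \int[mu]_(s in `[0, t]) psi (Q (f s))); last first.
  apply/esym; congr (_ - _ + _); first exact: (conv_rfun fO t lf pQb).
    exact: (conv_rfun SS t lf pQ).
  exact: (prim_rfun t lf pQ).
apply: (etrans (conv_rfun fO t lf p)).
have i1 : mu.-integrable `[0, t]
    (EFin \o (fun s => psi (Q (b *: orbit_prim (t - s) (f s))))).
  exact: (rfun_L1loc _ (lexx 0) pQb (conv_L1loc fO t lf)).
have i2 : mu.-integrable `[0, t] (EFin \o (fun s => psi (Q (S (t - s) (f s))))).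
  exact: (rfun_L1loc _ (lexx 0) pQ (conv_L1loc SS t lf)).
have i3 : mu.-integrable `[0, t] (EFin \o (fun s => psi (Q (f s)))).
  exact: (rfun_L1loc _ (lexx 0) pQ lf).
rewrite -RintegralB// -RintegralD//; last exact: rint_sub.
apply: eq_Rintegral => s; rewrite inE/= in_itv/= => /andP[s0 st].
have ts0 : 0 <= t - s by rewrite subr_ge0.
rewrite /orbit_prim max0_id// [in LHS](orbit_primitive (f s) ts0).
by rewrite linD// linB// pD (rfunB _ _ p) clampedE.
Qed.

(** Uniqueness: if [w] solves the homogeneous integrated equation then
    [T * (1 * w)], computed by Fubini and by the fundamental theorem, differs
    from itself by [1 * (1 * w)]. *)
Lemma homogeneous_eq0 (w : R -> E) : continuous w ->
  (forall t, 0 <= t -> prim w t = Q (b *: prim w t - w t)) ->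
  forall t, 0 <= t -> w t = 0.
Proof.
move=> cw hw; have lw := L1loc_continuous cw; have lW := L1loc_prim lw.
have [_ [M [M0 hM]] _] := SS.
have lS s : linear (S s) by case: (bS s).
suff W0 t : 0 <= t -> prim (prim w) t = 0.
  apply: (prim_eq0 cw) => t t0.
  have := prim_eq0 (prim_continuous lw) _ t0; rewrite max0_id//; apply=> s s0.
  rewrite -(W0 s s0); apply: eq_prim => r r0 _.
  by rewrite max0_id.
move=> t0; apply: rfun_ext => psi p; case: (p) => pD _ [K K0 pK].
rewrite rfun0//.
have ck v : continuous (fun s => psi (S s v)).
  by move=> s; apply: rfun_cvg => //; exact: clamped_continuous.
have step s : 0 <= s -> forall r, 0 <= r ->
    S r (prim w s) = prim w s + orbit_prim r (w s).
  move=> s0 r r0; case: dQ => _ _ Qg.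
  rewrite clampedE// {1}(hw s s0) -[LHS](subrK (Q (b *: prim w s - w s))).
  rewrite (semigroup_increment r0 (Qg _)) -(hw s s0) addrC; congr (_ + _).
  have e : b *: prim w s - (b *: prim w s - w s) = w s by rewrite opprB addrC subrK.
  rewrite e; exact: (esym (orbit_primE (w s) r0)).
have e1 : \int[mu]_(s in `[0, t]) psi (S (t - s) (prim w s)) =
    \int[mu]_(s in `[0, t]) psi (orbit_prim (t - s) (w s)).
  have KM : 0 <= K * M t by rewrite mulr_ge0.
  transitivity (\int[mu]_(r in `[0, t])
      (\int[mu]_(s in `[0, r]) psi (S (t - r) (w s)))).
    apply: eq_Rintegral => s _.
    exact: (prim_rfun s lw (rfun_comp p (bS (t - s)))).
  rewrite (fubini_kernel (a := fun r s v => psi (S (t - r) v)) (K := K * M t) KM lw).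
  - apply: eq_Rintegral => s; rewrite inE/= in_itv/= => /andP[s0 st].
    rewrite (Rint_reflect st (ck (w s))).
    rewrite /orbit_prim max0_id ?subr_ge0//.
    exact: (esym (prim_rfun _ (clamped_L1loc (w s)) p)).
  - move=> v; apply: (measurableT_comp (continuous_measurable_fun (ck v))).
    by apply: measurable_funB.
  - by move=> r s u v uv; apply: rfun_cvg => //; apply: bounded_cvg.
  - move=> r s v s0 sr rt; apply: le_trans (pK _) _; rewrite -mulrA ler_wpM2l//.
    by apply: hM; rewrite gerBl (le_trans s0).
have i1 : mu.-integrable `[0, t] (EFin \o (fun s => psi (prim w s))).
  exact: rfun_L1loc.
have i2 : mu.-integrable `[0, t] (EFin \o (fun s => psi (orbit_prim (t - s) (w s)))).
  exact: (rfun_L1loc _ (lexx 0) p (conv_L1loc orbit_prim_family t lw)).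
have e2 : \int[mu]_(s in `[0, t]) psi (S (t - s) (prim w s)) =
    \int[mu]_(s in `[0, t]) psi (prim w s) +
    \int[mu]_(s in `[0, t]) psi (orbit_prim (t - s) (w s)).
  rewrite -(@RintegralD _ _ R mu _ _ _ (measurable_itv _) i1 i2); apply: eq_Rintegral => s.
  rewrite inE/= in_itv/= => /andP[s0 st].
  by rewrite step ?subr_ge0.
apply: (etrans (prim_rfun t lW p)).
by apply: (@addIr _ (\int[mu]_(s in `[0, t]) psi (orbit_prim (t - s) (w s))));
  rewrite -e2 add0r.
Qed.

End GeneratorIntegral.

(** * Resolvents by rescaling *)

Section ExponentiallyStable.
Context {R : realType} {E : completeNormedModType R[i]}.
Variables (T : R -> E -> E) (cT : c0_semigroup T) (b : R[i]) (Q : E -> E).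
Hypothesis dQ : resolvent_data T b Q.

(** If [Q v = 0] then the orbit of [Q v] is constant, and its derivative [- v]
    vanishes. *)
Lemma resolvent_data_injective v : Q v = 0 -> v = 0.
Proof.
move=> Q0; case: dQ => _ _ /(_ v); rewrite Q0 scaler0 sub0r => L.
have e : (fun h : R => (h^-1)%:C *: (T h (0 : E) - 0)) @ (0 : R)^'+ --> (0 : E).
  apply: (@cvg_trans _ ((fun=> (0 : E)) @ (0 : R)^'+)); last exact: cvg_cst.
  apply: near_eq_cvg; near=> h.
  have h0 : 0 <= h by apply: ltW; near: h; exact: nbhs_right_gt.
  by case: cT => /(_ h h0)[lh _] _ _ _; rewrite lin0// subrr scaler0.
have h : - v = 0 by exact: (cvg_unique (@norm_hausdorff _ E) L e).
by rewrite -(opprK v) h oppr0.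
Unshelve. all: by end_near. Qed.

Variable (t : R).
Hypotheses (t0 : 0 <= t) (half : forall x, rnorm (T t x) <= 2^-1 * rnorm x).

Let bTt : bounded_op (T t). Proof. by case: cT => h _ _ _; exact: h. Qed.
Let lTt : linear (T t). Proof. by case: bTt. Qed.
Let bQ : bounded_op Q. Proof. by case: dQ. Qed.
Let lQ : linear Q. Proof. by case: bQ. Qed.

Let neumann y : exists2 z, z - T t z = y & rnorm z <= 2 * rnorm y.
Proof.
pose u := fix u n := if n is m.+1 then y + T t (u m) else 0.
have du n : rnorm (u n.+1 - u n) <= rnorm y * 2^-1 ^+ n.
  elim: n => [|n IH].
    by rewrite /= lin0// addr0 subr0 expr0 mulr1.
  rewrite -[u n.+2]/(y + T t (u n.+1)) -{2}[u n.+1]/(y + T t (u n)).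
  rewrite opprD addrACA subrr add0r -linB//.
  by apply: le_trans (half _) _; rewrite exprS mulrCA ler_wpM2l// invr_ge0.
have [z uz zu] : exists2 z, u n @[n --> \oo] --> z &
    forall n, rnorm (z - u n) <= rnorm y * 2^-1 ^+ n / (1 - 2^-1).
  by apply: geometric_cvg => //; rewrite ?rnorm_ge0 ?invr_ge0// invf_lt1// ltr1n.
exists z; last first.
  have := zu 0%N; rewrite /= subr0 expr0 mulr1 => h; apply: le_trans h _.
  by rewrite (_ : 1 - 2^-1 = 2^-1) ?invrK ?[2 * _]mulrC//; lra.
have c1 : u n.+1 @[n --> \oo] --> z by have := uz; rewrite -cvg_shiftS.
have c2 : y + T t (u n) @[n --> \oo] --> y + T t z.
  by apply: cvgD; [exact: cvg_cst|exact: bounded_cvg].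
have e := cvg_unique (@norm_hausdorff _ E) c1 c2.
by rewrite {1}e addrK.
Qed.

Let neumann_inj z : z - T t z = 0 -> z = 0.
Proof.
move/subr0_eq => e; apply: rnorm0_eq0; have := half z; rewrite -e.
have := rnorm_ge0 z; set r := rnorm z; lra.
Qed.

Let W v := orbit_prim T t v.

Let bW : bounded_op W.
Proof. exact: sc_family_bounded (orbit_prim_family cT). Qed.

Let Wres v : W v - b *: Q (W v) = Q (v - T t v).
Proof.
rewrite /W orbit_primE// {1}(orbit_primitive cT dQ v t0).
set w := prim _ t.
rewrite linD// linB// linZ// [Q (v - _)]linB//; vec.
Qed.

Let WQ v : W (Q v) = Q (W v).
Proof.
have l1 := clamped_L1loc cT v.
rewrite /W !orbit_primE// (prim_op t bQ l1); congr prim; apply/funext => s.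
by case: dQ => _ h _; apply: h; exact: max0_ge0.
Qed.

(** If [T t] is a strict contraction then [1 - b Q], which stands for
    [- A (b - A)^-1], is invertible: with [W] the primitive of the orbits up to
    [t], its inverse is [1 + b W (1 - T t)^-1]. *)
Lemma stable_inverse : exists2 S : E -> E, bounded_op S &
  (forall y, S y - b *: Q (S y) = y) /\
  (forall v y, v - b *: Q v = y -> v = S y).
Proof.
pose Z y := projT1 (cid2 (neumann y)).
have ZE y : Z y - T t (Z y) = y by rewrite /Z; case: cid2.
have Zb y : rnorm (Z y) <= 2 * rnorm y by rewrite /Z; case: cid2.
have inj v w : v - b *: Q v = w - b *: Q w -> v = w.
  move=> e; apply/eqP; rewrite -subr_eq0; apply/eqP; set d := v - w.
  have d0 : d - b *: Q d = 0.
    rewrite /d (linB v w lQ).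
    have -> : v - w - b *: (Q v - Q w) = (v - b *: Q v) - (w - b *: Q w) by vec.
    by rewrite e subrr.
  apply: neumann_inj; apply: resolvent_data_injective; rewrite -Wres.
  have bWl : linear W by case: bW.
  by rewrite -WQ -linZ// -linB// d0 lin0.
have ZL : linear Z.
  move=> a x y; apply/eqP; rewrite -subr_eq0; apply/eqP/neumann_inj.
  rewrite (linB _ _ lTt) lTt.
  have -> : Z (a *: x + y) - (a *: Z x + Z y) - (T t (Z (a *: x + y)) - (a *: T t (Z x) + T t (Z y)))
    = (Z (a *: x + y) - T t (Z (a *: x + y))) - (a *: (Z x - T t (Z x)) + (Z y - T t (Z y))).
    vec.
  by rewrite !ZE subrr.
have bZ : bounded_op Z by apply/bounded_opP; split=> //; exists 2.
exists (fun y => y + b *: W (Z y)).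
  exact: bounded_add bounded_id (bounded_scale b (bounded_comp bW bZ)).
have sol y : (y + b *: W (Z y)) - b *: Q (y + b *: W (Z y)) = y.
  rewrite (linD _ _ lQ) (linZ _ _ lQ).
  have -> : y + b *: W (Z y) - b *: (Q y + b *: Q (W (Z y))) =
      y - b *: Q y + b *: (W (Z y) - b *: Q (W (Z y))) by vec.
  by rewrite Wres ZE subrK.
split=> // v y e; apply: inj; rewrite e sol//.
Qed.

End ExponentiallyStable.

Section Rescaling.
Context {R : realType}.

Local Notation nC z := (complex.Re `|z|).
Local Notation C := (R[i] : numFieldType).

Lemma normC_le (z : R[i]) : nC z <= `|complex.Re z| + `|complex.Im z|.
Proof.
rewrite normc_def /=; case: z => x y /=.
rewrite -(ger0_norm (addr_ge0 (normr_ge0 x) (normr_ge0 y))) -sqrtr_sqr ler_wsqrtr//.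
by rewrite sqrrD !real_normK ?num_real// addrAC lerDl mulrn_wge0//.
Qed.

Lemma cvgC {T : Type} (F : set_system T) {FF : Filter F} (f : T -> C) (l : C) :
  complex.Re (f x) @[x --> F] --> complex.Re l ->
  complex.Im (f x) @[x --> F] --> complex.Im l -> f x @[x --> F] --> l.
Proof.
move=> fr fi; apply/(@rcvgP R R[i]^o _ _ FF f l).
have c0 : `|complex.Re (f x) - complex.Re l| + `|complex.Im (f x) - complex.Im l|
    @[x --> F] --> (0 : R).
  rewrite -[X in _ --> X]addr0; apply: cvgD; apply/cvgrPdist_lt => e e0.
    have /cvgrPdist_lt/(_ _ e0) := fr; apply: filterS => x.
    by rewrite sub0r normrN normr_id distrC.
  have /cvgrPdist_lt/(_ _ e0) := fi; apply: filterS => x.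
  by rewrite sub0r normrN normr_id distrC.
apply: (squeeze_cvgr (f := cst 0) _ (cvg_cst _) c0).
apply: nearW => x; rewrite rnorm_ge0/=.
apply: le_trans (normC_le _) _.
by case: (f x) => a b; case: l {fr fi c0} => c d.
Qed.

(** The complex exponential [t |-> exp (- z t)] of a real variable. *)
Definition cexp (z : R[i]) (t : R) : C :=
  Complex (expR (- complex.Re z * t) * cos (complex.Im z * t))
          (- (expR (- complex.Re z * t) * sin (complex.Im z * t))).

Lemma cexp0 z : cexp z 0 = 1.
Proof. by rewrite /cexp !mulr0 expR0 cos0 sin0 !mul1r oppr0. Qed.

Lemma cexpD z s t : cexp z (s + t) = cexp z s * cexp z t.
Proof.
rewrite /cexp !mulrDr expRD cosD sinD; apply/eqP; rewrite eq_complex /=.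
by apply/andP; split; apply/eqP; ring.
Qed.

Lemma normC_cexp z t : nC (cexp z t) = expR (- complex.Re z * t).
Proof.
rewrite normc_def /= sqrrN !exprMn -mulrDr cos2Dsin2 mulr1 sqrtr_sqr.
by rewrite ger0_norm ?expR_ge0.
Qed.

Let dRe z : is_derive (0 : R) (1 : R) (fun t => complex.Re (cexp z t)) (- complex.Re z).
Proof.
rewrite /cexp /=.
apply: is_derive_eq.
rewrite !mulr0 expR0 cos0 sin0 /GRing.scale /=.
ring.
Qed.

Let dIm z : is_derive (0 : R) (1 : R) (fun t => complex.Im (cexp z t)) (- complex.Im z).
Proof.
rewrite /cexp /=.
apply: is_derive_eq.
rewrite !mulr0 expR0 cos0 sin0 /GRing.scale /=.
ring.
Qed.

Let quot (f : R -> R) d : is_derive (0 : R) (1 : R) f d ->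
  h^-1 * (f h - f 0) @[h --> (0 : R)^'+] --> d.
Proof.
case=> D <-; apply/cvgrPdist_lt => e e0.
have h : h^-1 *: (f (h *: 1 + 0) - f 0) @[h --> (0 : R)^'] --> 'D_1 f 0 by exact: D.
have /cvgrPdist_lt/(_ _ e0)[r /= r0 hr] := h; exists r => // t tr tp.
by have := hr t tr (negbT (gt_eqF tp)); rewrite [t *: 1]mulr1 addr0.
Qed.

Lemma cexp_quotient (z : C) : (h^-1)%:C * (cexp z h - 1) @[h --> (0 : R)^'+] --> - z.
Proof.
have qr := quot (dRe z); have qi := quot (dIm z).
apply: cvgC.
- rewrite (_ : complex.Re (- z) = - complex.Re z); last by case: z {qr qi}.
  move: qr; rewrite /= !mulr0 expR0 cos0 mulr1; apply: cvg_trans.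
  by apply: near_eq_cvg; apply: nearW => h /=; rewrite !mul0r subr0.
- rewrite (_ : complex.Im (- z) = - complex.Im z); last by case: z {qr qi}.
  move: qi; rewrite /= !mulr0 sin0 mulr0 oppr0; apply: cvg_trans.
  by apply: near_eq_cvg; apply: nearW => h /=; rewrite ?oppr0 !mul0r !addr0.
Qed.

Lemma cexp_cvg z : cexp z h @[h --> (0 : R)^'+] --> (1 : C).
Proof.
have c1 : cexp z h - 1 @[h --> (0 : R)^'+] --> (0 : C).
  have c2 : (h%:C : C) @[h --> (0 : R)^'+] --> (0 : C).
    apply: cvgC => /=; last exact: cvg_cst.
    by apply: cvg_at_right_filter; exact: cvg_id.
  have c3 : h%:C * ((h^-1)%:C * (cexp z h - 1)) @[h --> (0 : R)^'+] --> (0 : C) * (- z).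
    by apply: cvgM; [exact: c2|exact: cexp_quotient].
  move: c3; rewrite mul0r; apply: cvg_trans; apply: near_eq_cvg; near=> h.
  have h0 : h != 0 by rewrite gt_eqF//; near: h; exact: nbhs_right_gt.
  by rewrite /= mulrA -rmorphM divff// rmorph1 mul1r.
have c4 : cexp z h - 1 + 1 @[h --> (0 : R)^'+] --> (0 : C) + 1.
  by apply: cvgD; [exact: c1|exact: cvg_cst].
move: c4; rewrite add0r; apply: cvg_trans; apply: near_eq_cvg; apply: nearW => h.
by rewrite /= subrK.
Unshelve. all: by end_near. Qed.

Context {E : completeNormedModType R[i]}.

Definition rescale (T : R -> E -> E) (z : R[i]) (t : R) (x : E) : E := cexp z t *: T t x.

Lemma rescale_semigroup T z : c0_semigroup T -> c0_semigroup (rescale T z).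
Proof.
move=> [bT T0 TD Tc]; split.
- by move=> t t0; apply: bounded_scale; exact: bT.
- by move=> x; rewrite /rescale cexp0 scale1r.
- move=> s t x s0 t0; rewrite /rescale cexpD TD// linZ ?scalerA//.
  by case: (bT s s0).
- move=> x; rewrite -[X in _ --> X]scale1r.
  by apply: cvgZ; [exact: cexp_cvg|exact: Tc].
Qed.

(** Multiplying by [exp (- z t)] subtracts [z] from the generator. *)
Lemma rescale_resolvent T z b Q : c0_semigroup T -> resolvent_data T b Q ->
  resolvent_data (rescale T z) (b - z) Q.
Proof.
move=> cT [bQ Qc Qg]; split=> //.
  by move=> t v t0; rewrite /rescale Qc// linZ//; case: bQ.
move=> v.
have c1 : cexp z h *: ((h^-1)%:C *: (T h (Q v) - Q v)) @[h --> (0 : R)^'+] -->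
    1 *: (b *: Q v - v).
  by apply: cvgZ; [exact: cexp_cvg|exact: Qg].
have c2 : ((h^-1)%:C * (cexp z h - 1)) *: Q v @[h --> (0 : R)^'+] --> (- z) *: Q v.
  by apply: cvgZ; [exact: cexp_quotient|exact: cvg_cst].
have c3 : cexp z h *: ((h^-1)%:C *: (T h (Q v) - Q v)) +
    ((h^-1)%:C * (cexp z h - 1)) *: Q v @[h --> (0 : R)^'+] -->
    1 *: (b *: Q v - v) + (- z) *: Q v.
  by apply: cvgD; [exact: c1|exact: c2].
move: c3; rewrite scale1r (_ : b *: Q v - v + - z *: Q v = (b - z) *: Q v - v); last first.
  by rewrite scalerBl scaleNr addrAC.
apply: cvg_trans; apply: near_eq_cvg; apply: nearW => h.
rewrite /rescale scalerA mulrC -!scalerA -scalerDr; congr (_ *: _).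
by rewrite scalerBr scalerBl scale1r addrA subrK.
Qed.

End Rescaling.

(** * Generators *)

Section DenseExtension.
Context {R : realType}.

Lemma dense_approx {V : Type} {E : normedModType R[i]} (d : V -> E) :
  dense (range d) -> forall z (e : R), 0 < e -> exists v, rnorm (d v - z) < e.
Proof.
move=> dd z e e0; have e0' : 0 < e%:C by rewrite ltcR.
have nz : nbhs z (ball z e%:C) by exact: nbhsx_ballx.
have ne : (ball z e%:C)^° !=set0 by exists z.
have [y [/interior_subset h [v _ vE]]] := dd _ ne (@open_interior _ _).
exists v; move: h; rewrite -vE; rewrite -ball_normE /ball_ /= normC_rnorm ltcR.
by rewrite rdistC.
Qed.

Lemma dense_seq {V : Type} {E : normedModType R[i]} (d : V -> E) :
  dense (range d) -> forall z : E, exists u : nat -> V, d (u n) @[n --> \oo] --> z.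
Proof.
move=> dd z; have H n : exists v, rnorm (d v - z) < n.+1%:R^-1.
  by apply: dense_approx => //; rewrite invr_gt0.
exists (fun n => projT1 (cid (H n))).
apply: (@rcvg_dominated _ _ _ _ _ _ (fun n => n.+1%:R^-1)); last exact: cvg_harmonic.
by apply: nearW => n; case: cid => v /= /ltW.
Qed.

Lemma dense_eq {V : Type} {E F : normedModType R[i]} (d : V -> E) (f g : E -> F) :
  dense (range d) -> bounded_op f -> bounded_op g -> (forall v, f (d v) = g (d v)) ->
  forall z, f z = g z.
Proof.
move=> dd bf bg fg z; have [u uz] := dense_seq dd z.
have c1 : f (d (u n)) @[n --> \oo] --> f z by exact: bounded_cvg.
have c2 : g (d (u n)) @[n --> \oo] --> g z by exact: bounded_cvg.
have e : (fun n => f (d (u n))) = (fun n => g (d (u n))) by apply/funext => n.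
by rewrite e in c1; exact: (cvg_unique (@norm_hausdorff _ F) c1 c2).
Qed.

Lemma bounded_extension {V : lmodType R[i]} {E : normedModType R[i]}
    {F : completeNormedModType R[i]} (d : V -> E) (f : V -> F) (K : R) :
  linear d -> linear f -> dense (range d) -> 0 <= K ->
  (forall v, rnorm (f v) <= K * rnorm (d v)) ->
  exists2 g : E -> F, bounded_op g & forall v, g (d v) = f v.
Proof.
move=> ld lf dd K0 fd.
have cauchy (u : nat -> V) (z : E) : d (u n) @[n --> \oo] --> z ->
    exists y : F, f (u n) @[n --> \oo] --> y.
  move=> uz; apply: rcauchy_cvg => e e0.
  have K1 : 0 < K + 1 by rewrite ltr_wpDl.
  have e1 : 0 < e / 2 / (K + 1) by rewrite !divr_gt0.
  have /cvg_rdist/cvgrPdist_lt/(_ _ e1)[N _ hN] := uz.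
  exists N => m n Nm Nn; rewrite -linB//.
  apply: le_lt_trans (fd _) _; rewrite linB//.
  have h p : (N <= p)%N -> rnorm (d (u p) - z) < e / 2 / (K + 1).
    by move=> Np; have := hN p Np; rewrite /= sub0r normrN ger0_norm ?rnorm_ge0.
  have : rnorm (d (u m) - d (u n)) < e / (K + 1).
    apply: le_lt_trans (rdist_triangle _ z _) _.
    have -> : e / (K + 1) = e / 2 / (K + 1) + e / 2 / (K + 1).
      by rewrite -mulrDl -splitr.
    by apply: ltrD; [exact: h|rewrite rdistC; exact: h].
  rewrite ltr_pdivlMr// => h'; apply: le_lt_trans h'.
  by rewrite mulrC ler_wpM2l ?rnorm_ge0// lerDl.
have ex (z : E) : exists y : F, exists2 u : nat -> V, d (u n) @[n --> \oo] --> z &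
    f (u n) @[n --> \oo] --> y.
  have [u uz] := dense_seq dd z; have [y uy] := cauchy u z uz.
  by exists y, u.
pose g z := projT1 (cid (ex z)).
have gE z : exists2 u : nat -> V, d (u n) @[n --> \oo] --> z &
    f (u n) @[n --> \oo] --> g z by rewrite /g; case: cid.
have gb (u : nat -> V) (z : E) (y : F) : d (u n) @[n --> \oo] --> z ->
    f (u n) @[n --> \oo] --> y -> rnorm y <= K * rnorm z.
  move=> uz uy.
  have c1 : rnorm (f (u n)) @[n --> \oo] --> rnorm y by exact: rcvg_norm.
  have c2 : K * rnorm (d (u n)) @[n --> \oo] --> K * rnorm z.
    by apply: cvgMr; exact: rcvg_norm.
  by apply: (ler_cvg_to c1 c2); apply: nearW => n; exact: fd.
have gu (u : nat -> V) (z : E) (y : F) : d (u n) @[n --> \oo] --> z ->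
    f (u n) @[n --> \oo] --> y -> g z = y.
  move=> uz uy; have [v vz vy] := gE z.
  have c1 : d (u n - v n) @[n --> \oo] --> z - z.
    have -> : (fun n => d (u n - v n)) = (fun n => d (u n) - d (v n)).
      by apply/funext => n; rewrite linB.
    by apply: cvgB; [exact: uz|exact: vz].
  have c2 : f (u n - v n) @[n --> \oo] --> y - g z.
    have -> : (fun n => f (u n - v n)) = (fun n => f (u n) - f (v n)).
      by apply/funext => n; rewrite linB.
    by apply: cvgB; [exact: uy|exact: vy].
  have := gb _ _ _ c1 c2; rewrite subrr rnorm0 mulr0 => h.
  apply/esym/eqP; rewrite -subr_eq0; apply/eqP/rnorm0_eq0/eqP.
  by rewrite eq_le h rnorm_ge0.
exists g.
  apply/bounded_opP; split; last first.
    by exists K => // z; have [u uz uy] := gE z; exact: gb uz uy.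
  move=> a x y; have [u ux uf] := gE x; have [v vy vf] := gE y.
  apply: (gu (fun n => a *: u n + v n)).
    have -> : (fun n => d (a *: u n + v n)) = (fun n => a *: d (u n) + d (v n)).
      by apply/funext => n; rewrite ld.
    by apply: cvgD; [apply: cvgZr; exact: ux|exact: vy].
  have -> : (fun n => f (a *: u n + v n)) = (fun n => a *: f (u n) + f (v n)).
    by apply/funext => n; rewrite lf.
  by apply: cvgD; [apply: cvgZr; exact: uf|exact: vf].
by move=> v; apply: (gu (fun=> v)); exact: cvg_cst.
Qed.

End DenseExtension.

Section Generators.
Context {R : realType} {X : completeNormedModType R[i]}.
Implicit Types (A : operator X X) (T : R -> X -> X).

Lemma generates_cvg A T x : generates A T -> dom A x ->
  (h^-1)%:C *: (T h x - x) @[h --> 0^'+] --> A x.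
Proof. by move=> [_ [dA AE]] Ax; rewrite (AE x Ax); move: Ax; rewrite dA. Qed.

Lemma generates_dom A T x y : generates A T ->
  (h^-1)%:C *: (T h x - x) @[h --> 0^'+] --> y -> dom A x /\ A x = y.
Proof.
move=> [cT [dA AE]] c.
have Ax : dom A x by rewrite dA; apply/cvg_ex; exists y.
by split=> //; rewrite (AE x Ax); exact: (cvg_lim (@norm_hausdorff _ X) c).
Qed.

Lemma resolventP A b x : resolvent_set A b ->
  dom A (resolvent A b x) /\ b *: resolvent A b x - A (resolvent A b x) = x.
Proof.
move=> [/(_ x)[z [hz _]] _].
exact: (@xgetPex _ 0 [set z | dom A z /\ b *: z - A z = x] (ex_intro _ z hz)).
Qed.

Lemma resolventK A b z : resolvent_set A b -> dom A z -> resolvent A b (b *: z - A z) = z.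
Proof.
move=> rb Az; have [h1 h2] := resolventP (b *: z - A z) rb.
case: rb => /(_ (b *: z - A z))[w [_ hu]] _.
by rewrite -(hu _ (conj h1 h2)); apply: hu.
Qed.

Lemma generates_resolvent_data A T b : generates A T -> resolvent_set A b ->
  resolvent_data T b (resolvent A b).
Proof.
move=> gA rb; case: (gA) => cT _; case: (cT) => bT _ TD _.
split; first by case: rb.
- move=> t v t0; have [h1 h2] := resolventP v rb.
  set r := resolvent A b v in h1 h2 *.
  have bTt := bT t t0; have lTt : linear (T t) by case: bTt.
  have c : (h^-1)%:C *: (T h (T t r) - T t r) @[h --> 0^'+] --> T t (A r).
    have c1 : T t ((h^-1)%:C *: (T h r - r)) @[h --> 0^'+] --> T t (A r).
      by apply: bounded_cvg => //; exact: generates_cvg gA h1.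
    apply: cvg_trans c1; apply: near_eq_cvg; near=> h.
    have h0 : 0 <= h by apply: ltW; near: h; exact: nbhs_right_gt.
    by rewrite linZ// linB// -(TD t h)// -(TD h t)// [h + t]addrC.
  have [d1 d2] := generates_dom gA c.
  rewrite -[LHS](resolventK rb d1) d2; congr resolvent.
  by rewrite -linZ// -linB// h2.
- move=> v; have [h1 h2] := resolventP v rb.
  have -> : b *: resolvent A b v - v = A (resolvent A b v).
    by rewrite -{2}h2 opprB addrCA subrr addr0.
  exact: generates_cvg.
Unshelve. all: by end_near. Qed.

Lemma semigroup_generates A : (exists T, generates A T) -> generates A (semigroup A).
Proof. by move=> h; exact: (@xgetPex _ _ [set T | generates A T] h). Qed.

Lemma C_omega_nonempty A : (exists T, generates A T) -> exists z, C_omega A z.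
Proof.
move=> /semigroup_generates[cT _].
have [w [M [w0 M0 hM]]] := semigroup_exp_bound cT.
exists (w + 1)%:C; rewrite /C_omega /half_plane /=.
apply: (@le_lt_trans _ _ w%:E); last by rewrite lte_fin ltrDl.
apply: ereal_inf_lbound; exists w => //; exists M => t x t0.
have e0 : 0 < expR (t * w) by exact: expR_gt0.
rewrite expRN mulrC ler_pdivrMr// mulrAC; exact: hM (ltW t0).
Qed.

(** On the half-plane the rescaled semigroup decays, so that some power of it is
    a strict contraction. *)
Lemma C_omega_contraction A z : C_omega A z -> exists2 t : R, 0 <= t &
  forall x, rnorm (rescale (semigroup A) z t x) <= 2^-1 * rnorm x.
Proof.
move=> /ereal_inf_lt[_ [w [M hM] <-]]; rewrite lte_fin => wz.
set a := complex.Re z in wz.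
have e0 : 0 < a - w by rewrite subr_gt0.
pose t := (2 * `|M| + 1) / (a - w).
have M0 : 0 <= `|M| by [].
have t0 : 0 < t by rewrite divr_gt0// ltr_wpDl// mulr_ge0.
exists t; first exact: ltW.
move=> x; rewrite /rescale rnormZ normC_cexp -/a.
have h := hM t x t0.
have k : expR (- a * t) = expR (- ((a - w) * t)) * expR (- (t * w)).
  by rewrite -expRD; congr expR; ring.
rewrite k -mulrA; have et : (a - w) * t = 2 * `|M| + 1.
  by rewrite /t mulrC divfK// gt_eqF.
have := ler_wpM2l (expR_ge0 (- ((a - w) * t))) h.
move=> h2; apply: le_trans h2 _.
rewrite mulrA ler_wpM2r ?rnorm_ge0// et expRN.
have g := expR_ge1Dx (2 * `|M| + 1).
have p : 0 < 1 + (2 * `|M| + 1) by rewrite ltr_wpDr// addr_ge0// mulr_ge0.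
have p' : 0 < expR (2 * `|M| + 1) by exact: expR_gt0.
rewrite mulrC ler_pdivrMr//; have := ler_norm M; lra.
Qed.

(** The resolvent at [z] is [Q (1 + (z - b) Q)^-1], where [Q] is the resolvent at
    [b]; the inverse exists because [b - z] and [Q] are resolvent data of a
    rescaled semigroup that decays. *)
Lemma resolvent_shift A b z : (exists T, generates A T) -> resolvent_set A b ->
  C_omega A z -> exists2 S : X -> X, bounded_op S &
    (forall y, S y + (z - b) *: resolvent A b (S y) = y) /\
    (forall v y, v + (z - b) *: resolvent A b v = y -> v = S y).
Proof.
move=> gA rb zA; have gs := semigroup_generates gA; case: (gs) => cT _.
have [t t0 ht] := C_omega_contraction zA.
have rd := rescale_resolvent z cT (generates_resolvent_data gs rb).
have [S bS [h1 h2]] := stable_inverse (rescale_semigroup z cT) rd t0 ht.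
have e v : v + (z - b) *: resolvent A b v = v - (b - z) *: resolvent A b v.
  by rewrite -scaleNr opprB.
by exists S => //; split=> [y|v y]; rewrite e; [exact: h1|exact: h2].
Qed.

(** Averages of the orbit of [x] over short times lie in the domain and are close
    to [x]. *)
Lemma resolvent_range_dense A b : (exists T, generates A T) -> resolvent_set A b ->
  dense (range (resolvent A b)).
Proof.
move=> gA rb O [x Ox] oO; have gs := semigroup_generates gA; case: (gs) => cT _.
set T := semigroup A in gs cT.
have rd := generates_resolvent_data gs rb.
have /nbhs_ballP[e e0 he] : nbhs x O by exact: open_nbhs_nbhs.
have [re eE] := re_gt0 e0.
have r2 : 0 < complex.Re e / 2 by rewrite divr_gt0.
have cx : clamped T s x @[s --> (0 : R)] --> clamped T 0 x by exact: clamped_continuous.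
have /cvg_rdist/cvgrPdist_lt/(_ _ r2)[d /= d0 hd] := cx.
pose h := d / 2; have h0 : 0 < h by rewrite divr_gt0.
have lx := clamped_L1loc cT x.
have Tx0 : clamped T 0 x = x by rewrite clampedE//; case: cT.
have H : rnorm (prim (fun s => clamped T s x) h - prim (fun s => clamped T s x) 0
    - (h - 0)%:C *: x) <= complex.Re e / 2 * (h - 0).
  apply: prim_increment => //; first exact: ltW.
  move=> s s0 sh; have := hd s; rewrite /= sub0r normrN ger0_norm//.
  rewrite sub0r normrN (ger0_norm (rnorm_ge0 _)) Tx0 => hs; apply/ltW/hs.
  by apply: le_lt_trans sh _; rewrite ltr_pdivrMr// ltr_pMr// ltr1n.
pose y := (h^-1)%:C *: prim (fun s => clamped T s x) h.
exists y; split.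
  apply: he; rewrite -ball_normE /ball_ /= eE normC_rnorm ltcR rdistC.
  move: H; rewrite prim0// !subr0 => H.
  have -> : y - x = (h^-1)%:C *: (prim (fun s => clamped T s x) h - h%:C *: x).
    by rewrite scalerBr scalerA -rmorphM mulVf ?gt_eqF// scale1r.
  rewrite rnormZr gtr0_norm ?invr_gt0//.
  apply: (@le_lt_trans _ _ (h^-1 * (complex.Re e / 2 * h))).
    by rewrite ler_wpM2l// invr_ge0 ltW.
  by rewrite mulrC mulfK ?gt_eqF// ltr_pdivrMr// ltr_pMr// ltr1n.
have lQ : linear (resolvent A b) by case: rd => -[].
exists ((h^-1)%:C *: (b *: prim (fun s => clamped T s x) h - T h x + x)) => //.
by rewrite linZ// -(orbit_primitive cT rd x (ltW h0)).
Qed.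

End Generators.

(** * The extrapolation space *)

Section Extrapolation.
Context {R : realType} {X Xm1 : completeNormedModType R[i]}.
Variables (j : X -> Xm1) (A : operator X X).

(** The extrapolation space seen through one resolvent point [eb]: [eR] extends
    the resolvent and [eL] is its inverse, the extension of [eb - A]. *)
Record extrapolation : Type := Extrapolation {
  eb : R[i];
  eR : Xm1 -> X;
  eL : X -> Xm1;
  eb_resolvent : resolvent_set A eb;
  eR_bounded : bounded_op eR;
  eL_bounded : bounded_op eL;
  eRL : forall x, eR (eL x) = x;
  eLR : forall z, eL (eR z) = z;
  eRj : forall x, eR (j x) = resolvent A eb x;
  j_bounded : bounded_op j;
  j_injective : injective j
}.

Hypothesis gA : exists T, generates A T.

(** The norms of [j x] and of the resolvent at [x] are equivalent, so the
    resolvent extends by density to [Xm1]; for the same reason [j] factors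
    through the resolvent, whose range is dense. *)
Lemma extrapolation_exists : extrapolation_space j A -> exists e : extrapolation, True.
Proof.
move=> [lj dj [b [m [M [rb m0 M0 mM]]]]].
have [mr mE] := re_gt0 m0; have [Mr ME] := re_gt0 M0.
set mu := complex.Re m in mr mE; set Mu := complex.Re M in Mr ME.
have bR : bounded_op (resolvent A b) by case: rb.
have lR : linear (resolvent A b) by case: bR.
have lo x : mu * rnorm (resolvent A b x) <= rnorm (j x).
  by have [h _] := mM x; move: h; rewrite mE !normC_rnorm -rmorphM lecR.
have hi x : rnorm (j x) <= Mu * rnorm (resolvent A b x).
  by have [_ h] := mM x; move: h; rewrite ME !normC_rnorm -rmorphM lecR.
have Rinj x : resolvent A b x = 0 -> x = 0.
  have [h1 h2] := resolventP x rb; move=> e; rewrite -h2 e scaler0 sub0r.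
  have := generates_cvg (semigroup_generates gA) h1; rewrite e => c.
  have [cT _] := semigroup_generates gA.
  have rd := generates_resolvent_data (semigroup_generates gA) rb.
  by have := resolvent_data_injective cT rd e; rewrite -h2 e scaler0 sub0r.
have jinj : injective j.
  move=> x y e; apply/eqP; rewrite -subr_eq0; apply/eqP/Rinj/rnorm0_eq0/eqP.
  rewrite eq_le rnorm_ge0 andbT -(ler_pM2l mr) mulr0.
  by apply: le_trans (lo _) _; rewrite linB// e subrr rnorm0.
have [eR' bE eRj'] : exists2 g : Xm1 -> X, bounded_op g & forall v, g (j v) = resolvent A b v.
  apply: (bounded_extension (K := mu^-1)) => //; first by rewrite invr_ge0 ltW.
  by move=> v; rewrite mulrC ler_pdivlMr// mulrC.
have [eL' bL eLR'] : exists2 g : X -> Xm1, bounded_op g & forall v, g (resolvent A b v) = j v.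
  apply: (bounded_extension (K := Mu)) => //; last exact: ltW.
  exact: resolvent_range_dense.
have RL x : eR' (eL' x) = x.
  apply: (dense_eq (resolvent_range_dense gA rb) (bounded_comp bE bL) bounded_id).
  by move=> v; rewrite eLR' eRj'.
have LR z : eL' (eR' z) = z.
  apply: (dense_eq dj (bounded_comp bL bE) bounded_id).
  by move=> v; rewrite eRj' eLR'.
have bj : bounded_op j.
  apply/bounded_opP; split=> //; case/bounded_opP: bR => _ [K K0 hK].
  exists (Mu * K); first by rewrite mulr_ge0// ltW.
  by move=> x; apply: le_trans (hi x) _; rewrite -mulrA ler_wpM2l// ltW.
by exists (Extrapolation rb bE bL RL LR eRj' bj jinj).
Qed.

Variables (dj : dense (range j)) (e : extrapolation).
Local Notation b := (eb e).
Local Notation T := (semigroup A).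
Local Notation S := (ext_semigroup j A).

Let gT : generates A T := semigroup_generates gA.
Let cT : c0_semigroup T. Proof. by case: gT. Qed.
Let rd : resolvent_data T b (resolvent A b) :=
  generates_resolvent_data gT (eb_resolvent e).
Let lL : linear (eL e). Proof. by case: (eL_bounded e). Qed.
Let lR : linear (eR e). Proof. by case: (eR_bounded e). Qed.
Let lj : linear j. Proof. by case: (j_bounded e). Qed.

Let eLres x : eL e (resolvent A b x) = j x.
Proof. by rewrite -(eRj e) eLR. Qed.

(** The extended semigroup is similar to the given one, through [eR]. *)
Lemma ext_semigroupP : c0_semigroup S /\
  forall t x, 0 <= t -> S t (j x) = j (T t x).
Proof.
apply: (@xgetPex _ _ [set S0 | c0_semigroup S0 /\
  forall t x, 0 <= t -> S0 t (j x) = j (T t x)]).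
exists (fun t z => eL e (T t (eR e z))); case: (cT) => bT T0 TD Tc; split.
  split.
  - move=> t t0; apply: bounded_comp (eL_bounded e) _.
    exact: bounded_comp (bT t t0) (eR_bounded e).
  - by move=> z; rewrite T0 eLR.
  - by move=> s t z s0 t0; rewrite TD// eRL.
  - move=> z; rewrite -{2}(eLR e z); apply: (bounded_cvg (eL_bounded e)); exact: Tc.
move=> t x t0; case: (rd) => _ h _.
by rewrite (eRj e) h// eLres.
Qed.

Let ext_cvg x : (h^-1)%:C *: (S h (j x) - j x) @[h --> 0^'+] --> b *: j x - eL e x.
Proof.
have [cS Sj] := ext_semigroupP; case: (rd) => bRs Rc Rg.
have c : eL e ((h^-1)%:C *: (T h (resolvent A b x) - resolvent A b x)) @[h --> 0^'+]
    --> eL e (b *: resolvent A b x - x).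
  apply: (bounded_cvg (eL_bounded e)); exact: Rg.
move: c; rewrite (linB _ _ lL) (linZ _ _ lL) eLres; apply: cvg_trans.
apply: near_eq_cvg; near=> h.
have h0 : 0 <= h by apply: ltW; near: h; exact: nbhs_right_gt.
by rewrite (linZ _ _ lL) (linB _ _ lL) Rc// !eLres Sj.
Unshelve. all: by end_near. Qed.

Lemma ext_opE x : ext_op j A x = b *: j x - eL e x.
Proof.
rewrite /ext_op /generator /=.
exact: (cvg_lim (@norm_hausdorff _ Xm1) (@ext_cvg x)).
Qed.

Lemma ext_op_bounded : bounded_op (ext_op j A).
Proof.
rewrite (_ : ext_op j A = fun x => b *: j x - eL e x); last exact/funext/ext_opE.
exact: bounded_sub (bounded_scale _ (j_bounded e)) (eL_bounded e).
Qed.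

Lemma ext_op_dom x : dom A x -> ext_op j A x = j (A x).
Proof.
move=> Ax; rewrite ext_opE.
have {2}-> : x = resolvent A b (b *: x - A x) by rewrite (resolventK (eb_resolvent e)).
by rewrite eLres (linB _ _ lj) (linZ _ _ lj) opprB addrCA subrr addr0.
Qed.

Lemma ext_resolvent_data : resolvent_data S b (fun z => j (eR e z)).
Proof.
have [cS Sj] := ext_semigroupP; case: (rd) => bRs Rc Rg.
have bjR : bounded_op (fun z => j (eR e z)) by exact: bounded_comp (j_bounded e) (eR_bounded e).
have SR t z : 0 <= t -> T t (eR e z) = eR e (S t z).
  move=> t0; case: (cT) => bT _ _ _; case: cS => bS _ _ _.
  apply: (dense_eq dj (bounded_comp (bT t t0) (eR_bounded e))
    (bounded_comp (eR_bounded e) (bS t t0))).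
  by move=> v; rewrite Sj// !(eRj e) Rc.
split=> //.
  by move=> t z t0; rewrite Sj// SR.
by move=> z; have := @ext_cvg (eR e z); rewrite (eLR e z).
Qed.

(** In terms of [v = eR y], the resolvent equation at [z] in [Xm1] becomes
    [x + (z - b) (b - A)^-1 x = v] in [X]. *)
Lemma ext_resolventP z : C_omega A z ->
  [/\ bounded_op (ext_resolvent j A z),
      forall y, z *: j (ext_resolvent j A z y) - ext_op j A (ext_resolvent j A z y) = y &
      forall x y, z *: j x - ext_op j A x = y -> x = ext_resolvent j A z y].
Proof.
move=> zA; have [W bW [W1 W2]] := resolvent_shift gA (eb_resolvent e) zA.
have eqE x y : (z *: j x - ext_op j A x = y) <->
    x + (z - b) *: resolvent A b x = eR e y.
  have -> : z *: j x - ext_op j A x = (z - b) *: j x + eL e x.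
    by rewrite ext_opE scalerBl; vec.
  split=> [<-|h].
    by rewrite lR (eRj e) eRL addrC.
  rewrite -(eLR e y) -h (linD _ _ lL) (linZ _ _ lL) eLres addrC//.
have EE y : ext_resolvent j A z y = W (eR e y).
  apply: (W2); apply/eqE.
  apply: (@xgetPex _ 0 [set x | z *: j x - ext_op j A x = y]).
  by exists (W (eR e y)); apply/eqE; exact: W1.
split.
- rewrite (_ : ext_resolvent j A z = fun y => W (eR e y)); last exact/funext.
  exact: bounded_comp bW (eR_bounded e).
- by move=> y; rewrite EE; apply/eqE; exact: W1.
- by move=> x y /eqE h; rewrite EE; exact: W2.
Qed.

Lemma resolvent_ext z v : C_omega A z -> resolvent A z v = ext_resolvent j A z (j v).
Proof.
move=> zA; have [_ h1 h2] := ext_resolventP zA.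
have := h1 (j v); set x := ext_resolvent j A z (j v) => hx.
have dx : dom A x /\ z *: x - A x = v.
  have ex : x = resolvent A b (v - (z - b) *: x).
    rewrite -(eRj e) (linB _ _ lj) (linZ _ _ lj) -hx ext_opE.
    have -> : z *: j x - (b *: j x - eL e x) - (z - b) *: j x = eL e x.
      by rewrite scalerBl; vec.
    by rewrite eRL.
  have [d1 d2] := resolventP (v - (z - b) *: x) (eb_resolvent e).
  rewrite -ex in d1 d2; split=> //.
  have -> : z *: x - A x = (b *: x - A x) + (z - b) *: x by rewrite scalerBl; vec.
  by rewrite d2 subrK.
have [d1 d2] : [set y | dom A y /\ z *: y - A y = v] (resolvent A z v).
  by apply: (@xgetPex _ 0 [set y | dom A y /\ z *: y - A y = v]); exists x.
apply: h2; rewrite ext_op_dom// -(linZ _ _ lj) -(linB _ _ lj) d2//.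
Qed.

End Extrapolation.

Section PerturbedExtension.
Context {R : realType} {X Xm1 : completeNormedModType R[i]}.

(** Both sides are bounded from [X] to [Xm1] and agree on the domain of [A]. *)
Lemma ext_op_perturb (j : X -> Xm1) (A : operator X X) (P : X -> X) :
  (exists T, generates A T) -> (exists T, generates (perturb A P) T) ->
  extrapolation j A -> extrapolation j (perturb A P) ->
  bounded_op P ->
  forall x, ext_op j (perturb A P) x = ext_op j A x + j (P x).
Proof.
move=> gA gP e eP bP.
apply: (dense_eq (resolvent_range_dense gA (eb_resolvent e)) (ext_op_bounded gP eP)).
  exact: bounded_add (ext_op_bounded gA e) (bounded_comp (j_bounded e) bP).
move=> v; have [d _] := resolventP v (eb_resolvent e).
rewrite (ext_op_dom gA e d) (ext_op_dom gP eP) //=.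
by rewrite linD//; case: (j_bounded e).
Qed.

End PerturbedExtension.

(** * Test functions and integration by parts *)

Section Jets.
Context {R : realType}.
Local Notation mu := (@lebesgue_measure R).

Lemma is_derive_eps (f : R -> R) (x d : R) :
  (forall e : R, 0 < e -> exists2 r : R, 0 < r &
     forall s, `|s - x| < r -> `|f s - f x - (s - x) * d| <= e * `|s - x|) ->
  is_derive x (1 : R) f d.
Proof.
move=> h.
have L : h^-1 *: (f (h *: 1 + x) - f x) @[h --> (0 : R)^'] --> d.
  apply/cvgrPdist_le => e e0; have [r r0 hr] := h e e0.
  exists r => // y; rewrite /= sub0r normrN => yr y0.
  have := hr (y + x); rewrite addrK => /(_ yr) H.
  rewrite [y *: 1]mulr1 distrC.
  have -> : y^-1 *: (f (y + x) - f x) - d = y^-1 * (f (y + x) - f x - y * d).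
    by rewrite mulrBr mulrA mulVf// mul1r.
  by rewrite normrM normfV mulrC ler_pdivrMr// normr_gt0.
split; first by apply/cvg_ex; exists d.
exact: (cvg_lim (@Rhausdorff R) L).
Qed.

Context {E : completeNormedModType R[i]}.

(** Real and imaginary parts of test functions: smooth curves of real functionals
    with compact support. *)
Definition real_jet (a : nat -> R -> E -> R) : Prop :=
  [/\ forall k t, 0 <= t -> is_rfun (a k t),
      forall k t, 0 <= t -> forall e : R, 0 < e -> exists2 d : R, 0 < d &
        forall s, 0 <= s -> `|s - t| < d -> forall v,
          `|a k s v - a k t v - (s - t) * a k.+1 t v| <= e * `|s - t| * rnorm v &
      exists b : R, forall t v, b < t -> a 0%N t v = 0].

Variables (a : nat -> R -> E -> R) (ja : real_jet a).

Let pa k t : 0 <= t -> is_rfun (a k t). Proof. by case: ja => h _ _; exact: h. Qed.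

Lemma real_jet_support : exists2 b : R, 0 <= b & forall k t v, b < t -> a k t v = 0.
Proof.
case: ja => _ da [b hb]; exists (Num.max 0 b); first exact: max0_ge0.
elim=> [|k IH] t v; first by rewrite gt_max => /andP[_]; exact: hb.
move=> bt; have t0 : 0 < t by apply: le_lt_trans bt; exact: max0_ge0.
have : `|a k.+1 t v| <= 0.
  apply/ler_addgt0Pl => e e0; rewrite addr0.
  have e1 : 0 < e / (rnorm v + 1) by rewrite divr_gt0// ltr_wpDl// rnorm_ge0.
  have [d d0 hd] := da k t (ltW t0) _ e1.
  have d2 : 0 < d / 2 by rewrite divr_gt0.
  have := hd (t + d / 2); rewrite addr_ge0 ?(ltW t0) ?(ltW d2)//.
  rewrite [t + _]addrC addrK gtr0_norm// ltr_pdivrMr// ltr_pMr// ltr1n.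
  move=> /(_ isT isT v); rewrite !IH//; last by rewrite ltr_wpDl// ltW.
  rewrite subrr sub0r normrN normrM (gtr0_norm d2) => h.
  have {h} : d / 2 * `|a k.+1 t v| <= d / 2 * (e / (rnorm v + 1) * rnorm v).
    by apply: le_trans h _; rewrite le_eqVlt; apply/orP; left; apply/eqP; ring.
  rewrite ler_pM2l// => h2; apply: le_trans h2 _.
  rewrite mulrAC ler_pdivrMr ?ltr_wpDl ?rnorm_ge0//.
  by rewrite ler_wpM2l ?(ltW e0)// lerDl.
by rewrite normr_le0 => /eqP.
Qed.

Let lip k t : 0 <= t -> exists C d : R, [/\ 0 <= C, 0 < d &
  forall s v, 0 <= s -> `|s - t| < d -> `|a k s v - a k t v| <= C * `|s - t| * rnorm v].
Proof.
move=> t0; case: ja => _ da _; have [d d0 hd] := da k t t0 1 ltr01.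
case: (pa k.+1 t0) => _ _ [K K0 pK].
exists (1 + K), d; split=> //; first by rewrite addr_ge0.
move=> s v s0 sd; have h := hd s s0 sd v.
have -> : a k s v - a k t v =
    (a k s v - a k t v - (s - t) * a k.+1 t v) + (s - t) * a k.+1 t v by ring.
apply: le_trans (ler_normD _ _) _; rewrite -mulrA [leRHS]mulrDl; apply: lerD.
  by rewrite mulrA.
by rewrite normrM mulrCA; apply: ler_wpM2l.
Qed.

Lemma real_jet_continuous k v : continuous (fun t : R => a k (Num.max 0 t) v).
Proof.
move=> t; set t' := Num.max 0 t.
have [C [d [C0 d0 hd]]] := lip k (max0_ge0 t).
have cm := @continuous_max0 R t.
apply/cvgrPdist_lt => e e0.
have D0 : 0 < C * rnorm v + 1 by rewrite ltr_wpDl// mulr_ge0// rnorm_ge0.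
have r0 : 0 < Num.min d (e / (C * rnorm v + 1)) by rewrite lt_min d0 divr_gt0.
have /cvgrPdist_lt/(_ _ r0) := cm; apply: filterS => s.
rewrite distrC lt_min => /andP[h1 h2]; rewrite distrC.
apply: le_lt_trans (hd _ v (max0_ge0 s) h1) _.
rewrite mulrAC; apply: (@le_lt_trans _ _ ((C * rnorm v + 1) * `|Num.max 0 s - t'|)).
  by rewrite ler_wpM2r// lerDl.
by rewrite mulrC -ltr_pdivlMr.
Qed.

(** Jets are bounded in operator norm on compact intervals, since the operator
    norm depends continuously on time. *)
Lemma real_jet_bounded k : exists K : R -> R, (forall T, 0 <= K T) /\
  forall T t v, 0 <= t -> t <= T -> `|a k t v| <= K T * rnorm v.
Proof.
pose S t := [set x | exists2 v, rnorm v <= 1 & x = `|a k (Num.max 0 t) v|].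
pose N t := sup (S t).
have S0 t : S t 0.
  exists 0; first by rewrite rnorm0.
  by rewrite rfun0 ?normr0//; exact: pa (max0_ge0 t).
have hS t : has_sup (S t).
  split; first by exists 0.
  case: (pa k (max0_ge0 t)) => _ _ [K K0 pK]; exists K => _ [v v1 ->].
  by apply: le_trans (pK v) _; rewrite ler_piMr.
have N0 t : 0 <= N t by apply: sup_upper_bound (S0 t).
have Nub t v : `|a k (Num.max 0 t) v| <= N t * rnorm v.
  have p := pa k (max0_ge0 t).
  have [v0|v0] := eqVneq (rnorm v) 0.
    case: p => _ _ [K K0 pK]; have := pK v; rewrite v0 !mulr0.
    by move=> h; exact: h.
  have vp : 0 < rnorm v by rewrite lt_def v0 rnorm_ge0.
  rewrite -ler_pdivrMr//; apply: sup_upper_bound => //.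
  exists ((rnorm v)^-1%:C *: v).
    by rewrite rnormZr gtr0_norm ?invr_gt0// mulVf.
  case: p => _ pZ _; rewrite pZ normrM gtr0_norm ?invr_gt0//.
  by rewrite mulrC.
have NL t : exists C d : R, [/\ 0 <= C, 0 < d & forall s,
    `|Num.max 0 s - Num.max 0 t| < d -> `|N s - N t| <= C * `|Num.max 0 s - Num.max 0 t|].
  have [C [d [C0 d0 hd]]] := lip k (max0_ge0 t).
  exists C, d; split=> // s sd.
  have h1 : N s <= N t + C * `|Num.max 0 s - Num.max 0 t|.
    apply: ge_sup; first by exists 0.
    move=> _ [v v1 ->]; have h := hd _ v (max0_ge0 s) sd.
    have := ler_normD (a k (Num.max 0 s) v - a k (Num.max 0 t) v) (a k (Num.max 0 t) v).
    rewrite subrK => /le_trans; apply; rewrite addrC; apply: lerD.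
      by apply: sup_upper_bound => //; exists v.
    by apply: le_trans h _; rewrite ler_piMr// mulr_ge0.
  have h2 : N t <= N s + C * `|Num.max 0 s - Num.max 0 t|.
    apply: ge_sup; first by exists 0.
    move=> _ [v v1 ->]; have h := hd _ v (max0_ge0 s) sd.
    have := ler_normB (a k (Num.max 0 s) v) (a k (Num.max 0 s) v - a k (Num.max 0 t) v).
    rewrite subKr => /le_trans; apply; apply: lerD.
      by apply: sup_upper_bound => //; exists v.
    by apply: le_trans h _; rewrite ler_piMr// mulr_ge0.
  by rewrite ler_norml; apply/andP; split; lra.
have Nc : continuous N.
  move=> t; have [C [d [C0 d0 hd]]] := NL t.
  apply/cvgrPdist_lt => e e0.
  have D0 : 0 < C + 1 by rewrite ltr_wpDl.
  have r0 : 0 < Num.min d (e / (C + 1)) by rewrite lt_min d0 divr_gt0.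
  have /cvgrPdist_lt/(_ _ r0) := @continuous_max0 R t; apply: filterS => s.
  rewrite distrC lt_min => /andP[h1 h2]; rewrite distrC.
  apply: le_lt_trans (hd _ h1) _.
  apply: (@le_lt_trans _ _ ((C + 1) * `|Num.max 0 s - Num.max 0 t|)).
    by rewrite ler_wpM2r// lerDl.
  by rewrite mulrC -ltr_pdivlMr.
have H T : exists K, 0 <= K /\ forall t v, 0 <= t -> t <= T -> `|a k t v| <= K * rnorm v.
  have [T0|T0] := leP 0 T; last first.
    by exists 0; split=> // t v t0 tT; have := le_trans t0 tT; rewrite leNgt T0.
  have c : {within `[0, T], continuous N} by exact: continuous_subspaceT.
  have [m _ hm] := EVT_max T0 c.
  exists (N m); split=> // t v t0 tT; rewrite -{1}(max0_id t0).
  apply: le_trans (Nub t v) _; rewrite ler_wpM2r ?rnorm_ge0//.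
  by apply: hm; rewrite in_itv/= t0.
by exists (fun T => projT1 (cid (H T))); split=> [T|T t v]; case: cid => K [K0 hK] //=;
  exact: hK.
Qed.

Lemma real_jet_measurable k (y : R -> E) : L1loc y ->
  measurable_fun `[(0 : R), +oo[%classic (fun t => a k t (y t)).
Proof.
move=> [sy _].
have m : measurable_fun `[(0 : R), +oo[%classic (fun t => a k (Num.max 0 t) (y t)).
  have m0 := @measurable_strongly R E _ R (fun (t : R) v => a k (Num.max 0 t) v) id
    `[(0 : R), +oo[%classic y (measurable_itv _) (@measurable_id _ _ setT).
  apply: m0 => //.
    by move=> v; apply: continuous_measurable_fun; exact: real_jet_continuous.
  by move=> w u v uv; apply: rfun_cvg => //; apply: pa; exact: max0_ge0.
apply: (eq_measurable_fun _ _ m) => t; rewrite inE/= in_itv/= andbT => t0.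
by rewrite max0_id.
Qed.

Lemma real_jet_integrable k (y : R -> E) : L1loc y ->
  mu.-integrable `[0, +oo[ (EFin \o (fun t => a k t (y t))).
Proof.
move=> ly; have [b b0 hb] := real_jet_support.
have [K [K0 hK]] := real_jet_bounded k.
pose g t := K b * rnorm (y t).
have ig : mu.-integrable `[0, b] (EFin \o g).
  by apply: rint_scale => //; apply: rnorm_integrable => //; exact: L1loc_integrable.
have ig' : mu.-integrable `[0, +oo[ (EFin \o (g \_ `[0, b])).
  rewrite -restrict_EFin; apply/integrable_restrict => //.
  by rewrite (setIidr (itv_half_line (lexx 0))).
apply: (rint_dominated _ _ _ ig') => //; first exact: real_jet_measurable.
move=> t /=; rewrite in_itv/= andbT => t0; rewrite patchE; case: ifPn => tb.
  by move: (set_mem tb); rewrite /= in_itv/= => /andP[_ tb']; exact: hK.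
rewrite hb ?normr0// ltNge; apply/negP => tb'; move: tb.
by rewrite notin_setE/= in_itv/= t0 tb'.
Qed.

Lemma real_jet_window k (y : R -> E) (T : R) : (forall t v, T < t -> a k t v = 0) ->
  \int[mu]_(t in `[0, +oo[) a k t (y t) = \int[mu]_(t in `[0, T]) a k t (y t).
Proof.
move=> hT; rewrite Rintegral_mkcond [RHS]Rintegral_mkcond; apply: eq_Rintegral => t _.
rewrite !patchE; case: ifPn => [|tn].
  move=> /set_mem /=; rewrite in_itv/= andbT => t0.
  case: ifPn => // tb; apply: hT; rewrite ltNge; apply/negP => tT.
  by move: tb; rewrite notin_setE/= in_itv/= t0 tT.
case: ifPn => // /set_mem /=; rewrite in_itv/= => /andP[t0 _].
by move: tn; rewrite notin_setE/= in_itv/= t0.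
Qed.

Let da k (t : R) v : 0 < t -> is_derive t (1 : R) (fun s => a k (Num.max 0 s) v) (a k.+1 (Num.max 0 t) v).
Proof.
move=> t0; apply: is_derive_eps => e e0; case: ja => _ d _.
have e1 : 0 < e / (rnorm v + 1) by rewrite divr_gt0// ltr_wpDl// rnorm_ge0.
have [r r0 hr] := d k t (ltW t0) _ e1.
exists (Num.min r t); first by rewrite lt_min r0.
move=> s; rewrite lt_min => /andP[sr st].
have s0 : 0 <= s by have := ler_norm (- (s - t)); rewrite normrN; lra.
rewrite !max0_id ?(ltW t0)//; apply: le_trans (hr s s0 sr v) _.
rewrite mulrAC ler_wpM2r// mulrAC ler_pdivrMr ?ltr_wpDl ?rnorm_ge0//.
by rewrite ler_wpM2l ?(ltW e0)// lerDl.
Qed.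

(** Integration by parts, twice, against a function that is merely integrable:
    Fubini reduces it to the scalar identity
    [int_s^T (r - s) phi''(r) dr = phi(s)]. *)
Lemma jet_second_primitive (g : R -> E) : L1loc g ->
  \int[mu]_(t in `[0, +oo[) a 2 t (second_primitive g t) =
  \int[mu]_(t in `[0, +oo[) a 0 t (g t).
Proof.
move=> lg; have [b b0 hb] := real_jet_support.
pose T := b + 1; have T0 : 0 <= T by rewrite addr_ge0.
have bT : b < T by rewrite ltrDl.
have hT k t v : T < t -> a k t v = 0 by move=> Tt; apply: hb; exact: lt_trans bT Tt.
rewrite (@real_jet_window 2 _ T (hT 2)) (@real_jet_window 0 _ T (hT 0%N)).
have [K [K0 hK]] := real_jet_bounded 2.
have KT : 0 <= T * K T by rewrite mulr_ge0.
transitivity (\int[mu]_(r in `[0, T]) (\int[mu]_(s in `[0, r])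
    (Num.max 0 (r - s) * a 2 (Num.max 0 r) (g s)))).
  apply: eq_Rintegral => t; rewrite inE/= in_itv/= => /andP[t0 tT].
  have p := pa 2 t0; case: (p) => _ pZ _.
  have -> : second_primitive g t = conv (fun r v => (Num.max 0 r)%:C *: v) g t.
    apply: eq_bochner => s; rewrite inE/= in_itv/= => /andP[s0 st].
    by rewrite max0_id// subr_ge0.
  apply: (etrans (conv_rfun sc_family_ramp t lg p)).
  by apply: eq_Rintegral => s _; rewrite pZ (max0_id t0).
rewrite (fubini_kernel (a := fun r s v => Num.max 0 (r - s) * a 2 (Num.max 0 r) v)
  (K := T * K T) KT lg).
- apply: eq_Rintegral => s; rewrite inE/= in_itv/= => /andP[s0 sT].
  set v := g s.
  have -> : \int[mu]_(r in `[s, T]) (Num.max 0 (r - s) * a 2 (Num.max 0 r) v) =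
      \int[mu]_(r in `[s, T]) ((r - s) * a 2 (Num.max 0 r) v).
    apply: eq_Rintegral => r; rewrite inE/= in_itv/= => /andP[sr _].
    by rewrite max0_id// subr_ge0.
  pose p r := (r - s) * a 1 (Num.max 0 r) v - a 0 (Num.max 0 r) v.
  have cs : continuous (fun r : R => r - s).
    by move=> x; apply: cvgB => //; exact: cvg_cst.
  have ck : continuous (fun r => (r - s) * a 2 (Num.max 0 r) v).
    by move=> x; apply: cvgM; [exact: cs|exact: real_jet_continuous].
  have cp : continuous p.
    move=> x; apply: cvgB; last exact: real_jet_continuous.
    by apply: cvgM; [exact: cs|exact: real_jet_continuous].
  have dp x : s < x -> x < T -> is_derive x (1 : R) p ((x - s) * a 2 (Num.max 0 x) v).
    move=> sx _; have x0 : 0 < x by apply: le_lt_trans sx.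
    have d1 := da 1 v x0; have d0 := da 0 v x0.
    apply: is_derive_eq; rewrite /GRing.scale /=; ring.
  rewrite (Rint_FTC2 sT ck cp dp) /p subrr mul0r sub0r opprK.
  by rewrite !(max0_id s0) (max0_id T0) !(hb _ T)// mulr0 subr0 add0r.
- move=> v; apply: measurable_funM.
    apply: (measurableT_comp (continuous_measurable_fun (@continuous_max0 R))).
    exact: measurable_funB.
  exact: (measurableT_comp (continuous_measurable_fun (real_jet_continuous (k := 2) (v := v)))).
- move=> r s u v uv; apply: cvgMr; apply: rfun_cvg => //.
  by apply: pa; exact: max0_ge0.
- move=> r s v s0 sr rT; rewrite normrM -mulrA; apply: ler_pM => //.
    rewrite ger0_norm ?max0_ge0// max0_id ?subr_ge0//.
    by apply: le_trans rT; rewrite gerBl.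
  have r0 : 0 <= r by exact: le_trans sr.
  by rewrite max0_id//; exact: hK.
Qed.

End Jets.

(** * Flat test functions *)

Section Flat.
Context {R : realType}.

Lemma eps_is_derive (f : R -> R) (x d : R) : is_derive x (1 : R) f d ->
  forall e : R, 0 < e -> exists2 r : R, 0 < r &
    forall s, `|s - x| < r -> `|f s - f x - (s - x) * d| <= e * `|s - x|.
Proof.
move=> [df fd] e e0.
have L : h^-1 *: (f (h *: (1 : R) + x) - f x) @[h --> (0 : R)^'] --> d.
  by rewrite -fd; exact: df.
have /cvgrPdist_le/(_ _ e0)[r /= r0 hr] := L; exists r => // s sr.
have [->|sx] := eqVneq s x; first by rewrite !subrr mul0r subr0 normr0 mulr0.
have s0 : s - x != 0 by rewrite subr_eq0.
have := hr (s - x); rewrite /= sub0r normrN => /(_ sr s0).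
rewrite [(s - x) *: _]mulr1 subrK distrC => H.
have -> : f s - f x - (s - x) * d = (s - x) * ((s - x)^-1 *: (f s - f x) - d).
  by rewrite mulrBr mulrA mulfV// mul1r.
by rewrite normrM mulrC ler_wpM2r.
Qed.

Variables (l : R) (l0 : 0 < l).

(** Smooth functions flat at the origin.  The family [r^2 p(1/r) exp(-l/r)],
    with [p] a polynomial, is closed under differentiation, which acts on [p] by
    [flat_deriv]. *)
Definition flat (p : {poly R}) (r : R) : R :=
  if 0 < r then r ^+ 2 * p.[r^-1] * expR (- l * r^-1) else 0.

Definition flat_deriv (p : {poly R}) : {poly R} :=
  2%:P * 'X * p - 'X^2 * p^`() + l%:P * 'X^2 * p.

Lemma poly_expR_bound (p : {poly R}) (m : R) : 0 < m ->
  exists2 C : R, 0 <= C & forall y, 0 <= y -> `|p.[y]| <= C * expR (m * y).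
Proof.
elim/poly_ind: p m => [|q c IH] m m0.
  by exists 0 => // y y0; rewrite horner0 normr0 mul0r.
have m2 : 0 < m / 2 by rewrite divr_gt0.
have [C C0 hC] := IH _ m2.
exists (C * (m / 2)^-1 + `|c|).
  by rewrite addr_ge0// mulr_ge0// invr_ge0 ltW.
move=> y y0; rewrite hornerMXaddC.
have e1 : y <= (m / 2)^-1 * expR (m / 2 * y).
  rewrite mulrC ler_pdivlMr// mulrC.
  by apply: le_trans (expR_ge1Dx _); rewrite lerDr.
have e2 : expR (m * y) = expR (m / 2 * y) * expR (m / 2 * y).
  by rewrite -expRD; congr expR; field.
have e3 : 1 <= expR (m * y).
  by apply: le_trans (expR_ge1Dx _); rewrite lerDl mulr_ge0// ltW.
apply: le_trans (ler_normD _ _) _; rewrite mulrDl; apply: lerD; last first.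
  by rewrite ler_peMr.
rewrite normrM (ger0_norm y0) e2.
apply: le_trans (ler_pM _ _ (hC y y0) e1) _ => //.
by rewrite le_eqVlt; apply/orP; left; apply/eqP; ring.
Qed.

Lemma flat_bound p : exists2 C : R, 0 <= C & forall r, `|flat p r| <= C * r ^+ 2.
Proof.
have [C C0 hC] := poly_expR_bound p l0; exists C => // r; rewrite /flat.
case: ifPn => [r0|_]; last by rewrite normr0 mulr_ge0// sqr_ge0.
have r1 : 0 <= r^-1 by rewrite invr_ge0 ltW.
rewrite normrM [`|_ * _.[_]|]normrM (ger0_norm (sqr_ge0 r)) (ger0_norm (expR_ge0 _)) -mulrA mulrC.
rewrite ler_wpM2r ?sqr_ge0//; apply: le_trans (ler_wpM2r (expR_ge0 _) (hC _ r1)) _.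
by rewrite -mulrA -expRD mulNr subrr expR0 mulr1.
Qed.

Lemma flat_derive p (r : R) : forall e : R, 0 < e -> exists2 d : R, 0 < d &
  forall s, `|s - r| < d ->
    `|flat p s - flat p r - (s - r) * flat (flat_deriv p) r| <= e * `|s - r|.
Proof.
move=> e e0; have [r0|r0|->] := ltgtP r 0.
- exists (- r); first by rewrite oppr_gt0.
  move=> s sr; have s0 : s < 0 by have := ler_norm (s - r); lra.
  rewrite /flat !ltNge (ltW r0) (ltW s0)/= subr0 mulr0 subr0 normr0.
  by rewrite mulr_ge0// ltW.
- pose f (s : R) := s ^+ 2 * p.[s^-1] * expR (- l * s^-1).
  have di : is_derive r (1 : R) (fun s : R => s^-1) (- r ^- 2).
    have := @is_deriveV R id r 1 1; rewrite scaler1 => h.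
    by apply: h; exact: lt0r_neq0.
  have dp : is_derive r (1 : R) (fun s : R => p.[s^-1]) (p^`().[r^-1] * - r ^- 2).
    exact: (@is_derive1_comp R (horner p) (fun s => s^-1) r _ _ _ di).
  have dl : is_derive r (1 : R) (fun s : R => - l * s^-1) (- l * - r ^- 2).
    exact: is_deriveZ.
  have de : is_derive r (1 : R) (fun s : R => expR (- l * s^-1))
      (expR (- l * r^-1) * (- l * - r ^- 2)).
    exact: (@is_derive1_comp R expR (fun s => - l * s^-1) r _ _ _ dl).
  have df : is_derive r (1 : R) f (flat (flat_deriv p) r).
    have d2 : is_derive r (1 : R) (fun s : R => s ^+ 2) (2 * r).
      have h := @is_deriveM R R id id r 1 _ _ (is_derive_id r 1) (is_derive_id r 1).
      by apply: (is_derive_eq h); rewrite /GRing.scale /= mulr1 mulr_natl mulr2n.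
    have d3 := @is_deriveM R R _ _ r 1 _ _ (@is_deriveM R R _ _ r 1 _ _ d2 dp) de.
    apply: (is_derive_eq d3).
    rewrite /flat r0 /flat_deriv /GRing.scale /= !hornerE /=.
    rewrite -[((fun s : R => s ^+ 2) * _) r]/(r ^+ 2 * p.[r^-1]).
    by field; rewrite gt_eqF.
  have [d d0 hd] := eps_is_derive df e0.
  exists (Num.min d r); first by rewrite lt_min d0.
  move=> s; rewrite lt_min => /andP[sd sr].
  have s0 : 0 < s by have := ler_norm (- (s - r)); rewrite normrN; lra.
  by rewrite {1 2}/flat r0 s0; exact: hd.
(* At the origin, quadratic decay gives a vanishing derivative. *)
- have [C C0 hC] := flat_bound p.
  have C1 : 0 < C + 1 by rewrite ltr_wpDl.
  exists (e / (C + 1)); first by rewrite divr_gt0.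
  move=> s; rewrite subr0 {2 3}/flat ltxx mulr0 !subr0 => sd.
  apply: le_trans (hC s) _; rewrite -real_normK ?num_real// expr2 mulrA.
  rewrite ler_wpM2r//; apply: (@le_trans _ _ ((C + 1) * `|s|)).
    by rewrite ler_wpM2r// lerDl.
  by rewrite mulrC -ler_pdivlMr// ltW.
Qed.

Lemma flat_second r :
  flat (flat_deriv (flat_deriv (2^-1)%:P)) r =
  if 0 < r then (1 + l / r + (l / r) ^+ 2 / 2) * expR (- (l / r)) else 0.
Proof.
rewrite /flat; case: ifP => // r0; rewrite mulNr; congr (_ * _).
rewrite /flat_deriv !poly.derivE !hornerE /=.
by field; rewrite gt_eqF.
Qed.

Lemma flat_second_bound r : `|flat (flat_deriv (flat_deriv (2^-1)%:P)) r| <= 2.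
Proof.
rewrite flat_second; case: ifPn => [r0|_]; last by rewrite normr0.
set s := l / r; have s0 : 0 <= s by rewrite divr_ge0 ?ltW.
rewrite expRN normrM normfV (ger0_norm (expR_ge0 _)) ler_pdivrMr ?expR_gt0//.
rewrite ger0_norm; last first.
  by rewrite !addr_ge0// mulr_ge0 ?sqr_ge0.
have -> : expR s = expR (s / 2) ^+ 2 by rewrite expr2 -expRD -splitr.
have h := expR_ge1Dx (s / 2).
have : (1 + s / 2) ^+ 2 <= expR (s / 2) ^+ 2 by rewrite ler_pXn2r// nnegrE ?expR_ge0// addr_ge0// divr_ge0.
have := sqr_ge0 s; nra.
Qed.

End Flat.

Section Separation.
Context {R : realType} {Y : completeNormedModType R[i]}.
Local Notation mu := (@lebesgue_measure R).
Local Notation C := (R[i] : numFieldType).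

Lemma normc_ge_Im (z : R[i]) : `|complex.Im z|%:C <= `|z|.
Proof.
by rewrite normc_def lecR -sqrtr_sqr ler_wsqrtr// lerDr sqr_ge0.
Qed.

Lemma real_jet_part (p : R[i] -> R) (phi : test_function Y) :
  (forall z w, p (z + w) = p z + p w) -> (forall (r : R) z, p (r%:C * z) = r * p z) ->
  (forall z : R[i], `|p z|%:C <= `|z|) -> real_jet (fun k t v => p (jet phi k t v)).
Proof.
move=> pD pZ pn.
have pB z w : p (z - w) = p z - p w.
  rewrite pD; congr (_ + _); rewrite -[- w]mulN1r (_ : -1 = (-1)%:C) ?pZ ?mulN1r//.
  by rewrite rmorphN rmorph1.
have p0 : p 0 = 0 by rewrite -(subrr 0) pB subrr.
split.
- move=> k t t0; have /bounded_opP[lj [K K0 hK]] := jet_dual phi k t0; split.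
  + by move=> v w; rewrite (linD _ _ lj) pD.
  + by move=> r v; rewrite (linZ _ _ lj) -pZ.
  + exists K => // v; apply: le_trans (hK v).
    by rewrite -lecR; apply: le_trans (pn _) _; rewrite (normC_rnorm (_ : R[i]^o)).
- move=> k t t0 e e0; have [d d0 hd] := jet_derive phi k t0 e0.
  exists d => // s s0 sd v; have := hd s s0 sd v; rewrite -pZ -!pB -lecR.
  by move=> h; apply: le_trans (pn _) _; apply: le_trans h _; rewrite [leRHS]rmorphM normC_rnorm.
- by have [b hb] := jet_support phi; exists b => t v bt; rewrite hb.
Qed.

Lemma real_jet_Re (phi : test_function Y) :
  real_jet (fun k t v => complex.Re (jet phi k t v)).
Proof.
apply: real_jet_part; first by case=> ? ? [].
  by move=> r [x y]; rewrite /= mul0r subr0.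
by move=> z; exact: normc_ge_Re.
Qed.

Lemma real_jet_Im (phi : test_function Y) :
  real_jet (fun k t v => complex.Im (jet phi k t v)).
Proof.
apply: real_jet_part; first by case=> ? ? [].
  by move=> r [x y]; rewrite /= mul0r addr0.
by move=> z; exact: normc_ge_Im.
Qed.

(** Test functions have complex-linear values: the formula is that of the
    complex-linear functional with real part [psi]. *)
Lemma linear_complexification (psi : Y -> R) : is_rfun psi ->
  bounded_op ((fun v => Complex (psi v) (- psi ('i%C *: v))) : Y -> R[i]^o).
Proof.
move=> p; have [pD pZ [K K0 pK]] := p.
apply/bounded_opP; split.
  move=> a u v; rewrite scalerDr !pD.
  have E (w : Y) : psi (a *: w) = complex.Re a * psi w + complex.Im a * psi ('i%C *: w).
    by rewrite {1}[a]complexE scalerDl pD pZ ['i%C * _]mulrC -scalerA pZ.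
  have ii (w : Y) : 'i%C *: ('i%C *: w) = - w.
    by rewrite scalerA -expr2 sqr_i scaleN1r.
  have pN w : psi (- w) = - psi w by rewrite -scaleN1r -[-1](rmorphN1 (real_complex R)) pZ mulN1r.
  rewrite scalerA mulrC -scalerA !E ii pN {E}; case: a => x y.
  by apply/eqP; rewrite eq_complex /=; apply/andP; split; apply/eqP; ring.
exists (K + K); first by rewrite addr_ge0.
move=> v; apply: le_trans (normC_le _) _ => /=.
rewrite mulrDl normrN; apply: lerD; first exact: pK.
apply: le_trans (pK _) _; rewrite rnormZ.
have -> : complex.Re `|'i%C : R[i]| = 1; last by rewrite mul1r.
by rewrite normc_def /= expr0n /= add0r expr1n sqrtr1.
Qed.

(** [(b - t) ^ 2 / 2], damped near [t = b]: its second derivative is close to the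
    indicator function of the times before [b] when [l] is small. *)
Definition flat_jet (l b : R) (psi : Y -> R) k (t : R) (v : Y) : R[i] :=
  ((-1) ^+ k * flat l (iter k (flat_deriv l) (2^-1)%:P) (b - t))%:C *
  Complex (psi v) (- psi ('i%C *: v)).

Lemma flat_test l b psi : 0 < l -> is_rfun psi ->
  exists phi : test_function Y, jet phi = flat_jet l b psi.
Proof.
move=> l0 p; have bp := linear_complexification p.
have d k t : 0 <= t -> bounded_op (flat_jet l b psi k t : Y -> R[i]^o).
  move=> _; exact: (@bounded_scale _ Y R[i]^o
    ((-1) ^+ k * flat l (iter k (flat_deriv l) (2^-1)%:P) (b - t))%:C _ bp).
have dj k t : 0 <= t -> forall eps : R, 0 < eps -> exists2 delta : R, 0 < delta &
    forall s, 0 <= s -> `|s - t| < delta -> forall v : Y,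
      `|flat_jet l b psi k s v - flat_jet l b psi k t v -
        (s - t)%:C * flat_jet l b psi k.+1 t v| <= (eps * `|s - t|)%:C * `|v|.
  move=> _ e e0; case/bounded_opP: bp => _ [K K0 hK].
  have K1 : 0 < K + 1 by rewrite ltr_wpDl.
  have [r r0 hr] := flat_derive l0 (iter k (flat_deriv l) (2^-1)%:P) (b - t)
    (divr_gt0 e0 K1).
  exists r => // s _ sr v; rewrite /flat_jet.
  have := hr (b - s); rewrite (_ : b - s - (b - t) = - (s - t)); last by ring.
  rewrite normrN => /(_ sr).
  set g0 := flat _ _ (b - s); set g1 := flat _ _ (b - t); set g2 := flat _ _ (b - t).
  set z := Complex _ _ => h.
  have -> : ((-1) ^+ k * g0)%:C * z - ((-1) ^+ k * g1)%:C * z -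
      (s - t)%:C * (((-1) ^+ k.+1 * g2)%:C * z) =
      ((-1) ^+ k * (g0 - g1 - - (s - t) * g2))%:C * z.
    by rewrite !(rmorphM, rmorphB, rmorphN) /= exprS !(rmorphM, rmorphN) /= rmorph1; ring.
  rewrite normrM normc_real normrM normrX normrN1 expr1n mul1r.
  rewrite (normC_rnorm (z : R[i]^o)) (normC_rnorm v) -!rmorphM lecR.
  apply: le_trans (ler_pM _ _ h (hK v)) _ => //; first exact: rnorm_ge0.
  rewrite mulrA ler_wpM2r ?rnorm_ge0// mulrAC ler_wpM2r//.
  by rewrite mulrAC ler_pdivrMr// ler_wpM2l ?(ltW e0)// lerDl.
have sj : exists b0 : R, forall t v, b0 < t -> flat_jet l b psi 0 t v = 0.
  exists b => t v bt; rewrite /flat_jet /flat ltNge (_ : b - t <= 0) ?mulr0 ?mul0r//.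
  by rewrite subr_le0 ltW.
by exists (Test d dj sj).
Qed.

(** The second derivatives of the flat test functions that vanish after [b] tend
    to the indicator function of the times before [b], by dominated convergence. *)
Lemma jet_separation (D : R -> Y) : L1loc D ->
  (forall phi : test_function Y,
     complex_integral `[0, +oo[ (fun t => jet phi 2 t (D t)) = 0) ->
  forall b, 0 <= b -> prim D b = 0.
Proof.
move=> lD h b b0; apply: rfun_ext => psi p; rewrite (prim_rfun b lD p) rfun0//.
pose l n : R := n.+1%:R^-1; have l0 n : 0 < l n by rewrite invr_gt0.
pose w n t := flat (l n) (flat_deriv (l n) (flat_deriv (l n) (2^-1)%:P)) (b - t).
have I n : \int[mu]_(t in `[0, b]) (w n t * psi (D t)) = 0 /\
    mu.-integrable `[(0 : R), b]%classic (EFin \o (fun t => w n t * psi (D t))).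
  have [phi e] := flat_test b (l0 n) p.
  have E t : complex.Re (jet phi 2 t (D t)) = w n t * psi (D t).
    by rewrite e /flat_jet /= mul0r subr0 sqrrN expr1n mul1r.
  have i := real_jet_integrable (real_jet_Re phi) 2 lD.
  have w0 t : b < t -> w n t = 0.
    move=> bt; rewrite /w /flat ltNge (_ : b - t <= 0)//.
    by rewrite subr_le0 ltW.
  split.
    apply: etrans (congr1 (@complex.Re R) (h phi)) => /=; apply/esym.
    rewrite (@real_jet_window _ _ (fun k t v => complex.Re (jet phi k t v)) 2 D b).
      by apply: eq_Rintegral => t _; rewrite E.
    by move=> t v bt; rewrite e /flat_jet -/(w n t) /= (w0 _ bt); rewrite mulr0 !mul0r subr0.
  have <- : (fun t => complex.Re (jet phi 2 t (D t))) = (fun t => w n t * psi (D t)).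
    exact/funext.
  by apply: integrableS i => //; exact: itv_half_line.
have L : \int[mu]_(t in `[0, b]) (w n t * psi (D t)) @[n --> \oo] -->
    \int[mu]_(t in `[0, b]) psi (D t).
  have ip := rfun_L1loc b (lexx 0) p lD.
  apply: (Rint_dominated_cvg (c := b) (g := fun t => 2 * `|psi (D t)|)) => //.
  - by move=> n; case: (I n).
  - by apply/measurable_EFinP; exact: measurable_int ip.
  - by apply: rint_scale => //; exact: rint_norm ip.
  - by move=> n s _; rewrite normrM ler_wpM2r// flat_second_bound.
  - move=> s; rewrite /= in_itv/= => /andP[s0 sb] sb'.
    have r0 : 0 < b - s by rewrite subr_gt0 lt_neqAle sb' sb.
    have lc : l n / (b - s) @[n --> \oo] --> (0 : R).
      by rewrite -(mul0r (b - s)^-1); apply: cvgM; [exact: cvg_harmonic|exact: cvg_cst].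
    have wc : w n s @[n --> \oo] --> (1 : R).
      have -> : (fun n => w n s) = (fun n => (1 + l n / (b - s) +
          (l n / (b - s)) ^+ 2 / 2) * expR (- (l n / (b - s)))).
        by apply/funext => n; rewrite /w flat_second r0.
      have : (1 + l n / (b - s) + (l n / (b - s)) ^+ 2 / 2) * expR (- (l n / (b - s)))
          @[n --> \oo] --> (1 + 0 + (0 * 0) / 2) * expR (- 0).
        apply: cvgM.
          apply: cvgD; first by apply: cvgD; [exact: cvg_cst|exact: lc].
          by apply: cvgM; [apply: cvgM; exact: lc|exact: cvg_cst].
        apply: continuous_cvg; first exact: continuous_expR.
        exact: cvgN.
      by rewrite mul0r mul0r !addr0 mul1r oppr0 expR0.
    by rewrite -[X in _ --> X]mul1r; apply: cvgM => //; exact: cvg_cst.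
have Z : \int[mu]_(t in `[0, b]) (w n t * psi (D t)) @[n --> \oo] --> (0 : R).
  have -> : (fun n => \int[mu]_(t in `[0, b]) (w n t * psi (D t))) = fun=> 0.
    by apply/funext => n; case: (I n).
  exact: cvg_cst.
exact: (cvg_unique (@Rhausdorff R) L Z).
Qed.

End Separation.

(** * Essential bounds and distributions *)

Section LocallyBounded.
Context {R : realType} {E : completeNormedModType R[i]}.
Local Notation mu := (@lebesgue_measure R).
Implicit Types (f g : R -> E) (t K : R).

Lemma Linfty_norm_leP t f K : 0 <= K -> (Linfty_norm t f <= K%:E)%E <->
  {ae mu, forall s, 0 <= s <= t -> rnorm (f s) <= K}.
Proof.
move=> K0; split=> [/ess_supP|] h; last apply/ess_supP; apply: (@filterS _ _ (ae_filter_ringOfSetsType mu) _ _ _ h) => {h} s.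
  move=> h /andP[s0 st]; move: h; rewrite patchE mem_set ?lee_fin//.
  by rewrite /= in_itv/= s0.
move=> h; rewrite patchE; case: ifPn => [/set_mem|_]; rewrite /= ?in_itv/= lee_fin//.
Qed.

Lemma Linfty_norm_ge0 t f : (0 <= Linfty_norm t f)%E.
Proof.
apply: ess_sup_gee.
  apply: (@lt_le_trans _ _ (mu `[(0 : R), 1]%classic)).
    by rewrite lebesgue_measure_itv/= lte_fin ltr01 oppr0 adde0 lte_fin ltr01.
  by apply: le_measure => //; rewrite inE.
apply: aeW => s; rewrite patchE; case: ifP => // _; by rewrite lee_fin rnorm_ge0.
Qed.

Lemma Linfty_norm_fin t f : 0 < t -> Linftyloc f -> exists2 K, 0 <= K & Linfty_norm t f = K%:E.
Proof.
move=> t0 [_ /(_ t t0)]; have := Linfty_norm_ge0 t f.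
case: Linfty_norm => [r| |]; rewrite ?ltxx//.
by rewrite lee_fin => r0 _; exists r.
Qed.

Lemma Linftyloc_L1loc f : Linftyloc f -> L1loc f.
Proof.
move=> lf; case: (lf) => sf _; split=> // t t0.
have t1 : 0 < t + 1 by rewrite ltr_wpDl.
have [K K0 fK] := Linfty_norm_fin t1 lf.
have /Linfty_norm_leP - /(_ K0) ae : (Linfty_norm (t + 1) f <= K%:E)%E by rewrite fK.
have sf' : strongly_measurable `[(0 : R), t]%classic f.
  by apply: strongly_measurable_sub sf => //; exact: itv_half_line.
apply: (@le_lt_trans _ _ (\int[mu]_(s in `[0%R, t]) K%:E)%E).
  apply: ae_ge0_le_integral => //.
  - by move=> s _; rewrite lee_fin rnorm_ge0.
  - by apply/measurable_EFinP; exact: measurable_rnorm.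
  - apply: (@filterS _ _ (ae_filter_ringOfSetsType mu) _ _ _ ae) => s h; rewrite /= in_itv/= => /andP[s0 st].
    by rewrite lee_fin h// s0 (le_trans st)// lerDl.
rewrite integral_cst//=; apply: lte_mul_pinfty => //; exact: mu_itv_fin.
Qed.

Lemma Linfty_norm_add t f g K L : 0 <= K -> 0 <= L ->
  (Linfty_norm t f <= K%:E)%E -> (Linfty_norm t g <= L%:E)%E ->
  (Linfty_norm t (fun s => f s + g s)%R <= (K + L)%:E)%E.
Proof.
move=> K0 L0 /Linfty_norm_leP - /(_ K0) h1 /Linfty_norm_leP - /(_ L0) h2.
apply/Linfty_norm_leP; first exact: addr_ge0.
have h := @filterI _ _ (ae_filter_ringOfSetsType mu) _ _ h1 h2.
apply: (@filterS _ _ (ae_filter_ringOfSetsType mu) _ _ _ h) => s [fK gL] st.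
by apply: le_trans (ler_rnormD _ _) _; apply: lerD; [exact: fK|exact: gL].
Qed.

Lemma Linftyloc_add f g : Linftyloc f -> Linftyloc g -> Linftyloc (fun s => f s + g s).
Proof.
move=> lf lg; split.
  by apply: strongly_measurable_add; [case: lf|case: lg].
move=> t t0; have [K K0 fK] := Linfty_norm_fin t0 lf; have [L L0 gL] := Linfty_norm_fin t0 lg.
by apply: le_lt_trans (Linfty_norm_add (t := t) K0 L0 _ _) (ltry _); rewrite ?fK ?gL.
Qed.

End LocallyBounded.

Section LocallyBoundedOperator.
Context {R : realType} {E F : completeNormedModType R[i]}.
Local Notation mu := (@lebesgue_measure R).

Lemma Linfty_norm_op (T : E -> F) (f : R -> E) (t L K : R) : 0 <= L -> 0 <= K ->
  (forall v, rnorm (T v) <= L * rnorm v) -> (Linfty_norm t f <= K%:E)%E ->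
  (Linfty_norm t (fun s => T (f s)) <= (L * K)%:E)%E.
Proof.
move=> L0 K0 TL /Linfty_norm_leP - /(_ K0) h; apply/Linfty_norm_leP; first exact: mulr_ge0.
apply: (@filterS _ _ (ae_filter_ringOfSetsType mu) _ _ _ h) => s hs st; apply: le_trans (TL _) _.
by rewrite ler_wpM2l// hs.
Qed.

Lemma Linftyloc_op (T : E -> F) (f : R -> E) : bounded_op T -> Linftyloc f ->
  Linftyloc (fun s => T (f s)).
Proof.
move=> bT lf; have /bounded_opP[_ [L L0 TL]] := bT; split.
  by apply: strongly_measurable_op => //; case: lf.
move=> t t0; have [K K0 fK] := Linfty_norm_fin t0 lf.
by apply: le_lt_trans (Linfty_norm_op (t := t) L0 K0 TL _) (ltry _); rewrite fK.
Qed.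

End LocallyBoundedOperator.

Section Distributions.
Context {R : realType} {Y : completeNormedModType R[i]}.
Local Notation mu := (@lebesgue_measure R).

Lemma eq_complex_integral (D : set R) (f g : R -> R[i]) :
  (forall t, D t -> f t = g t) -> complex_integral D f = complex_integral D g.
Proof.
by move=> fg; congr Complex; apply: eq_Rintegral => t /set_mem Dt; rewrite fg.
Qed.

Lemma jet_integral_add (phi : test_function Y) k (g h : R -> Y) : L1loc g -> L1loc h ->
  complex_integral `[0, +oo[ (fun t => jet phi k t (g t + h t)) =
  complex_integral `[0, +oo[ (fun t => jet phi k t (g t)) +
  complex_integral `[0, +oo[ (fun t => jet phi k t (h t)).
Proof.
move=> lg lh; rewrite (@eq_complex_integral _ _
    (fun t => jet phi k t (g t) + jet phi k t (h t))); last first.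
  move=> t; rewrite /= in_itv/= andbT => t0.
  by have [lj _] := jet_dual phi k t0; rewrite (linD _ _ lj).
apply/eqP; rewrite eq_complex /=; apply/andP; split; apply/eqP.
- rewrite -(@RintegralD _ _ R mu _ _ _ (measurable_itv _)
    (real_jet_integrable (real_jet_Re phi) k lg) (real_jet_integrable (real_jet_Re phi) k lh)).
  by apply: eq_Rintegral => t _; case: (jet _ _ _ (g t)); case: (jet _ _ _ (h t)).
- rewrite -(@RintegralD _ _ R mu _ _ _ (measurable_itv _)
    (real_jet_integrable (real_jet_Im phi) k lg) (real_jet_integrable (real_jet_Im phi) k lh)).
  by apply: eq_Rintegral => t _; case: (jet _ _ _ (g t)); case: (jet _ _ _ (h t)).
Qed.

Lemma jet_integral_sub (phi : test_function Y) k (g h : R -> Y) : L1loc g -> L1loc h ->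
  complex_integral `[0, +oo[ (fun t => jet phi k t (g t - h t)) =
  complex_integral `[0, +oo[ (fun t => jet phi k t (g t)) -
  complex_integral `[0, +oo[ (fun t => jet phi k t (h t)).
Proof.
move=> lg lh; apply/eqP; rewrite eq_sym subr_eq -(jet_integral_add _ _ (L1loc_sub lg lh) lh).
by apply/eqP; apply: eq_complex_integral => t _; rewrite subrK.
Qed.

Lemma jet_integral_second (phi : test_function Y) (g : R -> Y) : L1loc g ->
  complex_integral `[0, +oo[ (fun t => jet phi 2 t (second_primitive g t)) =
  distribution_of_fun g phi.
Proof.
move=> lg; congr Complex.
  exact: (jet_second_primitive (real_jet_Re phi)).
exact: (jet_second_primitive (real_jet_Im phi)).
Qed.

(** A continuous curve is determined by its second distributional derivative on
    the closed half line: constants and slopes are detected because test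
    functions need not vanish at the origin. *)
Lemma second_derivative_unique (D g : R -> Y) : continuous (fun t : R => D (Num.max 0 t)) ->
  L1loc g ->
  (forall phi : test_function Y,
     complex_integral `[0, +oo[ (fun t => jet phi 2 t (D t)) = distribution_of_fun g phi) ->
  forall t, 0 <= t -> D t = second_primitive g t.
Proof.
move=> cD lg h; have lD := L1loc_max0 cD; have lW := L1loc_prim (L1loc_prim lg).
pose d (t : R) := D (Num.max 0 t) - prim (prim g) (Num.max 0 t).
have cd : continuous d.
  by move=> s; apply: cvgB; [exact: cD|apply: prim_continuous; exact: L1loc_prim].
suff d0 : forall b, 0 <= b -> prim d b = 0.
  move=> t t0; have := prim_eq0 cd d0 t0; rewrite /d (max0_id t0) (second_primitiveE t0 lg).
  by move/eqP; rewrite subr_eq0 => /eqP.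
apply: jet_separation; first exact: L1loc_continuous.
move=> phi; apply/eqP.
rewrite (@eq_complex_integral _ _ (fun t => jet phi 2 t (D t - prim (prim g) t))); last first.
  by move=> t; rewrite /= in_itv/= andbT => t0; rewrite /d max0_id.
rewrite (jet_integral_sub _ _ lD lW) subr_eq0 h -(jet_integral_second phi lg); apply/eqP.
apply: eq_complex_integral => t; rewrite /= in_itv/= andbT => t0.
by rewrite (second_primitiveE t0 lg).
Qed.

End Distributions.

(** * Integrated solutions in the extrapolation space *)

Section IntegratedSolutions.
Context {R : realType} {X Xm1 : completeNormedModType R[i]}.
Variables (j : X -> Xm1).

(** The equation [x' = A x + f], [x(0) = 0], integrated once: [w] is the primitive
    of [x], and it has values in [X] although [x] only has values in [Xm1]. *)
Definition integrated_solution (A : operator X X) (x f : R -> Xm1) (w : R -> X) : Prop :=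
  forall t, 0 <= t -> j (w t) = prim x t /\ ext_op j A (w t) = x t - prim f t.

Definition mild (A : operator X X) (f : R -> Xm1) (t : R) : Xm1 :=
  conv (clamped (ext_semigroup j A)) f t.

Lemma mildE A f t :
  bochner `[0, t] (fun s => ext_semigroup j A (t - s) (f s)) = mild A f t.
Proof.
apply: eq_bochner => s; rewrite inE/= in_itv/= => /andP[s0 st].
by rewrite clampedE// subr_ge0.
Qed.

Variable A : operator X X.
Hypotheses (gA : exists T, generates A T) (dj : dense (range j)).
Variable e : extrapolation j A.
Local Notation S := (ext_semigroup j A).

Let cS : c0_semigroup S. Proof. by case: (ext_semigroupP gA e). Qed.
Let lj : linear j. Proof. by case: (j_bounded e). Qed.
Let lO : linear (ext_op j A). Proof. by case: (ext_op_bounded gA e). Qed.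
Let lR : linear (eR e). Proof. by case: (eR_bounded e). Qed.

Lemma mild_continuous f : L1loc f -> continuous (fun t : R => mild A f (Num.max 0 t)).
Proof. by move=> lf; exact: (conv_continuous (clamped_family cS) lf). Qed.

Let mild_resolvent f t : 0 <= t -> L1loc f ->
  prim (mild A f) t = j (eR e (eb e *: prim (mild A f) t - mild A f t + prim f t)).
Proof. exact: (prim_conv_resolvent cS (ext_resolvent_data gA dj e)). Qed.

Lemma mild_0 f : L1loc f -> mild A f 0 = 0.
Proof. by move=> lf; exact: prim0 (conv_L1loc (clamped_family cS) 0 lf). Qed.

#[local] Opaque mild.

Lemma mild_within f : L1loc f -> {within `[0, +oo[, continuous (mild A f)}.
Proof.
move=> lf; apply: (@subspace_eq_continuous _ _ _ (fun t : R => mild A f (Num.max 0 t))).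
  by move=> t; rewrite inE/= in_itv/= andbT => t0; rewrite max0_id.
by apply: continuous_subspaceT; exact: mild_continuous.
Qed.

Lemma mild_L1loc f : L1loc f -> L1loc (mild A f).
Proof. by move=> lf; apply: L1loc_max0; exact: mild_continuous. Qed.

Lemma mild_integrated f : L1loc f -> exists w, integrated_solution A (mild A f) f w.
Proof.
move=> lf; pose b := eb e.
exists (fun t => eR e (b *: prim (mild A f) t - mild A f t + prim f t)) => t t0.
have F := mild_resolvent t0 lf; rewrite -/b in F.
split; first by rewrite -F.
rewrite (ext_opE gA e) -F eLR -/b; move: (b *: prim (mild A f) t) (mild A f t) (prim f t) => p q r.
by vec.
Qed.

Section OneSolution.
Variables (x f : R -> Xm1) (w : R -> X).
Hypotheses (cx : continuous (fun t : R => x (Num.max 0 t))) (lf : L1loc f).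
Hypothesis xw : integrated_solution A x f w.

Let lx : L1loc x := L1loc_max0 cx.

Lemma integrated_continuous : continuous (fun t : R => w (Num.max 0 t)).
Proof.
have -> : (fun t : R => w (Num.max 0 t)) = (fun t : R =>
    eR e (eb e *: prim x (Num.max 0 t) - x (Num.max 0 t) + prim f (Num.max 0 t))).
  apply/funext => t; have [h1 h2] := xw (max0_ge0 t).
  rewrite -(eRL e (w _)); congr (eR e _).
  have := ext_opE gA e (w (Num.max 0 t)); rewrite h1 h2 => h.
  have -> : eL e (w (Num.max 0 t)) = eb e *: prim x (Num.max 0 t) -
     (eb e *: prim x (Num.max 0 t) - eL e (w (Num.max 0 t))) by vec.
  rewrite -h; move: (_ *: _) (x _) (prim f _) => p q r.
  by vec.
move=> t; apply: (bounded_cvg (eR_bounded e)); apply: cvgD.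
  by apply: cvgB; [apply: cvgZr; exact: prim_continuous|exact: cx].
exact: prim_continuous.
Qed.

Lemma integrated_L1loc : L1loc w.
Proof. exact: L1loc_max0 integrated_continuous. Qed.

Lemma integrated_state t : 0 <= t -> state_primitive j x t = prim w t.
Proof.
move=> t0; have h : j (prim w t) = second_primitive x t.
  rewrite (second_primitiveE t0 lx) (prim_op t (j_bounded e) integrated_L1loc).
  by apply: eq_prim => s s0 _; case: (xw s0).
apply: (j_injective e); rewrite h.
exact: (@xgetPex _ 0 [set z | j z = second_primitive x t] (ex_intro _ _ h)).
Qed.

(** Primitives commute with the extension of [A], a bounded operator from [X] to
    [Xm1]. *)
Lemma integrated_twice t : 0 <= t ->
  ext_op j A (prim w t) = j (w t) - second_primitive f t.
Proof.
move=> t0; rewrite (prim_op t (ext_op_bounded gA e) integrated_L1loc).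
have [-> _] := xw t0; rewrite (second_primitiveE t0 lf).
rewrite -(prim_sub t lx (L1loc_prim lf)).
by apply: eq_prim => s s0 _; case: (xw s0).
Qed.

End OneSolution.

Lemma integrated_add x1 f1 w1 x2 f2 w2 :
  L1loc x1 -> L1loc x2 -> L1loc f1 -> L1loc f2 ->
  integrated_solution A x1 f1 w1 -> integrated_solution A x2 f2 w2 ->
  integrated_solution A (fun t => x1 t + x2 t) (fun t => f1 t + f2 t)
    (fun t => w1 t + w2 t).
Proof.
move=> lx1 lx2 lf1 lf2 h1 h2 t t0.
have [a1 b1] := h1 t t0; have [a2 b2] := h2 t t0.
rewrite (linD _ _ lj) (linD _ _ lO) a1 a2 b1 b2.
rewrite (prim_add t lx1 lx2) (prim_add t lf1 lf2); split=> //.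
move: (x1 t) (x2 t) (prim f1 t) (prim f2 t) => p q r s.
by vec.
Qed.

Lemma integrated_unique x f w y v :
  continuous (fun t : R => x (Num.max 0 t)) -> continuous (fun t : R => y (Num.max 0 t)) ->
  integrated_solution A x f w -> integrated_solution A y f v ->
  forall t, 0 <= t -> x t = y t /\ w t = v t.
Proof.
move=> cx cy xw yv; have lx := L1loc_max0 cx; have ly := L1loc_max0 cy.
pose d (t : R) := x (Num.max 0 t) - y (Num.max 0 t).
have cd : continuous d by move=> s; apply: cvgB; [exact: cx|exact: cy].
have pd t : 0 <= t -> prim d t = j (w t - v t).
  move=> t0; rewrite (linB _ _ lj); have [-> _] := xw t t0; have [-> _] := yv t t0.
  rewrite -(prim_sub t lx ly).
  by apply: eq_prim => s s0 _; rewrite /d max0_id.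
have d0 t : 0 <= t -> d t = 0.
  apply: (homogeneous_eq0 cS (ext_resolvent_data gA dj e) cd) => {}t t0.
  rewrite (pd t t0); congr (j _); rewrite -(eRL e (w t - v t)); congr (eR e _).
  have := ext_opE gA e (w t - v t); rewrite (linB _ _ lO).
  have [_ ->] := xw t t0; have [_ ->] := yv t t0 => h.
  have -> : d t = x t - prim f t - (y t - prim f t).
    by rewrite /d max0_id//; vec.
  by rewrite h eRL; vec.
have xy t : 0 <= t -> x t = y t.
  by move=> t0; have := d0 t t0; rewrite /d max0_id// => /eqP; rewrite subr_eq0 => /eqP.
move=> t t0; split; first exact: xy.
apply: (j_injective e); have [-> _] := xw t t0; have [-> _] := yv t t0.
by apply: eq_prim => s s0 _; exact: xy.
Qed.

End IntegratedSolutions.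

(** * Observation operators *)

Section Observation.
Context {R : realType} {U X Xm1 Y : completeNormedModType R[i]}.
Variables (j : X -> Xm1) (A : operator X X) (C : X -> Y).
Hypotheses (gA : exists T, generates A T) (CX : bounded_X1 A C).
Variable e : extrapolation j A.

(** [C] as a bounded operator, after identification of the domain of [A] with
    [X] through the resolvent. *)
Definition observe (v : X) : Y := C (resolvent A (eb e) v).

Lemma observe_bounded : bounded_op observe.
Proof.
have [Clin [b [M [rb CM]]]] := CX; have re := eb_resolvent e.
have bR : bounded_op (resolvent A (eb e)) by case: re.
have lR : linear (resolvent A (eb e)) by case: bR.
split.
  move=> a u v; rewrite /observe lR Clin//; exact: (proj1 (resolventP _ re)).
have /bounded_opP[_ [L L0 TL]] :
    bounded_op (fun v => v + (b - eb e) *: resolvent A (eb e) v).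
  exact: bounded_add bounded_id (bounded_scale _ bR).
exists (`|M| * L%:C) => v.
have [d h] := resolventP v re; set x := resolvent A (eb e) v in d h *.
have {}CM : `|C x| <= M * `|b *: x - A x| by exact: CM.
have xE : b *: x - A x = v + (b - eb e) *: x.
  by rewrite -{1}h scalerBl; vec.
rewrite xE in CM; apply: (le_trans CM).
have k : `|v + (b - eb e) *: x| <= L%:C * `|v|.
  by rewrite !normC_rnorm -rmorphM lecR; exact: TL.
apply: (@le_trans _ _ (`|M| * `|v + (b - eb e) *: x|)).
  have M0 : 0 <= M * `|v + (b - eb e) *: x|.
    by apply: le_trans (normr_ge0 (C x)) CM.
  by rewrite -(ger0_norm M0) normrM normr_id.
by rewrite -mulrA ler_wpM2l.
Qed.

Lemma observeE p a : ext_op j A p = j a -> C p = observe (eb e *: p - a).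
Proof.
move=> h; rewrite /observe -(eRj e); congr C.
have lj : linear j by case: (j_bounded e).
rewrite (linB _ _ lj) (linZ _ _ lj) -h (ext_opE gA e).
have -> : eb e *: j p - (eb e *: j p - eL e p) = eL e p by vec.
by rewrite eRL.
Qed.

Let lO : linear (ext_op j A). Proof. by case: (ext_op_bounded gA e). Qed.
Let lj : linear j. Proof. by case: (j_bounded e). Qed.

Variables (b : R[i]) (bA : C_omega A b).

Lemma ext_op_resolvent v :
  ext_op j A (ext_resolvent j A b v) = b *: j (ext_resolvent j A b v) - v.
Proof.
have [_ h _] := ext_resolventP gA e bA; rewrite -{3}(h v).
by move: (_ *: _) (ext_op _ _ _) => *; vec.
Qed.

Lemma observe_state x w v : ext_op j A x = j w - v ->
  C (x - ext_resolvent j A b v) =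
  observe (eb e *: (x - ext_resolvent j A b v) - (w - b *: ext_resolvent j A b v)).
Proof.
move=> h; apply: observeE.
rewrite (linB _ _ lO) h ext_op_resolvent !(linB _ _ lj) (linZ _ _ lj).
by move: (j w) (_ *: _) => *; vec.
Qed.

Lemma observe_resolvent q :
  C (resolvent A b q) =
  observe (eb e *: ext_resolvent j A b (j q) - (b *: ext_resolvent j A b (j q) - q)).
Proof.
rewrite (resolvent_ext gA e _ bA); apply: observeE.
by rewrite ext_op_resolvent (linB _ _ lj) (linZ _ _ lj).
Qed.

Let bE : bounded_op (ext_resolvent j A b).
Proof. by case: (ext_resolventP gA e bA). Qed.

Lemma observe_resolvent_bounded : bounded_op (fun q => C (resolvent A b q)).
Proof.
have bEj := bounded_comp bE (j_bounded e).
rewrite (_ : (fun q => _) = (fun q => observe (eb e *: ext_resolvent j A b (j q) -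
    (b *: ext_resolvent j A b (j q) - q)))); last exact/funext/observe_resolvent.
apply: bounded_comp observe_bounded _.
apply: bounded_sub (bounded_scale _ bEj) _.
exact: bounded_sub (bounded_scale _ bEj) bounded_id.
Qed.

(** Local integrability allows integrals against test functions to be split. *)
Lemma observe_L1loc (x w : R -> X) (v : R -> Xm1) :
  L1loc x -> L1loc w -> L1loc v ->
  (forall t, 0 <= t -> ext_op j A (x t) = j (w t) - v t) ->
  L1loc (fun t => C (x t - ext_resolvent j A b (v t))).
Proof.
move=> lx lw lv h; have bC := observe_bounded.
have lr := L1loc_op bE lv; have bZ c := bounded_scale c (@bounded_id _ X).
have l1 := L1loc_op (bZ (eb e)) (L1loc_sub lx lr).
have l2 := L1loc_sub lw (L1loc_op (bZ b) lr).
apply: L1loc_ext (L1loc_op bC (L1loc_sub l1 l2)) => t t0.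
by rewrite (observe_state (h t t0)).
Qed.

End Observation.

Lemma regroup {R : realType} {E : completeNormedModType R[i]} (c : R[i])
    (x1 x2 w1 w2 q s1 s2 s3 p1 p2 p3 p4 : E) :
  c *: (x1 + x2 - s1) - (w1 + w2 - q - (p1 - p4)) =
  c *: (x1 - s2) - (w1 - p2) +
  (c *: (x2 - s3) - (w2 - p3) + (c *: s3 - (p3 - q))) +
  (c *: s2 - p2 + (p1 - c *: s1 - p4)).
Proof.
rewrite !scalerBr scalerDr.
move: (c *: x1) (c *: x2) (c *: s1) (c *: s2) (c *: s3) => *.
by vec.
Qed.

Lemma regroup_constant {V : zmodType} (y a c d g h : V) :
  y = a + c + d -> y + g = a + h + c + (d + (g - h)).
Proof.
move=> ->; rewrite -!addrA; congr (_ + _).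
rewrite [RHS]addrCA; congr (_ + _); rewrite [RHS]addrCA; congr (_ + _).
by rewrite addrCA subrr addr0.
Qed.

Section Perturbation.
#[local] Opaque ext_resolvent ext_op resolvent observe.

Context {R : realType} {U X Xm1 Y : completeNormedModType R[i]}.
Variables (j : X -> Xm1) (A : operator X X) (B : U -> Xm1) (C : X -> Y).
Variables (G Gt : R[i] -> U -> Y) (P : X -> X).
Local Notation AP := (perturb A P).

Hypotheses (nA : system_node j (Sigma A B C G)) (nP : system_node j (Sigma AP B C Gt)).
Hypothesis bP : bounded_op P.

Let gA : exists T, generates A T. Proof. by case: nA. Qed.
Let gP : exists T, generates AP T. Proof. by case: nP. Qed.
Let dj : dense (range j). Proof. by case: nA => _ []. Qed.
Let bB : bounded_op B. Proof. by case: nA. Qed.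
Let CX : bounded_X1 A C. Proof. by case: nA. Qed.

Variables (e : extrapolation j A) (eP : extrapolation j AP).
Let lj : linear j. Proof. by case: (j_bounded e). Qed.
Let lO : linear (ext_op j A). Proof. by case: (ext_op_bounded gA e). Qed.

Variables (b bp : R[i]).
Hypotheses (bA : C_omega A b) (bpA : C_omega AP bp).
Local Notation rho := (fun v : U => ext_resolvent j A b (B v)).
Local Notation rhop := (fun v : U => ext_resolvent j AP bp (B v)).
Local Notation CR := (observe C e).

Let brho : bounded_op rho.
Proof. by case: (ext_resolventP gA e bA) => h _ _; exact: bounded_comp h bB. Qed.
Let brhop : bounded_op rhop.
Proof. by case: (ext_resolventP gP eP bpA) => h _ _; exact: bounded_comp h bB. Qed.
Let bG : bounded_op (G b). Proof. by case: nA => _ _ _ _ [h _ _]; exact: h. Qed.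
Let bGt : bounded_op (Gt bp). Proof. by case: nP => _ _ _ _ [h _ _]; exact: h. Qed.
Let bCR : bounded_op CR. Proof. exact: observe_bounded CX e. Qed.
Let lCR : linear CR. Proof. by case: bCR. Qed.

Let ext_op_rhop v : ext_op j A (rhop v) = bp *: j (rhop v) - B v - j (P (rhop v)).
Proof.
have [_ h _] := ext_resolventP gP eP bpA; rewrite -{3}(h (B v)).
rewrite (ext_op_perturb gA gP e eP bP).
by move: (_ *: _) (ext_op _ _ _) (j (P _)) => p q r; vec.
Qed.

(** The feedthrough of the perturbed node differs from that of the given one by
    a bounded operator, on account of the additive constant in transfer functions
    and of the two base points. *)
Definition feedthrough_gap (v : U) : Y :=
  CR (eb e *: rho v - b *: rho v + (bp *: rhop v - eb e *: rhop v - P (rhop v))) +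
  (Gt bp v - G b v).

Lemma feedthrough_gap_bounded : bounded_op feedthrough_gap.
Proof.
apply: bounded_add (bounded_sub bGt bG); apply: bounded_comp bCR _.
apply: bounded_add.
  exact: bounded_sub (bounded_scale _ brho) (bounded_scale _ brho).
apply: bounded_sub (bounded_comp bP brhop).
exact: bounded_sub (bounded_scale _ brhop) (bounded_scale _ brhop).
Qed.

(** Each output is [observe] of a combination of a state and its derivative, plus
    a feedthrough term.  Here [x1] and [x2] are twice integrated states, driven by
    [v] and by [q], and [w1], [w2] are their derivatives. *)
Lemma observation_split (x1 x2 w1 w2 q : X) (v : U) :
  ext_op j A x1 = j w1 - B v -> ext_op j A x2 = j w2 - j q ->
  C (x1 + x2 - rhop v) + Gt bp v =
  (C (x1 - rho v) + G b v) +
  (C (x2 - ext_resolvent j A b (j q)) + C (resolvent A b q)) + feedthrough_gap v.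
Proof.
move=> h1 h2.
pose r3 := ext_resolvent j A b (j q); rewrite -/r3.
have E1 := observe_state C gA e bA h1.
have E2 := observe_state C gA e bA h2; rewrite -/r3 in E2.
have E3 := observe_resolvent C gA e bA q; rewrite -/r3 in E3.
clearbody r3.
have E4 : C (x1 + x2 - rhop v) =
    CR (eb e *: (x1 + x2 - rhop v) - (w1 + w2 - q - (bp *: rhop v - P (rhop v)))).
  apply: (observeE C gA).
  rewrite (linB _ _ lO) (linD _ _ lO) h1 h2 ext_op_rhop !(linB _ _ lj, linD _ _ lj, linZ _ _ lj).
  by move: (j w1) (j w2) (j q) (B v) (j (P _)) (bp *: _) => *; vec.
have E : CR (eb e *: (x1 + x2 - rhop v) - (w1 + w2 - q - (bp *: rhop v - P (rhop v)))) =
    CR (eb e *: (x1 - rho v) - (w1 - b *: rho v)) +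
    (CR (eb e *: (x2 - r3) - (w2 - b *: r3)) + CR (eb e *: r3 - (b *: r3 - q))) +
    CR (eb e *: rho v - b *: rho v + (bp *: rhop v - eb e *: rhop v - P (rhop v))).
  rewrite -!(linD _ _ lCR); congr CR.
  exact: regroup.
have F : C (x1 + x2 - rhop v) = C (x1 - rho v) + (C (x2 - r3) + C (resolvent A b q)) +
    CR (eb e *: rho v - b *: rho v + (bp *: rhop v - eb e *: rhop v - P (rhop v))).
  apply: (etrans E4); apply: (etrans E); congr (_ + _ + _); first exact: esym.
  by congr (_ + _); exact: esym.
exact: (regroup_constant _ _ F).
Qed.

End Perturbation.

(** * Solutions with zero initial state *)

Section Outputs.
Context {R : realType} {X Xm1 : completeNormedModType R[i]}.
Variables (j : X -> Xm1) (A : operator X X).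

Definition base_point : R[i] := xget 0 (C_omega A).

Lemma base_pointP : (exists T, generates A T) -> C_omega A base_point.
Proof. by move=> /C_omega_nonempty[z hz]; exact: (xgetPex 0 (ex_intro _ z hz)). Qed.

Lemma CDE {U Y : completeNormedModType R[i]} (B : U -> Xm1) (C : X -> Y)
    (G : R[i] -> U -> Y) x v :
  CD j (Sigma A B C G) (x, v) =
  C (x - ext_resolvent j A base_point (B v)) + G base_point v.
Proof. by []. Qed.

End Outputs.

Lemma eq_output {R : realType} {U X Xm1 Y : completeNormedModType R[i]} (j : X -> Xm1)
    (N : node_data U X Xm1 Y) (u : R -> U) (x y : R -> Xm1) :
  (forall t, 0 <= t -> x t = y t) -> output j N u x = output j N u y.
Proof.
move=> xy; have E t : state_primitive j x t = state_primitive j y t.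
  apply: (congr1 (fun q => xget 0 [set z | j z = q])).
  by apply: eq_bochner => s; rewrite inE/= in_itv/= => /andP[s0 _]; rewrite xy.
apply/funext => phi; apply: eq_complex_integral => t _.
by rewrite E.
Qed.

Section ZeroInitialState.
#[local] Opaque base_point.
Context {R : realType} {U X Xm1 Y : completeNormedModType R[i]}.
Variables (j : X -> Xm1) (A : operator X X) (B : U -> Xm1) (C : X -> Y) (G : R[i] -> U -> Y).
Local Notation N := (Sigma A B C G).
Hypotheses (gA : exists T, generates A T) (bB : bounded_op B).
Variable e : extrapolation j A.

Let lj : linear j. Proof. by case: (j_bounded e). Qed.
Let cS : c0_semigroup (ext_semigroup j A). Proof. by case: (ext_semigroupP gA e). Qed.

Lemma mild_generalised_solution u : L1loc u ->
  generalised_solution j N u (mild j A (fun s => B (u s))) (output j N u (mild j A (fun s => B (u s)))).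
Proof.
move=> lu; split=> //.
  exact: (mild_within gA e (L1loc_op bB lu)).
exists 0 => t t0; rewrite (lin0 lj) /= mildE.
case: cS => /(_ t t0)[lS _] _ _ _.
by rewrite (lin0 lS) add0r.
Qed.

Lemma generalised_solution_mild u x y : generalised_solution j N u x y -> x 0 = 0 ->
  forall t, 0 <= t -> x t = mild j A (fun s => B (u s)) t.
Proof.
move=> [lu _ [x0 /= xE] _] x00; case: cS => bS S0 _ _.
have j0 : j x0 = 0.
  have := xE 0 (lexx 0); rewrite mildE x00 S0 (mild_0 gA e (L1loc_op bB lu)) addr0.
  by move=> <-.
by move=> t t0; rewrite (xE t t0) mildE j0; case: (bS t t0) => lS _; rewrite (lin0 lS) add0r.
Qed.

Hypotheses (CX : bounded_X1 A C) (bG : bounded_op (G (base_point A))).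

Lemma CD_L1loc (x w : R -> X) (v : R -> U) : L1loc x -> L1loc w -> L1loc v ->
  (forall t, 0 <= t -> ext_op j A (x t) = j (w t) - B (v t)) ->
  L1loc (fun t => CD j N (x t, v t)).
Proof.
move=> lx lw lv h; have bA := base_pointP gA.
apply: L1loc_ext (L1loc_add (observe_L1loc gA CX e bA lx lw (L1loc_op bB lv) h) (L1loc_op bG lv)).
by move=> t _; rewrite CDE.
Qed.

End ZeroInitialState.

Section StateSplitting.
Context {R : realType} {X Xm1 : completeNormedModType R[i]}.
Variables (j : X -> Xm1) (A : operator X X) (P : X -> X).
Local Notation AP := (perturb A P).
Hypotheses (gA : exists T, generates A T) (gP : exists T, generates AP T).
Hypotheses (dj : dense (range j)) (bP : bounded_op P).
Variables (e : extrapolation j A) (eP : extrapolation j AP).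

Let lj : linear j. Proof. by case: (j_bounded e). Qed.

(** The perturbation [P w] of the primitive of the state is the primitive of [P z],
    and can be moved to the forcing. *)
Lemma integrated_perturb x f w z : L1loc f -> L1loc z ->
  integrated_solution j AP x f w -> (forall t, 0 <= t -> w t = prim z t) ->
  integrated_solution j A x (fun t => f t + j (P (z t))) w.
Proof.
move=> lf lz xw wz t t0; have [h1 h2] := xw t t0; split; first exact: h1.
have bjP := bounded_comp (j_bounded e) bP.
rewrite (prim_add t lf (L1loc_op bjP lz)) -(prim_op t bjP lz) -(wz t t0).
have := ext_op_perturb gA gP e eP bP (w t); rewrite h2.
by move: (x t) (prim f t) (j _) (ext_op _ _ _) => p q r s h; rewrite opprD addrA h addrK.
Qed.

(** Both sides solve the same integrated equation for [A], so uniqueness applies. *)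
Lemma mild_perturb f z w : L1loc f -> L1loc z ->
  integrated_solution j AP (mild j AP f) f w -> (forall t, 0 <= t -> w t = prim z t) ->
  exists w1 w2, [/\ integrated_solution j A (mild j A f) f w1,
    integrated_solution j A (mild j A (fun s => j (P (z s)))) (fun s => j (P (z s))) w2 &
    forall t, 0 <= t -> w t = w1 t + w2 t].
Proof.
move=> lf lz xw wz; have bjP := bounded_comp (j_bounded e) bP.
have lg := L1loc_op bjP lz.
have [w1 h1] := mild_integrated gA dj e lf; have [w2 h2] := mild_integrated gA dj e lg.
exists w1, w2; split=> // t t0.
have l1 := mild_L1loc gA e lf; have l2 := mild_L1loc gA e lg.
have h := integrated_add gA e l1 l2 lf lg h1 h2.
have h' := integrated_perturb lf lz xw wz.
have c1 := mild_continuous gA e lf; have c2 := mild_continuous gA e lg.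
have c12 : continuous (fun t : R => mild j A f (Num.max 0 t) +
    mild j A (fun s => j (P (z s))) (Num.max 0 t)).
  by move=> s; apply: cvgD; [exact: c1|exact: c2].
by have [] := integrated_unique gA dj e (mild_continuous gP eP lf) c12 h' h t0.
Qed.

End StateSplitting.

(** * Additive perturbations *)

Section OutputSplitting.
#[local] Opaque CD second_primitive state_primitive mild ext_op ext_resolvent resolvent base_point.
Context {R : realType} {U X Xm1 Y : completeNormedModType R[i]}.
Variables (j : X -> Xm1) (A : operator X X) (B : U -> Xm1) (C : X -> Y)
  (G Gt : R[i] -> U -> Y) (P : X -> X).
Local Notation AP := (perturb A P).
Local Notation N := (Sigma A B C G).
Local Notation NP := (Sigma AP B C Gt).
Local Notation NC := (Sigma A j C (fun z x => C (resolvent A z x))).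
Local Notation NI := (Sigma AP B id (fun z u => ext_resolvent j AP z (B u))).

Hypotheses (nA : system_node j N) (nP : system_node j NP) (bP : bounded_op P).

Let gA : exists T, generates A T. Proof. by case: nA. Qed.
Let gP : exists T, generates AP T. Proof. by case: nP. Qed.
Let dj : dense (range j). Proof. by case: nA => _ []. Qed.
Let bB : bounded_op B. Proof. by case: nA. Qed.
Let CX : bounded_X1 A C. Proof. by case: nA. Qed.

Variables (e : extrapolation j A) (eP : extrapolation j AP).

Let bA := base_pointP gA.
Let bPA := base_pointP gP.
Let bG : bounded_op (G (base_point A)).
Proof. by case: nA => _ _ _ _ [h _ _]; exact: h. Qed.

Definition gap : U -> Y := feedthrough_gap B C G Gt P e (base_point A) (base_point AP).

Lemma gap_bounded : bounded_op gap.
Proof. exact: (feedthrough_gap_bounded nA nP bP e eP bA bPA). Qed.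

(** Observing the state itself gives the second primitive of the output, so the
    state is the second primitive of a function, and the velocity its primitive. *)
Lemma state_output (u : R -> U) (x : R -> Xm1) (w : R -> X) (z : R -> X) :
  L1loc u -> L1loc z -> continuous (fun t : R => x (Num.max 0 t)) ->
  integrated_solution j AP x (fun s => B (u s)) w ->
  output j NI u x = distribution_of_fun z ->
  forall t, 0 <= t -> w t = prim z t.
Proof.
move=> lu lz cx xw xz; have lBu := L1loc_op bB lu.
have cw := integrated_continuous gP eP cx lBu xw.
have lw := integrated_L1loc gP eP cx lBu xw.
apply: prim_injective; [exact: cw|exact: prim_continuous|move=> t t0].
rewrite -(second_primitiveE t0 lz).
apply: (second_derivative_unique (D := prim w)); [exact: prim_continuous|exact: lz| |exact: t0].
move=> phi; rewrite -xz; apply: eq_complex_integral => s.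
rewrite /= in_itv/= andbT => s0.
by rewrite CDE (integrated_state gP eP cx lBu xw s0) subrK.
Qed.

(** The twice integrated states add up, and outputs are functions of them. *)
Lemma output_split (u : R -> U) (x : R -> Xm1) (w z : R -> X) :
  L1loc u -> L1loc z -> x = mild j AP (fun s => B (u s)) ->
  integrated_solution j AP x (fun s => B (u s)) w -> 
  (forall t, 0 <= t -> w t = prim z t) ->
  let x1 := mild j A (fun s => B (u s)) in
  let x2 := mild j A (fun s => j (P (z s))) in
  forall phi, output j NP u x phi =
    output j N u x1 phi + output j NC (fun s => P (z s)) x2 phi +
    distribution_of_fun (fun s => gap (u s)) phi.
Proof.
move=> lu lz -> xw wz x1 x2 phi; have lBu := L1loc_op bB lu.
have lPz := L1loc_op bP lz; have ljPz := L1loc_op (j_bounded e) lPz.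
have cx := mild_continuous gP eP lBu.
have [w1 [w2 [h1 h2 w12]]] := mild_perturb gA gP dj bP e eP lBu lz xw wz.
have c1 := mild_continuous gA e lBu; have c2 := mild_continuous gA e ljPz.
have lw := integrated_L1loc gP eP cx lBu xw.
have lw1 := integrated_L1loc gA e c1 lBu h1.
have lw2 := integrated_L1loc gA e c2 ljPz h2.
have bgap := gap_bounded.
have lsu := L1loc_second_primitive lu; have lsz := L1loc_second_primitive lPz.
have o1 t : 0 <= t -> ext_op j A (prim w1 t) = j (w1 t) - B (second_primitive u t).
  move=> t0; rewrite (integrated_twice gA e c1 lBu h1 t0).
  by rewrite (second_primitive_op bB lu t0).
have o2 t : 0 <= t ->
    ext_op j A (prim w2 t) = j (w2 t) - j (second_primitive (fun s => P (z s)) t).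
  move=> t0; rewrite (integrated_twice gA e c2 ljPz h2 t0).
  by rewrite (second_primitive_op (j_bounded e) lPz t0).
have l1 := CD_L1loc gA bB e CX bG (L1loc_prim lw1) lw1 lsu o1.
have bC := observe_resolvent_bounded gA CX e bA.
have l2 := CD_L1loc gA (j_bounded e) e CX
  (G := fun z x => C (resolvent A z x)) bC (L1loc_prim lw2) lw2 lsz o2.
have lg := L1loc_op bgap lsu.
rewrite -(jet_integral_second phi (L1loc_op bgap lu)).
transitivity (complex_integral `[0, +oo[ (fun t => jet phi 2 t
    (CD j N (prim w1 t, second_primitive u t) +
     CD j NC (prim w2 t, second_primitive (fun s => P (z s)) t) +
     gap (second_primitive u t)))).
  apply: eq_complex_integral => t; rewrite /= in_itv/= andbT => t0; congr (jet _ _ _ _).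
  rewrite (integrated_state gP eP cx lBu xw t0).
  have -> : prim w t = prim w1 t + prim w2 t.
    by rewrite -(prim_add t lw1 lw2); apply: eq_prim => s s0 _; exact: w12.
  rewrite !CDE.
  exact: (observation_split nA nP bP e eP bA bPA (o1 t t0) (o2 t t0)).
rewrite (jet_integral_add _ _ (L1loc_add l1 l2) lg) (jet_integral_add _ _ l1 l2).
congr (_ + _ + _); apply: eq_complex_integral => t; rewrite /= in_itv/= andbT => t0.
- by rewrite (integrated_state gA e c1 lBu h1 t0).
- by rewrite (integrated_state gA e c2 ljPz h2 t0).
- by rewrite (second_primitive_op bgap lu t0).
Qed.

End OutputSplitting.

Lemma distribution_of_fun_add {R : realType} {Y : completeNormedModType R[i]}
  (f g : R -> Y) (phi : test_function Y) : L1loc f -> L1loc g ->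
  distribution_of_fun (fun s => f s + g s) phi =
  distribution_of_fun f phi + distribution_of_fun g phi.
Proof. exact: jet_integral_add. Qed.

Theorem theorem6p7 (R : realType) (U X Xm1 Y : completeNormedModType R[i])
  (j : X -> Xm1) (A : operator X X) (B : U -> Xm1) (C : X -> Y)
  (G : R[i] -> U -> Y) (P : X -> X) :
  system_node j (Sigma A B C G) ->
  BIBO_stable j (Sigma A B C G) ->
  bounded_op P ->
  BIBO_stable j (Sigma (perturb A P) B id
    (fun z u => ext_resolvent j (perturb A P) z (B u))) ->
  BIBO_stable j (Sigma A j C (fun z x => C (resolvent A z x))) ->
  forall Gt : R[i] -> U -> Y,
    system_node j (Sigma (perturb A P) B C Gt) ->
    BIBO_stable j (Sigma (perturb A P) B C Gt).
Proof.
move=> nA [c1 c10 sA] bP [c2 c20 sI] [c3 c30 sC] Gt nP.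
have [gA xA bB _ _] := nA; have [gP xP _ _ _] := nP.
have [_ dj _] := xA.
have [e _] := extrapolation_exists gA xA; have [eP _] := extrapolation_exists gP xP.
have bE := gap_bounded nA nP bP e eP.
set E := gap _ _ _ _ _ _ in bE.
have /bounded_opP[_ [KP KP0 hP]] := bP; have /bounded_opP[_ [KE KE0 hE]] := bE.
exists (c1 + c3 * (KP * c2) + KE).
  by rewrite ltr_wpDr// ltr_wpDr// mulr_ge0 ?mulr_ge0 ?(ltW c20) ?(ltW c30).
move=> u x y gx lui x00.
have [lu _ _ yE] := gx.
have xm := generalised_solution_mild gP bB eP gx x00.
have lBu := L1loc_op bB lu.
have [z [lz zE zb]] : exists z : R -> X, [/\ Linftyloc z,
    output j (Sigma (perturb A P) B id
      (fun z u => ext_resolvent j (perturb A P) z (B u))) u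
      (mild j (perturb A P) (fun s => B (u s))) = distribution_of_fun z &
    forall t, 0 < t -> (Linfty_norm t z <= c2%:E * Linfty_norm t u)%E].
  apply: sI lui _; first exact: mild_generalised_solution.
  exact: mild_0.
have lz1 := Linftyloc_L1loc lz.
have [w xw] := mild_integrated gP dj eP lBu.
have wz := state_output nA nP eP lu lz1 (mild_continuous gP eP lBu) xw zE.
have lPz := Linftyloc_op bP lz; have lPz1 := L1loc_op bP lz1.
have [f1 [lf1 f1E f1b]] := sA _ _ _ (mild_generalised_solution C G gA bB e lu) lui
  (mild_0 gA e lBu).
have [f3 [lf3 f3E f3b]] := sC _ _ _
  (mild_generalised_solution C (fun z x => C (resolvent A z x)) gA (j_bounded e) e lPz1) lPz
  (mild_0 gA e (L1loc_op (j_bounded e) lPz1)).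
have lEu := Linftyloc_op bE lui.
exists (fun t => f1 t + f3 t + E (u t)); split.
- by apply: Linftyloc_add => //; exact: Linftyloc_add.
- have lf13 : L1loc (fun t => f1 t + f3 t).
    by apply: L1loc_add; exact: Linftyloc_L1loc.
  apply/funext => phi.
  rewrite (distribution_of_fun_add phi lf13 (Linftyloc_L1loc lEu)).
  rewrite (distribution_of_fun_add phi (Linftyloc_L1loc lf1) (Linftyloc_L1loc lf3)).
  rewrite -f1E -f3E -(output_split nA nP bP e eP lu lz1 erefl xw wz phi) yE.
  by rewrite (eq_output _ _ _ xm).
- move=> t t0; have [M M0 uM] := Linfty_norm_fin t0 lui.
  have zM : (Linfty_norm t z <= (c2 * M)%:E)%E by rewrite EFinM -uM; exact: zb.
  have PzM := Linfty_norm_op KP0 (mulr_ge0 (ltW c20) M0) hP zM.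
  have f1M : (Linfty_norm t f1 <= (c1 * M)%:E)%E by rewrite EFinM -uM; exact: f1b.
  have f3M : (Linfty_norm t f3 <= (c3 * (KP * (c2 * M)))%:E)%E.
    apply: le_trans (f3b t t0) _; rewrite [leRHS]EFinM.
    by apply: lee_wpmul2l => //; rewrite lee_fin ltW.
  have EuM : (Linfty_norm t (fun s => E (u s)) <= (KE * M)%:E)%E.
    by apply: Linfty_norm_op => //; rewrite uM.
  have a1 := mulr_ge0 (ltW c10) M0.
  have a3 := mulr_ge0 (ltW c30) (mulr_ge0 KP0 (mulr_ge0 (ltW c20) M0)).
  have h := Linfty_norm_add (addr_ge0 a1 a3) (mulr_ge0 KE0 M0)
    (Linfty_norm_add a1 a3 f1M f3M) EuM.
  apply: le_trans h _; rewrite uM -EFinM lee_fin le_eqVlt; apply/orP; left; apply/eqP.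
  by ring.
Qed.
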